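(* Let $X$ be a Banach space which is a subspace of $\mathrm{Hol}(\mathbb{D})$ with continuous inclusion, such that: (i) $e_0\in X$; (ii) if $f,f_1\in\mathrm{Hol}(\mathbb{D})$ with $f=e_1f_1$, then $f\in X$ if and only if $f_1\in X$; (iii) if $f\in X$ then $z\mapsto f(\beta' z)$ belongs to $X$ for all $\beta'\in\mathbb{T}$. Let $m\in\mathrm{Hol}(\mathbb{D})$ with $mf\in X$ for all $f\in X$, let $\beta\in\mathbb{C}$ with $|\beta|=1$ and $\beta^n\neq1$ for all $n\in\mathbb{N}$, and let $T_X\in\mathcal{L}(X)$ be defined by $(T_Xf)(z)=m(z)f(\beta z)$. Assume there exists $z_0\in\mathbb{D}$ with $m(z_0)=0$. Then $\sigma(T_X)=\{\lambda\in\mathbb{C}:|\lambda|\leq r_\sigma(T_X)\}$.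
   Context: $\mathbb{D}$ is the open unit disc, $\mathbb{T}=\{\lambda\in\mathbb{C}:|\lambda|=1\}$, $\mathrm{Hol}(\mathbb{D})$ is the Fréchet space of holomorphic functions on $\mathbb{D}$ with the topology of uniform convergence on compact subsets, $e_k(z)=z^k$. $\sigma(T_X)$ is the spectrum of the bounded operator $T_X$ on the Banach space $X$ and $r_\sigma(T_X)$ its spectral radius. *)

(* Defs.v *)
From Stdlib Require Import Reals.
From Coquelicot Require Import Coquelicot.
Open Scope C_scope.

(* functions on the unit disc D are represented by functions C -> C;
   only their values on D matter (equality "on D") *)
Definition inD (z : C) : Prop := (Cmod z < 1)%R.

Definition eqD (f g : C -> C) : Prop := forall z, inD z -> f z = g z.

Definition holD (f : C -> C) : Prop :=
  forall z, inD z -> ex_derive (K := C_AbsRing) (V := C_NormedModule) f z.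

Definition fadd (f g : C -> C) : C -> C := fun z => f z + g z.
Definition fscal (a : C) (f : C -> C) : C -> C := fun z => a * f z.
Definition fzero : C -> C := fun _ => 0.

Definition banach_subspace_Hol (X : (C -> C) -> Prop) (N : (C -> C) -> R) : Prop :=
  (forall f, X f -> holD f) /\
  (forall f g, X f -> eqD f g -> X g /\ N g = N f) /\
  X fzero /\
  (forall f g, X f -> X g -> X (fadd f g)) /\
  (forall a f, X f -> X (fscal a f)) /\
  (forall f, X f -> (0 <= N f)%R) /\
  (forall f, X f -> (N f = 0%R <-> eqD f fzero)) /\
  (forall f g, X f -> X g -> (N (fadd f g) <= N f + N g)%R) /\
  (forall a f, X f -> N (fscal a f) = (Cmod a * N f)%R) /\
  (forall u : nat -> C -> C, (forall n, X (u n)) ->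
     (forall eps : R, (0 < eps)%R -> exists n0, forall p q, (n0 <= p)%nat -> (n0 <= q)%nat ->
          (N (fadd (u p) (fscal (-1) (u q))) < eps)%R) ->
     exists g, X g /\ forall eps : R, (0 < eps)%R -> exists n0, forall n, (n0 <= n)%nat ->
          (N (fadd (u n) (fscal (-1) g)) < eps)%R) /\
  (* continuous inclusion into Hol(D) (topology of uniform convergence on
     compacta, generated by the sup-seminorms over the discs |z| <= r < 1) *)
  (forall r : R, (0 <= r)%R -> (r < 1)%R -> exists c : R,
     forall f, X f -> forall z, (Cmod z <= r)%R -> (Cmod (f z) <= c * N f)%R).

Definition bounded_op (X : (C -> C) -> Prop) (N : (C -> C) -> R)
    (S : (C -> C) -> (C -> C)) : Prop :=
  (forall f, X f -> X (S f)) /\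
  (forall f g, X f -> eqD f g -> eqD (S f) (S g)) /\
  (forall a f g, X f -> X g -> eqD (S (fadd f (fscal a g))) (fadd (S f) (fscal a (S g)))) /\
  (exists c : R, forall f, X f -> (N (S f) <= c * N f)%R).

Definition invertible_op (X : (C -> C) -> Prop) (N : (C -> C) -> R)
    (A : (C -> C) -> (C -> C)) : Prop :=
  exists S, bounded_op X N S /\
    forall f, X f -> eqD (S (A f)) f /\ eqD (A (S f)) f.

Definition spectrum (X : (C -> C) -> Prop) (N : (C -> C) -> R)
    (A : (C -> C) -> (C -> C)) (lam : C) : Prop :=
  ~ invertible_op X N (fun f => fadd (A f) (fscal (- lam) f)).

Definition spectral_radius (X : (C -> C) -> Prop) (N : (C -> C) -> R)
    (A : (C -> C) -> (C -> C)) : Rbar :=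
  Lub_Rbar (fun x => exists lam, spectrum X N A lam /\ x = Cmod lam).

Definition wcomp (m : C -> C) (beta : C) : (C -> C) -> (C -> C) :=
  fun f z => m z * f (beta * z).

(* Main.v *)
(* Let V be multiplication by the coordinate. Then T V = beta V T and V X is the hyperplane
   {f(0) = 0}, so if T - mu is invertible then so is T - mu / beta. Since the resolvent set is
   open and the powers of beta are dense in the unit circle, a circle that meets the resolvent
   set lies in it entirely.

   Suppose that the circle |mu| = r is in the resolvent set. Averaging -mu (T - mu)^-1 f over the
   L-th roots of r^L gives h_L with T^L h_L = r^L (h_L - f), and along L = 2^j the h_L converge in
   X to the integral h over the circle. A function in the range of T^L vanishes at z0 beta^-k
   for k < L (to order L at 0 if z0 = 0), so h - f vanishes identically. Hence h = f, the same
   averages bound T^n by c r^n, and the spectrum is contained in {|mu| <= r}. *)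

Require Import Defs.
From Stdlib Require Import Reals Lra Lia Psatz List.
From Stdlib Require Import ClassicalEpsilon IndefiniteDescription.
From Coquelicot Require Import Coquelicot.
Open Scope C_scope.

(** * Continuity, complex differentiability and integrals of complex-valued functions *)

(** The averages over the roots of r^L replace the Riesz projection of f, which is the integral of
    (mu - T)^-1 f over the circle divided by 2 pi i. Finite sums stay in X and obey exact
    identities: the powers mu^p sum to 0 over the L nodes for 0 < p < L, so T^n acts by inserting
    the factor mu^n. From L to 2L each new node is paired with a neighbour; the resolvent is
    Lipschitz on the circle, so the step is O(1/L), which is geometric along L = 2^j.

    The theorem follows by contradiction: if |lam| <= r_sigma and lam were in the resolvent set,
    openness would give a circle of radius r < |lam| in it, and then r_sigma <= r. The case lam = 0
    is apart: the range of T consists of functions that vanish at z0, so it misses the constant 1.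

    Two classical facts carry the rest. Invertibility asks for a bounded inverse, so bijectivity has
    to be upgraded by the bounded inverse theorem. The identity V X = {f(0) = 0} rests on a
    removable singularity at 0, hence on Cauchy's formula; all circles used are centred at 0, so
    Goursat's theorem on polar rectangles is enough. *)

Definition cont_at {A : Type} (d : A -> A -> R) (f : A -> C) (x : A) : Prop :=
  forall eps : R, (0 < eps)%R -> exists del : R, (0 < del)%R /\
    forall y, (d x y < del)%R -> (Cmod (f y - f x) < eps)%R.

Definition dC (x y : C) : R := Cmod (y - x).
Definition dR (x y : R) : R := Rabs (y - x).

Lemma Cmod_sub_sym (a b : C) : Cmod (a - b) = Cmod (b - a).
Proof. rewrite <- (Cmod_opp (b - a)). f_equal. ring. Qed.

Lemma cont_at_ext {A} d (f g : A -> C) x :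
  (forall y, f y = g y) -> cont_at d f x -> cont_at d g x.
Proof.
  intros H Hf eps He. destruct (Hf eps He) as [del [Hd K]].
  exists del; split; auto. intros y Hy. rewrite <- !H. auto.
Qed.

Lemma cont_at_const {A} d (c : C) (x : A) : cont_at d (fun _ => c) x.
Proof.
  intros eps He. exists 1%R. split; [lra|]. intros y _.
  replace (c - c) with (RtoC 0) by ring. rewrite Cmod_0. lra.
Qed.

Lemma cont_at_id (z : C) : cont_at dC (fun y => y) z.
Proof. intros eps He. exists eps. split; auto. Qed.

Lemma cont_at_plus {A} d (f g : A -> C) x :
  cont_at d f x -> cont_at d g x -> cont_at d (fun y => f y + g y) x.
Proof.
  intros Hf Hg eps He.
  destruct (Hf (eps/2)%R) as [d1 [Hd1 K1]]; [lra|].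
  destruct (Hg (eps/2)%R) as [d2 [Hd2 K2]]; [lra|].
  exists (Rmin d1 d2). split; [apply Rmin_pos; auto|]. intros y Hy.
  assert (d x y < d1 /\ d x y < d2)%R as [H1 H2].
  { split; eapply Rlt_le_trans; eauto; [apply Rmin_l|apply Rmin_r]. }
  replace (f y + g y - (f x + g x)) with ((f y - f x) + (g y - g x)) by ring.
  eapply Rle_lt_trans; [apply Cmod_triangle|].
  specialize (K1 y H1). specialize (K2 y H2). lra.
Qed.

Lemma cont_at_mult {A} d (f g : A -> C) x :
  cont_at d f x -> cont_at d g x -> cont_at d (fun y => f y * g y) x.
Proof.
  intros Hf Hg eps He.
  set (M := (1 + Cmod (f x) + Cmod (g x))%R).
  assert (HM : (1 <= M)%R).
  { unfold M. pose proof (Cmod_ge_0 (f x)). pose proof (Cmod_ge_0 (g x)). lra. }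
  (* With [e <= 1] the product of the two increments is at most [e], which is what the summand 1 in
     [M] pays for. *)
  set (e := Rmin 1 (eps / M)).
  assert (Hpos : (0 < eps / M)%R) by (apply Rdiv_lt_0_compat; lra).
  assert (He0 : (0 < e)%R) by (apply Rmin_pos; lra).
  assert (He1 : (e <= 1)%R) by apply Rmin_l.
  assert (He2 : (e * M <= eps)%R).
  { apply Rle_trans with (eps / M * M)%R.
    - apply Rmult_le_compat_r; [lra|apply Rmin_r].
    - right; field; lra. }
  destruct (Hf e) as [d1 [Hd1 K1]]; [lra|].
  destruct (Hg e) as [d2 [Hd2 K2]]; [lra|].
  exists (Rmin d1 d2). split; [apply Rmin_pos; auto|]. intros y Hy.
  assert (d x y < d1 /\ d x y < d2)%R as [H1 H2].
  { split; eapply Rlt_le_trans; eauto; [apply Rmin_l|apply Rmin_r]. }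
  specialize (K1 y H1). specialize (K2 y H2).
  replace (f y * g y - f x * g x)
    with ((f y - f x) * (g y - g x) + (f x * (g y - g x) + (f y - f x) * g x)) by ring.
  eapply Rle_lt_trans; [apply Cmod_triangle|].
  eapply Rle_lt_trans; [apply Rplus_le_compat_l, Cmod_triangle|].
  rewrite !Cmod_mult.
  pose proof (Cmod_ge_0 (f x)) as F. pose proof (Cmod_ge_0 (g x)) as G.
  pose proof (Cmod_ge_0 (f y - f x)) as F'. pose proof (Cmod_ge_0 (g y - g x)) as G'.
  unfold M in *. nra.
Qed.

Lemma cont_at_opp {A} d (f : A -> C) x : cont_at d f x -> cont_at d (fun y => - f y) x.
Proof.
  intros H. apply (cont_at_ext d (fun y => (-(1)) * f y)); [intro; ring|].
  apply cont_at_mult; auto. apply cont_at_const.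
Qed.

Lemma cont_at_minus {A} d (f g : A -> C) x :
  cont_at d f x -> cont_at d g x -> cont_at d (fun y => f y - g y) x.
Proof. intros. apply cont_at_plus; auto. now apply cont_at_opp. Qed.

Lemma cont_at_inv {A} d (f : A -> C) x :
  f x <> 0 -> cont_at d f x -> cont_at d (fun y => / f y) x.
Proof.
  intros Hx Hf eps He.
  assert (Hc : (0 < Cmod (f x))%R) by now apply Cmod_gt_0.
  set (c := Cmod (f x)) in *.
  (* The bound [c / 2] forces |f y| >= c/2, so |f y| |f x| >= c^2/2; the second bound carries
     exactly this factor. *)
  set (e := Rmin (c / 2) (eps * (c * c / 2))).
  assert (P : (0 < eps * (c * c / 2))%R) by (apply Rmult_lt_0_compat; nra).
  assert (He0 : (0 < e)%R) by (apply Rmin_pos; lra).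
  destruct (Hf e He0) as [del [Hd K]]. exists del. split; auto.
  intros y Hy. specialize (K y Hy).
  assert (K1 : (Cmod (f y - f x) < c / 2)%R) by (eapply Rlt_le_trans; [exact K|apply Rmin_l]).
  assert (K2 : (Cmod (f y - f x) < eps * (c * c / 2))%R)
    by (eapply Rlt_le_trans; [exact K|apply Rmin_r]).
  assert (Hy2 : (c / 2 <= Cmod (f y))%R).
  { assert (T : (c <= Cmod (f y) + Cmod (f x - f y))%R).
    { unfold c. replace (f x) with (f y + (f x - f y)) at 1 by ring. apply Cmod_triangle. }
    rewrite Cmod_sub_sym in T. lra. }
  assert (Hfy : f y <> 0) by (apply Cmod_gt_0; lra).
  replace (/ f y - / f x) with (- ((f y - f x) / (f y * f x))).
  2: { field. auto. }
  rewrite Cmod_opp, Cmod_div, Cmod_mult by (apply Cmult_neq_0; auto).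
  fold c. apply Rmult_lt_reg_r with (Cmod (f y) * c)%R; [nra|].
  unfold Rdiv. rewrite Rmult_assoc, Rinv_l, Rmult_1_r by nra.
  eapply Rlt_le_trans; [exact K2|].
  apply Rmult_le_compat_l; nra.
Qed.

Lemma cont_at_comp {A B} dA dB (g : A -> B) (f : B -> C) x :
  (forall eps, (0 < eps)%R -> exists del, (0 < del)%R /\
     forall y, (dA x y < del)%R -> (dB (g x) (g y) < eps)%R) ->
  cont_at dB f (g x) -> cont_at dA (fun y => f (g y)) x.
Proof.
  intros Hg Hf eps He. destruct (Hf eps He) as [d1 [H1 K1]].
  destruct (Hg d1 H1) as [d2 [H2 K2]]. exists d2. split; auto.
Qed.

Lemma cont_at_compC {A} d (g : A -> C) (f : C -> C) x :
  cont_at d g x -> cont_at dC f (g x) -> cont_at d (fun y => f (g y)) x.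
Proof. intros Hg Hf. apply (cont_at_comp d dC); auto. Qed.

Lemma cont_at_ext_loc (f g : C -> C) z (del : R) :
  (0 < del)%R -> (forall y, (Cmod (y - z) < del)%R -> f y = g y) ->
  cont_at dC f z -> cont_at dC g z.
Proof.
  intros Hd E Hf eps He. destruct (Hf eps He) as [d1 [H1 K1]].
  exists (Rmin del d1). split; [apply Rmin_pos; auto|]. unfold dC in *. intros y Hy.
  rewrite <- !E; auto.
  - apply K1. eapply Rlt_le_trans; [exact Hy|apply Rmin_r].
  - replace (z - z) with (RtoC 0) by ring. now rewrite Cmod_0.
  - eapply Rlt_le_trans; [exact Hy|apply Rmin_l].
Qed.

(* Caratheodory's form of complex differentiability: it reduces the product and
   quotient rules to continuity. *)
Definition cdiff (f : C -> C) (z : C) : Prop :=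
  exists phi : C -> C, cont_at dC phi z /\ forall y, f y = f z + phi y * (y - z).

Lemma cdiff_cont (f : C -> C) (z : C) : cdiff f z -> cont_at dC f z.
Proof.
  intros [phi [Hp E]].
  apply (cont_at_ext dC (fun y => f z + phi y * (y - z))); [intro; now rewrite <- E|].
  apply cont_at_plus; [apply cont_at_const|]. apply cont_at_mult; auto.
  apply cont_at_minus; [apply cont_at_id|apply cont_at_const].
Qed.

(** The slope identity is required at every [y], not only near [z], so far from [z] the slope is
    redefined as the difference quotient of [g]. *)
Lemma cdiff_ext_loc (f g : C -> C) (z : C) (del : R) :
  (0 < del)%R -> (forall y, (Cmod (y - z) < del)%R -> f y = g y) -> cdiff f z -> cdiff g z.
Proof.
  intros Hd E [phi [Hp Ef]].
  assert (Ez : f z = g z).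
  { apply E. replace (z - z) with (RtoC 0) by ring. now rewrite Cmod_0. }
  exists (fun y => if Rlt_dec (Cmod (y - z)) del then phi y else (g y - g z) / (y - z)).
  split.
  - apply (cont_at_ext_loc phi _ z del); auto.
    intros y Hy. destruct Rlt_dec; auto; contradiction.
  - intros y. destruct Rlt_dec as [H|H].
    + rewrite <- E by auto. rewrite Ef. now rewrite <- Ez.
    + assert (y - z <> 0). { intros K. apply H. rewrite K, Cmod_0. auto. }
      field; auto.
Qed.

Lemma cdiff_ext (f g : C -> C) (z : C) : (forall y, f y = g y) -> cdiff f z -> cdiff g z.
Proof. intros E. apply (cdiff_ext_loc f g z 1%R Rlt_0_1). auto. Qed.

Lemma cdiff_const (c z : C) : cdiff (fun _ => c) z.
Proof. exists (fun _ => 0). split; [apply cont_at_const|intro; ring]. Qed.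

Lemma cdiff_id (z : C) : cdiff (fun y => y) z.
Proof. exists (fun _ => 1). split; [apply cont_at_const|intro; ring]. Qed.

Lemma cdiff_plus (f g : C -> C) (z : C) : cdiff f z -> cdiff g z -> cdiff (fun y => f y + g y) z.
Proof.
  intros [p [Hp Ep]] [q [Hq Eq]]. exists (fun y => p y + q y).
  split; [now apply cont_at_plus|]. intros y. rewrite (Ep y), (Eq y). ring.
Qed.

Lemma cdiff_mult (f g : C -> C) (z : C) : cdiff f z -> cdiff g z -> cdiff (fun y => f y * g y) z.
Proof.
  intros Hf Hg. pose proof (cdiff_cont _ _ Hg) as Cg.
  destruct Hf as [p [Hp Ep]], Hg as [q [Hq Eq]].
  exists (fun y => p y * g y + f z * q y). split.
  - apply cont_at_plus; apply cont_at_mult; auto. apply cont_at_const.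
  - intros y.
    transitivity (f z * g z + (p y * (y - z)) * g y + f z * (q y * (y - z))); [|ring].
    replace (p y * (y - z)) with (f y - f z) by (rewrite (Ep y); ring).
    replace (q y * (y - z)) with (g y - g z) by (rewrite (Eq y); ring). ring.
Qed.

Lemma cdiff_minus (f g : C -> C) (z : C) : cdiff f z -> cdiff g z -> cdiff (fun y => f y - g y) z.
Proof.
  intros Hf Hg. apply (cdiff_ext_loc (fun y => f y + (-(1)) * g y) _ z 1%R Rlt_0_1).
  { intros; ring. }
  apply cdiff_plus; auto. apply cdiff_mult; auto. apply cdiff_const.
Qed.

Lemma cdiff_inv (f : C -> C) (z : C) : f z <> 0 -> cdiff f z -> cdiff (fun y => / f y) z.
Proof.
  intros Hz Hf. pose proof (cdiff_cont _ _ Hf) as Cf.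
  destruct (Cf (Cmod (f z))) as [del [Hd K]]; [apply Cmod_gt_0; exact Hz|].
  assert (NZ : forall y, (Cmod (y - z) < del)%R -> f y <> 0).
  { intros y Hy E. specialize (K y Hy). rewrite E in K.
    replace (0 - f z) with (- f z) in K by ring. rewrite Cmod_opp in K. lra. }
  destruct Hf as [p [Hp Ep]].
  (* Far from [z] the function [f] may vanish; there 1/f is replaced by the value that the slope
     formula predicts, so that the formula holds everywhere. *)
  apply (cdiff_ext_loc (fun y => if Rlt_dec (Cmod (y - z)) del then / f y
     else / f z + - p y * (/ f y * / f z) * (y - z)) _ z del Hd).
  { intros y Hy. destruct Rlt_dec; auto; contradiction. }
  exists (fun y => - p y * (/ f y * / f z)). split.
  - apply cont_at_mult; [now apply cont_at_opp|].
    apply cont_at_mult; [|apply cont_at_const]. now apply cont_at_inv.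
  - intros y. destruct (Rlt_dec (Cmod (z - z)) del) as [_|H].
    2: { exfalso; apply H. replace (z - z) with (RtoC 0) by ring. now rewrite Cmod_0. }
    destruct Rlt_dec as [H|H]; auto. pose proof (NZ y H) as Hy.
    assert (P : p y * (y - z) = f y - f z) by (rewrite (Ep y); ring).
    transitivity (/ f z + - (p y * (y - z)) * (/ f y * / f z)); [|ring].
    rewrite P. field. auto.
Qed.

Lemma cdiff_div (f g : C -> C) (z : C) : g z <> 0 -> cdiff f z -> cdiff g z -> cdiff (fun y => f y / g y) z.
Proof. intros. apply cdiff_mult; auto. now apply cdiff_inv. Qed.

Lemma cdiff_pow (n : nat) (z : C) : cdiff (fun y => y ^ n) z.
Proof.
  induction n as [|n IH].
  - apply (cdiff_ext (fun _ => 1)); [reflexivity|apply cdiff_const].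
  - apply (cdiff_ext (fun y => y * y ^ n)); [intro; now rewrite Cpow_S|].
    apply (cdiff_mult (fun y => y) (fun y => y ^ n)); [apply cdiff_id|exact IH].
Qed.

Lemma cdiff_iff_ex_derive (f : C -> C) (z : C) :
  cdiff f z <-> ex_derive (K := C_AbsRing) (V := C_NormedModule) f z.
Proof.
  split.
  - intros [phi [Hp E]]. exists (phi z). split; [apply is_linear_scal_l|].
    intros x Hx eps.
    apply (is_filter_lim_locally_unique (V := AbsRing_NormedModule C_AbsRing)) in Hx. subst x.
    destruct (Hp eps (cond_pos eps)) as [del [Hd K]].
    exists (mkposreal del Hd). intros y Hy.
    change (Cmod (y - z) < del)%R in Hy.
    change (Cmod ((f y - f z) - (y - z) * phi z) <= eps * Cmod (y - z))%R.
    rewrite (E y). replace (f z + phi y * (y - z) - f z - (y - z) * phi z)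
      with ((phi y - phi z) * (y - z)) by ring.
    rewrite Cmod_mult. apply Rmult_le_compat_r; [apply Cmod_ge_0|]. left. apply K, Hy.
  - intros [l [_ H]].
    exists (fun y => if excluded_middle_informative (y = z) then l else (f y - f z) / (y - z)).
    split.
    + intros eps He. specialize (H z (fun P HP => HP) (pos_div_2 (mkposreal eps He))).
      destruct H as [del K]. exists del. split; [apply cond_pos|]. intros y Hy.
      destruct (excluded_middle_informative (z = z)) as [_|N]; [|now destruct N].
      destruct excluded_middle_informative as [->|N].
      { replace (l - l) with (RtoC 0) by ring. now rewrite Cmod_0. }
      specialize (K y Hy).
      change (Cmod ((f y - f z) - (y - z) * l) <= eps / 2 * Cmod (y - z))%R in K.
      assert (N' : y - z <> 0).
      { intros Q. apply N. replace y with ((y - z) + z) by ring. rewrite Q. ring. }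
      replace ((f y - f z) / (y - z) - l) with (((f y - f z) - (y - z) * l) / (y - z))
        by (field; auto).
      rewrite Cmod_div by auto. apply Cmod_gt_0 in N'.
      apply Rle_lt_trans with (eps / 2)%R; [|lra].
      apply Rmult_le_reg_r with (Cmod (y - z)); auto.
      unfold Rdiv at 1. rewrite Rmult_assoc, Rinv_l, Rmult_1_r by lra. exact K.
    + intros y. destruct excluded_middle_informative as [->|N]; [ring|].
      field. intros Q. apply N. replace y with ((y - z) + z) by ring. rewrite Q. ring.
Qed.

(** * Polar coordinates *)

Definition cis (t : R) : C := (cos t, sin t).

Definition polar (r t : R) : C := RtoC r * cis t.

Lemma Cmod_cis t : Cmod (cis t) = 1%R.
Proof.
  unfold Cmod, cis; simpl. replace (cos t * (cos t * 1) + sin t * (sin t * 1))%R with 1%R.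
  - apply sqrt_1.
  - pose proof (sin2_cos2 t) as H. unfold Rsqr in H. lra.
Qed.

Lemma cis_neq_0 t : cis t <> 0.
Proof. apply Cmod_gt_0. rewrite Cmod_cis. lra. Qed.

Lemma cis_plus s t : cis (s + t) = cis s * cis t.
Proof. unfold cis, Cmult; simpl. rewrite cos_plus, sin_plus. f_equal; ring. Qed.

Lemma cis_0 : cis 0 = 1.
Proof. unfold cis. now rewrite cos_0, sin_0. Qed.

Lemma cis_2PI : cis (2 * PI) = 1.
Proof. unfold cis. now rewrite cos_2PI, sin_2PI. Qed.

Lemma cis_pow t n : cis t ^ n = cis (INR n * t).
Proof.
  induction n as [|n IH]; [simpl; now rewrite Rmult_0_l, cis_0|].
  rewrite Cpow_S, IH, <- cis_plus, S_INR. f_equal. ring.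
Qed.

(** After a rotation this is |e^(iu) - 1| = 2 |sin(u/2)| <= |u|. *)
Lemma cis_lipschitz s t : (Cmod (cis s - cis t) <= Rabs (s - t))%R.
Proof.
  assert (H : forall u, (Cmod (cis u - 1) <= Rabs u)%R).
  { intros u. unfold Cmod. apply Rsqr_incr_0_var; [|apply Rabs_pos].
    rewrite Rsqr_sqrt by (apply Rplus_le_le_0_compat; apply pow2_ge_0).
    rewrite <- Rsqr_abs. unfold cis; simpl. unfold Rsqr.
    replace u with (2 * (u / 2))%R at 1 2 3 4 by field.
    rewrite cos_2a_sin, sin_2a.
    set (v := (u / 2)%R). replace u with (2 * v)%R by (unfold v; field).
    pose proof (sin2_cos2 v) as SC. unfold Rsqr in SC.
    assert (S : (sin v * sin v <= v * v)%R).
    { destruct (Rle_dec 0 v) as [Hv|Hv].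
      - pose proof (SIN_bound v). destruct (Req_dec v 0) as [->|]; [rewrite sin_0; lra|].
        destruct (Rle_dec v 1).
        + pose proof (sin_lt_x v ltac:(lra)).
          pose proof (sin_ge_0 v Hv ltac:(pose proof PI2_1; lra)). nra.
        + nra.
      - pose proof (SIN_bound v). destruct (Rle_dec (-1) v).
        + pose proof (sin_lt_x (- v) ltac:(lra)) as A.
          pose proof (sin_ge_0 (- v) ltac:(lra) ltac:(pose proof PI2_1; lra)) as B.
          rewrite sin_neg in A, B. nra.
        + nra. }
    replace ((1 - 2 * sin v * sin v + - (1)) * ((1 - 2 * sin v * sin v + - (1)) * 1) +
      (2 * sin v * cos v + - 0) * ((2 * sin v * cos v + - 0) * 1))%R
      with (4 * (sin v * sin v) * (sin v * sin v + cos v * cos v))%R by ring.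
    rewrite SC. lra. }
  replace (cis s - cis t) with (cis t * (cis (s - t) - 1)).
  - rewrite Cmod_mult, Cmod_cis, Rmult_1_l. apply H.
  - replace s with ((s - t) + t)%R at 2 by ring. rewrite cis_plus. ring.
Qed.

Lemma Cmod_polar r t : Cmod (polar r t) = Rabs r.
Proof. unfold polar. rewrite Cmod_mult, Cmod_cis, Cmod_R. ring. Qed.

Lemma polar_dist r t r' t' :
  (Cmod (polar r t - polar r' t') <= Rabs (r - r') + Rabs r' * Rabs (t - t'))%R.
Proof.
  replace (polar r t - polar r' t')
    with (RtoC (r - r') * cis t + RtoC r' * (cis t - cis t')).
  - eapply Rle_trans; [apply Cmod_triangle|]. rewrite !Cmod_mult, Cmod_cis, !Cmod_R.
    apply Rplus_le_compat; [lra|]. apply Rmult_le_compat_l; [apply Rabs_pos|apply cis_lipschitz].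
  - unfold polar. rewrite RtoC_minus. ring.
Qed.

Lemma cis_surj (z : C) : Cmod z = 1%R -> exists t, (- PI <= t <= PI)%R /\ z = cis t.
Proof.
  destruct z as [x y]. unfold Cmod; simpl. intros H.
  assert (E : (x * x + y * y = 1)%R).
  { apply (f_equal Rsqr) in H. rewrite Rsqr_sqrt in H by nra. unfold Rsqr in H. lra. }
  assert (Hx : (-1 <= x <= 1)%R) by nra.
  assert (S : (sin (acos x) = Rabs y)%R).
  { rewrite sin_acos by auto. rewrite <- sqrt_Rsqr_abs. f_equal. unfold Rsqr. lra. }
  pose proof (acos_bound x) as B.
  destruct (Rle_dec 0 y) as [Hy|Hy].
  - exists (acos x). split; [lra|].
    unfold cis. rewrite cos_acos, S, Rabs_pos_eq by auto. reflexivity.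
  - exists (- acos x)%R. split; [lra|].
    unfold cis. rewrite cos_neg, sin_neg, cos_acos, S, Rabs_left by lra.
    f_equal; ring.
Qed.

Lemma polar_surj (z : C) : exists t, (- PI <= t <= PI)%R /\ z = polar (Cmod z) t.
Proof.
  destruct (Req_dec (Cmod z) 0) as [E|N].
  - exists 0%R. split; [pose proof PI_RGT_0; lra|]. rewrite E. unfold polar.
    rewrite Cmult_0_l. now apply Cmod_eq_0.
  - assert (N' : RtoC (Cmod z) <> 0) by (intros E; apply N, RtoC_inj, E).
    destruct (cis_surj (z / RtoC (Cmod z))) as [t [Ht E]].
    + rewrite Cmod_div, Cmod_R, Rabs_pos_eq by auto using Cmod_ge_0. field; auto.
    + exists t. split; auto. unfold polar. rewrite <- E. field. auto.
Qed.

(** * Integrals of complex-valued functions of a real variable *)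

Definition Cint (f : R -> C) (a b : R) : C :=
  (RInt (fun t => Re (f t)) a b, RInt (fun t => Im (f t)) a b).

Definition cont_on (f : R -> C) (a b : R) : Prop :=
  forall t, (a <= t <= b)%R -> cont_at dR f t.

Lemma cont_on_ex_RInt f a b :
  (a <= b)%R -> cont_on f a b ->
  ex_RInt (fun t => Re (f t)) a b /\ ex_RInt (fun t => Im (f t)) a b.
Proof.
  intros Hab Hf.
  split; apply (ex_RInt_continuous (V := R_CompleteNormedModule)); rewrite Rmin_left, Rmax_right by auto;
    intros z Hz P [eps HP]; destruct (Hf z Hz eps (cond_pos eps)) as [del [Hd K]];
    exists (mkposreal del Hd); intros y Hy; apply HP; specialize (K y Hy);
    pose proof (Rmax_Cmod (f y - f z)) as M;
    eapply Rle_lt_trans; try exact K; eapply Rle_trans; try exact M.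
  - apply Rmax_l.
  - apply Rmax_r.
Qed.

Lemma Cint_ext f g a b : (a <= b)%R ->
  (forall t, (a <= t <= b)%R -> f t = g t) -> Cint f a b = Cint g a b.
Proof.
  intros Hab E. unfold Cint. f_equal; apply RInt_ext; rewrite Rmin_left, Rmax_right by auto;
    intros; rewrite E; auto; lra.
Qed.

Lemma Cint_plus f g a b : (a <= b)%R -> cont_on f a b -> cont_on g a b ->
  Cint (fun t => f t + g t) a b = Cint f a b + Cint g a b.
Proof.
  intros Hab Hf Hg. destruct (cont_on_ex_RInt f a b Hab Hf), (cont_on_ex_RInt g a b Hab Hg).
  unfold Cint, Cplus; simpl. f_equal; apply (RInt_plus (V := R_CompleteNormedModule)); auto.
Qed.

Lemma Cint_scal c f a b : (a <= b)%R -> cont_on f a b ->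
  Cint (fun t => c * f t) a b = c * Cint f a b.
Proof.
  intros Hab Hf. destruct (cont_on_ex_RInt f a b Hab Hf) as [H1 H2].
  unfold Cint, Cmult; simpl.
  assert (S : forall k h, ex_RInt h a b -> RInt (fun t => k * h t)%R a b = (k * RInt h a b)%R).
  { intros k h Hh. apply (RInt_scal (V := R_CompleteNormedModule) h a b k Hh). }
  assert (S' : forall k h, ex_RInt h a b -> ex_RInt (fun t => k * h t)%R a b).
  { intros k h Hh. apply (ex_RInt_scal (V := R_NormedModule) h a b k Hh). }
  f_equal.
  - rewrite <- !S by auto. symmetry. etransitivity.
    + symmetry. apply (RInt_minus (V := R_CompleteNormedModule)); apply S'; auto.
    + reflexivity.
  - rewrite <- !S by auto. symmetry. etransitivity.
    + symmetry. apply (RInt_plus (V := R_CompleteNormedModule)); apply S'; auto.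
    + reflexivity.
Qed.

Lemma cont_on_sub f a b a' b' :
  (a <= a')%R -> (b' <= b)%R -> cont_on f a b -> cont_on f a' b'.
Proof. intros H1 H2 H t Ht. apply H. lra. Qed.

Lemma Cint_Chasles f a b c : (a <= b)%R -> (b <= c)%R -> cont_on f a c ->
  Cint f a c = Cint f a b + Cint f b c.
Proof.
  intros Hab Hbc Hf.
  destruct (cont_on_ex_RInt f a b Hab (cont_on_sub f a c a b (Rle_refl a) Hbc Hf)).
  destruct (cont_on_ex_RInt f b c Hbc (cont_on_sub f a c b c Hab (Rle_refl c) Hf)).
  unfold Cint, Cplus; simpl.
  f_equal; symmetry; apply (RInt_Chasles (V := R_CompleteNormedModule)); auto.
Qed.

(** The factor 2 comes from bounding the real and imaginary parts separately. The later arguments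
    tolerate any absolute constant. *)
Lemma Cint_bound f a b M : (a <= b)%R -> cont_on f a b ->
  (forall t, (a <= t <= b)%R -> (Cmod (f t) <= M)%R) ->
  (Cmod (Cint f a b) <= 2 * (b - a) * M)%R.
Proof.
  intros Hab Hf HM. destruct (cont_on_ex_RInt f a b Hab Hf) as [H1 H2].
  assert (A : (Rabs (fst (Cint f a b)) <= (b - a) * M)%R).
  { apply abs_RInt_le_const; auto. intros t Ht. eapply Rle_trans; [|apply HM, Ht].
    eapply Rle_trans; [|apply Rmax_Cmod]. apply Rmax_l. }
  assert (B : (Rabs (snd (Cint f a b)) <= (b - a) * M)%R).
  { apply abs_RInt_le_const; auto. intros t Ht. eapply Rle_trans; [|apply HM, Ht].
    eapply Rle_trans; [|apply Rmax_Cmod]. apply Rmax_r. }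
  set (z := Cint f a b) in *. rewrite (surjective_pairing z).
  replace (fst z, snd z) with (RtoC (fst z) + RtoC (snd z) * Ci).
  - eapply Rle_trans; [apply Cmod_triangle|]. rewrite Cmod_mult, Cmod_Ci, !Cmod_R. lra.
  - unfold Ci, RtoC, Cmult, Cplus; simpl. f_equal; ring.
Qed.

Lemma Cint_const c a b : (a <= b)%R -> Cint (fun _ => c) a b = RtoC (b - a) * c.
Proof.
  intros Hab. unfold Cint. rewrite !RInt_const. unfold Cmult, RtoC; simpl.
  unfold scal; simpl; unfold mult; simpl. unfold Re, Im. f_equal; ring.
Qed.

Lemma Cint_cis a b : (a <= b)%R -> Ci * Cint cis a b = cis b - cis a.
Proof.
  intros Hab. unfold Cint, cis, Ci, Cmult, Cminus, Cplus, Copp; simpl.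
  assert (E1 : RInt (fun t => cos t) a b = (sin b - sin a)%R).
  { apply is_RInt_unique. apply (is_RInt_derive (V := R_CompleteNormedModule) sin cos).
    - intros; apply is_derive_sin.
    - intros; apply (ex_derive_continuous cos). eexists; apply is_derive_cos. }
  assert (E2 : RInt (fun t => sin t) a b = (cos a - cos b)%R).
  { apply is_RInt_unique. replace (cos a - cos b)%R with (minus (- cos b) (- cos a))%R
      by (unfold minus, plus, opp; simpl; ring).
    apply (is_RInt_derive (V := R_CompleteNormedModule) (fun t => - cos t)%R sin).
    - intros x _. auto_derive; auto. ring.
    - intros; apply (ex_derive_continuous sin). eexists; apply is_derive_sin. }
  rewrite E1, E2. f_equal; ring.
Qed.

(** * Goursat's theorem on polar rectangles *)

Definition cont_rect (F : C -> C) (r1 r2 t1 t2 : R) : Prop :=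
  forall r t, (r1 <= r <= r2)%R -> (t1 <= t <= t2)%R -> cont_at dC F (polar r t).

(* The integral of F(z) dz / z along the boundary of a polar rectangle. *)
Definition polar_bd (F : C -> C) (r1 r2 t1 t2 : R) : C :=
  Ci * (Cint (fun t => F (polar r2 t)) t1 t2 - Cint (fun t => F (polar r1 t)) t1 t2)
  - (Cint (fun r => / RtoC r * F (polar r t2)) r1 r2
     - Cint (fun r => / RtoC r * F (polar r t1)) r1 r2).

Lemma cont_at_cis t : cont_at dR cis t.
Proof.
  intros eps He. exists eps. split; auto.
  intros s Hs. eapply Rle_lt_trans; [apply cis_lipschitz|exact Hs].
Qed.

Lemma cont_at_polar_angle r t : cont_at dR (fun s => polar r s) t.
Proof. apply cont_at_mult; [apply cont_at_const|apply cont_at_cis]. Qed.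

Lemma cont_at_RtoC r : cont_at dR RtoC r.
Proof.
  intros eps He. exists eps. split; auto. intros s Hs.
  rewrite <- RtoC_minus, Cmod_R. exact Hs.
Qed.

Lemma cont_at_polar_radius r t : cont_at dR (fun s => polar s t) r.
Proof. apply cont_at_mult; [apply cont_at_RtoC|apply cont_at_const]. Qed.

Lemma cont_on_arc F r1 r2 t1 t2 r :
  cont_rect F r1 r2 t1 t2 -> (r1 <= r <= r2)%R -> cont_on (fun t => F (polar r t)) t1 t2.
Proof.
  intros H Hr t Ht. apply (cont_at_compC dR (fun s => polar r s) F).
  - apply cont_at_polar_angle.
  - apply H; auto.
Qed.

Lemma cont_on_ray F r1 r2 t1 t2 t :
  (0 < r1)%R -> cont_rect F r1 r2 t1 t2 -> (t1 <= t <= t2)%R ->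
  cont_on (fun r => / RtoC r * F (polar r t)) r1 r2.
Proof.
  intros H0 H Ht r Hr. apply cont_at_mult.
  - apply cont_at_inv; [|apply cont_at_RtoC]. intros E. apply RtoC_inj in E. lra.
  - apply (cont_at_compC dR (fun s => polar s t) F).
    + apply cont_at_polar_radius.
    + apply H; auto.
Qed.

Lemma cont_rect_sub F r1 r2 t1 t2 r1' r2' t1' t2' :
  (r1 <= r1')%R -> (r2' <= r2)%R -> (t1 <= t1')%R -> (t2' <= t2)%R ->
  cont_rect F r1 r2 t1 t2 -> cont_rect F r1' r2' t1' t2'.
Proof. intros ? ? ? ? H r t Hr Ht. apply H; lra. Qed.

Section Rectangle.

Context (r1 r2 t1 t2 : R).
Hypothesis Hr1 : (0 < r1)%R.
Hypothesis Hr : (r1 <= r2)%R.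
Hypothesis Ht : (t1 <= t2)%R.

Lemma polar_bd_plus F G :
  cont_rect F r1 r2 t1 t2 -> cont_rect G r1 r2 t1 t2 ->
  polar_bd (fun z => F z + G z) r1 r2 t1 t2 = polar_bd F r1 r2 t1 t2 + polar_bd G r1 r2 t1 t2.
Proof.
  intros HF HG. unfold polar_bd.
  rewrite !(Cint_plus (fun t => F (polar _ t)) (fun t => G (polar _ t)) t1 t2)
    by (auto; eapply cont_on_arc; eauto; lra).
  assert (E : forall t, (t1 <= t <= t2)%R ->
    Cint (fun r => / RtoC r * (F (polar r t) + G (polar r t))) r1 r2 =
    Cint (fun r => / RtoC r * F (polar r t)) r1 r2 + Cint (fun r => / RtoC r * G (polar r t)) r1 r2).
  { intros t Ht'. rewrite <- Cint_plus by (auto; eapply cont_on_ray; eauto).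
    apply Cint_ext; auto. intros; ring. }
  rewrite !E by lra. ring.
Qed.

Lemma polar_bd_scal c F :
  cont_rect F r1 r2 t1 t2 ->
  polar_bd (fun z => c * F z) r1 r2 t1 t2 = c * polar_bd F r1 r2 t1 t2.
Proof.
  intros HF. unfold polar_bd.
  rewrite !(Cint_scal c (fun t => F (polar _ t)) t1 t2)
    by (auto; eapply cont_on_arc; eauto; lra).
  assert (E : forall t, (t1 <= t <= t2)%R ->
    Cint (fun r => / RtoC r * (c * F (polar r t))) r1 r2 =
    c * Cint (fun r => / RtoC r * F (polar r t)) r1 r2).
  { intros t Ht'. rewrite <- Cint_scal by (auto; eapply cont_on_ray; eauto).
    apply Cint_ext; auto. intros; ring. }
  rewrite !E by lra. ring.
Qed.

(** Since dz/z = dr/r + i dt, the integrals of a constant over opposite sides are equal. Together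
    with [polar_bd_id], where the form is dz, this disposes of affine functions. *)
Lemma polar_bd_const c : polar_bd (fun _ => c) r1 r2 t1 t2 = 0.
Proof. unfold polar_bd. ring. Qed.

Lemma polar_bd_id : polar_bd (fun z => z) r1 r2 t1 t2 = 0.
Proof.
  unfold polar_bd, polar.
  rewrite !(Cint_scal _ cis t1 t2) by (auto; intros t _; apply cont_at_cis).
  assert (E : forall t, Cint (fun r => / RtoC r * (RtoC r * cis t)) r1 r2 = RtoC (r2 - r1) * cis t).
  { intros t. rewrite <- Cint_const by auto. apply Cint_ext; auto. intros r Hr'. field.
    intros E. apply RtoC_inj in E. lra. }
  rewrite !E.
  transitivity (RtoC (r2 - r1) * (Ci * Cint cis t1 t2) - RtoC (r2 - r1) * (cis t2 - cis t1)).
  - rewrite RtoC_minus. ring.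
  - rewrite Cint_cis by auto. ring.
Qed.

Lemma polar_bd_bound F M :
  cont_rect F r1 r2 t1 t2 ->
  (forall r t, (r1 <= r <= r2)%R -> (t1 <= t <= t2)%R -> (Cmod (F (polar r t)) <= M)%R) ->
  (Cmod (polar_bd F r1 r2 t1 t2) <= 4 * ((t2 - t1) + (r2 - r1) / r1) * M)%R.
Proof.
  intros HF HM. unfold polar_bd.
  assert (A : forall r, (r1 <= r <= r2)%R ->
    (Cmod (Cint (fun t => F (polar r t)) t1 t2) <= 2 * (t2 - t1) * M)%R).
  { intros r Hr'. apply Cint_bound; auto. eapply cont_on_arc; eauto. }
  assert (B : forall t, (t1 <= t <= t2)%R ->
    (Cmod (Cint (fun r => (/ RtoC r * F (polar r t))%C) r1 r2) <= 2 * (r2 - r1) * (/ r1 * M))%R).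
  { intros t Ht'. apply Cint_bound; auto. { eapply cont_on_ray; eauto. }
    intros r Hr'. rewrite Cmod_mult, Cmod_inv, Cmod_R by (intros E; apply RtoC_inj in E; lra).
    rewrite Rabs_pos_eq by lra. apply Rmult_le_compat.
    - left. apply Rinv_0_lt_compat. lra.
    - apply Cmod_ge_0.
    - apply Rinv_le_contravar; lra.
    - apply HM; auto. }
  pose proof (A r1 ltac:(lra)). pose proof (A r2 ltac:(lra)).
  pose proof (B t1 ltac:(lra)). pose proof (B t2 ltac:(lra)).
  assert (T : forall a b, (Cmod (a - b) <= Cmod a + Cmod b)%R).
  { intros a b. unfold Cminus. rewrite <- (Cmod_opp b). apply Cmod_triangle. }
  eapply Rle_trans; [apply T|]. rewrite Cmod_mult, Cmod_Ci.
  eapply Rle_trans; [apply Rplus_le_compat; [apply Rmult_le_compat_l; [lra|apply T]|apply T]|].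
  unfold Rdiv. lra.
Qed.

Lemma polar_bd_split F rm tm :
  (r1 <= rm <= r2)%R -> (t1 <= tm <= t2)%R -> cont_rect F r1 r2 t1 t2 ->
  polar_bd F r1 r2 t1 t2 =
    polar_bd F r1 rm t1 tm + polar_bd F rm r2 t1 tm +
    polar_bd F r1 rm tm t2 + polar_bd F rm r2 tm t2.
Proof.
  intros Hrm Htm HF. unfold polar_bd.
  rewrite (Cint_Chasles (fun t => F (polar r2 t)) t1 tm t2) by (try lra; eapply cont_on_arc; eauto; lra).
  rewrite (Cint_Chasles (fun t => F (polar r1 t)) t1 tm t2) by (try lra; eapply cont_on_arc; eauto; lra).
  rewrite (Cint_Chasles (fun r => / RtoC r * F (polar r t2)) r1 rm r2)
    by (try lra; eapply cont_on_ray; eauto; lra).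
  rewrite (Cint_Chasles (fun r => / RtoC r * F (polar r t1)) r1 rm r2)
    by (try lra; eapply cont_on_ray; eauto; lra).
  ring.
Qed.

End Rectangle.

Lemma nested_intervals_meet (u v : nat -> R) :
  (forall n, (u n <= u (S n))%R) -> (forall n, (v (S n) <= v n)%R) -> (forall n, (u n <= v n)%R) ->
  exists x, forall n, (u n <= x <= v n)%R.
Proof.
  intros Hu Hv Huv.
  assert (Mu : forall n k, (u n <= u (k + n)%nat)%R).
  { induction k; simpl; [lra|]. eapply Rle_trans; [exact IHk|apply Hu]. }
  assert (Mv : forall n k, (v (k + n)%nat <= v n)%R).
  { induction k; simpl; [lra|]. eapply Rle_trans; [apply Hv|exact IHk]. }
  assert (X : forall n p, (u n <= v p)%R).
  { intros n p. eapply Rle_trans; [apply (Mu n p)|]. eapply Rle_trans; [apply Huv|].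
    rewrite Nat.add_comm. apply Mv. }
  destruct (completeness (fun x => exists n, x = u n)) as [x [H1 H2]].
  - exists (v 0%nat). intros y [n ->]. apply X.
  - exists (u 0%nat). now exists 0%nat.
  - exists x. intros n. split.
    + apply H1. now exists n.
    + apply H2. intros y [p ->]. apply X.
Qed.

Section Bisection.

Context (F : C -> C) (h k : R).

Definition half_len (x : R) (n : nat) : R := (x * (/ 2) ^ n)%R.

Definition rect_bd (n : nat) (p : R * R) : C :=
  polar_bd F (fst p) (fst p + half_len h n) (snd p) (snd p + half_len k n).

(** Only lower corners are recorded, because the sides of generation [n] are fixed by [n]. The last
    quarter is taken by default; the triangle inequality makes it large when the other three are
    not. *)
Definition quarter (n : nat) (p : R * R) : R * R :=
  let h' := half_len h (S n) in
  let k' := half_len k (S n) in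
  let big q := Rle_dec (Cmod (rect_bd n p) / 4) (Cmod (rect_bd (S n) q)) in
  if big p then p else
  if big (fst p + h', snd p)%R then (fst p + h', snd p)%R else
  if big (fst p, snd p + k')%R then (fst p, snd p + k')%R else
  (fst p + h', snd p + k')%R.

Fixpoint corner (p : R * R) (n : nat) : R * R :=
  match n with O => p | S n => quarter n (corner p n) end.

Lemma half_len_S x n : half_len x n = (half_len x (S n) + half_len x (S n))%R.
Proof. unfold half_len. simpl. field. Qed.

Lemma half_len_ge_0 x n : (0 <= x)%R -> (0 <= half_len x n)%R.
Proof. intros H. apply Rmult_le_pos; auto. apply pow_le. lra. Qed.

Lemma quarter_spec n p :
  (0 <= h)%R -> (0 <= k)%R -> (0 < fst p)%R ->
  cont_rect F (fst p) (fst p + half_len h n) (snd p) (snd p + half_len k n) ->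
  (fst p <= fst (quarter n p) <= fst p + half_len h (S n))%R /\
  (snd p <= snd (quarter n p) <= snd p + half_len k (S n))%R /\
  (Cmod (rect_bd n p) / 4 <= Cmod (rect_bd (S n) (quarter n p)))%R.
Proof.
  intros Hh Hk Hp HF. unfold quarter.
  pose proof (half_len_ge_0 h (S n) Hh) as Ph. pose proof (half_len_ge_0 k (S n) Hk) as Pk.
  repeat destruct Rle_dec; simpl; try (repeat split; auto; lra).
  split; [lra|]. split; [lra|].
  assert (E : rect_bd n p = rect_bd (S n) p + rect_bd (S n) (fst p + half_len h (S n), snd p)%R
    + rect_bd (S n) (fst p, snd p + half_len k (S n))%R
    + rect_bd (S n) (fst p + half_len h (S n), snd p + half_len k (S n))%R).
  { pose proof (half_len_S h n) as Eh. pose proof (half_len_S k n) as Ek.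
    unfold rect_bd; simpl.
    rewrite (polar_bd_split (fst p) (fst p + half_len h n) (snd p) (snd p + half_len k n))
      with (rm := (fst p + half_len h (S n))%R) (tm := (snd p + half_len k (S n))%R)
      by (auto; lra).
    rewrite Eh, Ek, <- !Rplus_assoc. reflexivity. }
  set (q2 := (fst p + half_len h (S n), snd p)%R) in *.
  set (q3 := (fst p, snd p + half_len k (S n))%R) in *.
  set (q4 := (fst p + half_len h (S n), snd p + half_len k (S n))%R) in *.
  assert (T : (Cmod (rect_bd n p) <= Cmod (rect_bd (S n) p) + Cmod (rect_bd (S n) q2) +
     Cmod (rect_bd (S n) q3) + Cmod (rect_bd (S n) q4))%R).
  { rewrite E. repeat (eapply Rle_trans; [apply Cmod_triangle|]; apply Rplus_le_compat_r).
    lra. }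
  lra.
Qed.

End Bisection.

(** Bisection keeps a quarter of the integral at each step and shrinks to a point. There [F] minus
    its affine approximation is o(distance), so its integral over generation [n] is at most a small
    multiple of diameter times perimeter, that is of 4^-n. *)
Theorem goursat_polar F r1 r2 t1 t2 :
  (0 < r1)%R -> (r1 <= r2)%R -> (t1 <= t2)%R ->
  (forall r t, (r1 <= r <= r2)%R -> (t1 <= t <= t2)%R -> cdiff F (polar r t)) ->
  polar_bd F r1 r2 t1 t2 = 0.
Proof.
  intros Hr1 Hr Ht HF.
  set (h := (r2 - r1)%R). set (k := (t2 - t1)%R).
  assert (Hh : (0 <= h)%R) by (unfold h; lra). assert (Hk : (0 <= k)%R) by (unfold k; lra).
  set (p := corner F h k (r1, t1)).
  assert (HC : cont_rect F r1 r2 t1 t2) by (intros r t ? ?; apply cdiff_cont; auto).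
  assert (Inv : forall n, (r1 <= fst (p n))%R /\ (fst (p n) + half_len h n <= r2)%R /\
     (t1 <= snd (p n))%R /\ (snd (p n) + half_len k n <= t2)%R).
  { induction n as [|n IH].
    - simpl. unfold half_len; simpl. unfold h, k. lra.
    - destruct IH as (A & B & D & E).
      destruct (quarter_spec F h k n (p n) Hh Hk ltac:(lra)) as (P & Q & _).
      { eapply cont_rect_sub; [| | | |exact HC]; lra. }
      change (p (S n)) with (quarter F h k n (p n)).
      rewrite (half_len_S h n) in B. rewrite (half_len_S k n) in E. lra. }
  assert (Step : forall n,
    (fst (p n) <= fst (p (S n)) <= fst (p n) + half_len h (S n))%R /\
    (snd (p n) <= snd (p (S n)) <= snd (p n) + half_len k (S n))%R /\
    (Cmod (rect_bd F h k n (p n)) / 4 <= Cmod (rect_bd F h k (S n) (p (S n))))%R).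
  { intros n. destruct (Inv n) as (A & B & D & E). apply quarter_spec; auto; [lra|].
    eapply cont_rect_sub; [| | | |exact HC]; lra. }
  destruct (nested_intervals_meet (fun n => fst (p n)) (fun n => fst (p n) + half_len h n)%R)
    as [rs Hrs].
  { intros n. apply Step. }
  { intros n. destruct (Step n) as (A & _). rewrite (half_len_S h n). lra. }
  { intros n. pose proof (half_len_ge_0 h n Hh). lra. }
  destruct (nested_intervals_meet (fun n => snd (p n)) (fun n => snd (p n) + half_len k n)%R)
    as [ts Hts].
  { intros n. apply Step. }
  { intros n. destruct (Step n) as (_ & A & _). rewrite (half_len_S k n). lra. }
  { intros n. pose proof (half_len_ge_0 k n Hk). lra. }
  set (J0 := Cmod (polar_bd F r1 r2 t1 t2)).
  assert (Low : forall n, (J0 * (/ 4) ^ n <= Cmod (rect_bd F h k n (p n)))%R).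
  { induction n as [|n IH].
    - simpl. unfold rect_bd, half_len, J0, p, h, k; simpl.
      right. rewrite !Rmult_1_r. f_equal. f_equal; ring.
    - destruct (Step n) as (_ & _ & A). simpl. lra. }
  destruct (HF rs ts) as [phi [Hphi Ephi]].
  { specialize (Hrs 0%nat). specialize (Inv 0%nat). lra. }
  { specialize (Hts 0%nat). specialize (Inv 0%nat). lra. }
  set (zs := polar rs ts) in *.
  (* [L] bounds distances in the rectangle, by [polar_dist]; [K] multiplies it by the constant of
     [polar_bd_bound]. Each of the two factors is halved by a bisection. *)
  set (L := (h + r2 * k)%R). set (K := (4 * (k + h / r1) * L)%R).
  assert (HL : (0 <= L)%R). { unfold L. assert (0 <= r2 * k)%R by (apply Rmult_le_pos; lra). lra. }
  assert (Q : (0 <= h / r1)%R).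
  { apply Rmult_le_pos; auto. left. apply Rinv_0_lt_compat. lra. }
  assert (HK : (0 <= K)%R). { unfold K. apply Rmult_le_pos; [lra|auto]. }
  assert (Up : forall eps, (0 < eps)%R -> (J0 <= K * eps)%R).
  { intros eps He. destruct (Hphi eps He) as [del [Hd Kd]].
    assert (exists n, (L * (/ 2) ^ n < del)%R) as [n Hn].
    { destruct (pow_lt_1_zero (/ 2) ltac:(rewrite Rabs_pos_eq; lra) (del / (L + 1))) as [n Hn].
      { apply Rdiv_lt_0_compat; lra. }
      exists n. specialize (Hn n (Nat.le_refl n)).
      rewrite Rabs_pos_eq in Hn by (apply pow_le; lra).
      apply Rle_lt_trans with ((L + 1) * (/ 2) ^ n)%R.
      - apply Rmult_le_compat_r; [apply pow_le; lra|lra].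
      - apply (Rmult_lt_compat_l (L + 1)) in Hn; [|lra].
        replace ((L + 1) * (del / (L + 1)))%R with del in Hn by (field; lra). exact Hn. }
    specialize (Hrs n). specialize (Hts n). specialize (Low n).
    destruct (Inv n) as (I1 & I2 & I3 & I4).
    set (a := fst (p n)) in *. set (b := snd (p n)) in *.
    set (hn := half_len h n) in *. set (kn := half_len k n) in *.
    assert (P1 : (0 <= hn)%R) by (apply half_len_ge_0; auto).
    assert (P2 : (0 <= kn)%R) by (apply half_len_ge_0; auto).
    assert (HCn : cont_rect F a (a + hn) b (b + kn))
      by (eapply cont_rect_sub; [| | | |exact HC]; lra).
    set (D := phi zs).
    (* [F] minus its first-order expansion at [zs]. The affine part has integral 0, so the boundary
       integral does not change. *)
    set (A := fun z : C => F z + ((- D) * z + (D * zs - F zs))).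
    assert (CL : cont_rect (fun z => (- D) * z + (D * zs - F zs)) a (a + hn) b (b + kn)).
    { intros r t _ _. apply cont_at_plus; [apply cont_at_mult|]; try apply cont_at_const.
      apply cont_at_id. }
    assert (EA : polar_bd A a (a + hn) b (b + kn) = rect_bd F h k n (p n)).
    { unfold A. rewrite polar_bd_plus by (auto; lra).
      rewrite (polar_bd_plus a (a + hn) b (b + kn) ltac:(lra) ltac:(lra) ltac:(lra)
         (fun z => (- D) * z) (fun _ => D * zs - F zs)).
      - rewrite (polar_bd_scal a (a + hn) b (b + kn) ltac:(lra) ltac:(lra) ltac:(lra) (- D) (fun z => z)).
        + rewrite polar_bd_id, polar_bd_const by lra. unfold rect_bd. fold a b hn kn. ring.
        + intros r t _ _. apply cont_at_id.
      - intros r t _ _. apply cont_at_mult; [apply cont_at_const|apply cont_at_id].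
      - intros r t _ _. apply cont_at_const. }
    assert (Dist : forall r t, (a <= r <= a + hn)%R -> (b <= t <= b + kn)%R ->
      (Cmod (polar r t - zs) <= L * (/ 2) ^ n)%R).
    { intros r t Hr' Ht'. unfold zs. eapply Rle_trans; [apply polar_dist|].
      assert (Rabs (r - rs) <= hn)%R by (apply Rabs_le; lra).
      assert (Rabs (t - ts) <= kn)%R by (apply Rabs_le; lra).
      assert (Rabs rs <= r2)%R by (apply Rabs_le; lra).
      replace (L * (/ 2) ^ n)%R with (hn + r2 * kn)%R
        by (unfold L, hn, kn, half_len; ring).
      apply Rplus_le_compat; auto. apply Rmult_le_compat; auto using Rabs_pos. }
    assert (B : (Cmod (polar_bd A a (a + hn) b (b + kn))
       <= 4 * ((b + kn - b) + (a + hn - a) / a) * (eps * (L * (/ 2) ^ n)))%R).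
    { apply polar_bd_bound; try lra.
      - intros r t Hr' Ht'. apply cont_at_plus; [apply HCn|apply CL]; auto.
      - intros r t Hr' Ht'. pose proof (Dist r t Hr' Ht') as Dz.
        unfold A. rewrite (Ephi (polar r t)).
        replace (F zs + phi (polar r t) * (polar r t - zs) + (- D * polar r t + (D * zs - F zs)))
          with ((phi (polar r t) - D) * (polar r t - zs)) by ring.
        rewrite Cmod_mult. apply Rmult_le_compat; auto using Cmod_ge_0.
        left. apply Kd. unfold dC. lra. }
    rewrite EA in B.
    replace ((b + kn - b) + (a + hn - a) / a)%R with (kn + hn / a)%R in B by (f_equal; [ring|f_equal; ring]).
    assert (B2 : (kn + hn / a <= (k + h / r1) * (/ 2) ^ n)%R).
    { assert (hn / a <= hn / r1)%R.
      { apply Rmult_le_compat_l; auto. apply Rinv_le_contravar; lra. }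
      unfold hn, kn, half_len in *. unfold Rdiv in *. lra. }
    assert (P3 : (0 < (/ 2) ^ n)%R) by (apply pow_lt; lra).
    assert (P4 : (0 < (/ 4) ^ n)%R) by (apply pow_lt; lra).
    assert (E4 : ((/ 2) ^ n * (/ 2) ^ n = (/ 4) ^ n)%R).
    { rewrite <- Rpow_mult_distr. f_equal. lra. }
    apply Rmult_le_reg_r with ((/ 4) ^ n)%R; auto.
    eapply Rle_trans; [exact Low|]. eapply Rle_trans; [exact B|].
    rewrite <- E4. unfold K.
    replace (4 * (k + h / r1) * L * eps * ((/ 2) ^ n * (/ 2) ^ n))%R
      with (4 * ((k + h / r1) * (/ 2) ^ n) * (eps * (L * (/ 2) ^ n)))%R by ring.
    apply Rmult_le_compat_r.
    - apply Rmult_le_pos; [lra|]. apply Rmult_le_pos; lra.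
    - lra. }
  apply Cmod_eq_0. fold J0. apply Rle_antisym; [|apply Cmod_ge_0].
  apply Rnot_lt_le. intros HJ.
  (* The summand 1 covers a degenerate rectangle, where [K] may be 0. *)
  specialize (Up (J0 / (2 * (K + 1)))%R ltac:(apply Rdiv_lt_0_compat; lra)).
  assert (K * (J0 / (2 * (K + 1))) <= J0 / 2)%R; [|lra].
  replace (K * (J0 / (2 * (K + 1))))%R with (J0 / 2 * (K / (K + 1)))%R by (field; lra).
  assert (K / (K + 1) <= 1)%R.
  { apply Rmult_le_reg_r with (K + 1)%R; [lra|]. unfold Rdiv. rewrite Rmult_assoc, Rinv_l; lra. }
  nra.
Qed.

(** * Cauchy's formula on circles centred at the origin *)

(** Integrating in the angle amounts to the form dz/(iz). Hence the Cauchy kernel below is z/(z - w)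
    and the constant is 2 pi. *)
Definition circ_int (F : C -> C) (r : R) : C := Cint (fun t => F (polar r t)) 0 (2 * PI).

Definition cont_circ (F : C -> C) (r : R) : Prop := forall t, cont_at dC F (polar r t).

Lemma two_PI_ge_0 : (0 <= 2 * PI)%R.
Proof. pose proof PI_RGT_0. lra. Qed.

Lemma two_PI_neq_0 : RtoC (2 * PI) <> 0.
Proof. intros E. apply RtoC_inj in E. pose proof PI_RGT_0. lra. Qed.

Lemma cont_circ_on F r a b : cont_circ F r -> cont_on (fun t => F (polar r t)) a b.
Proof.
  intros H t _. apply (cont_at_compC dR (fun s => polar r s) F); [apply cont_at_polar_angle|apply H].
Qed.

Lemma circ_int_plus F G r : cont_circ F r -> cont_circ G r ->
  circ_int (fun z => F z + G z) r = circ_int F r + circ_int G r.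
Proof.
  intros HF HG. unfold circ_int.
  rewrite <- Cint_plus by (try apply two_PI_ge_0; now apply cont_circ_on). reflexivity.
Qed.

Lemma circ_int_scal c F r : cont_circ F r ->
  circ_int (fun z => c * F z) r = c * circ_int F r.
Proof.
  intros HF. unfold circ_int.
  rewrite <- Cint_scal by (try apply two_PI_ge_0; now apply cont_circ_on). reflexivity.
Qed.

Lemma circ_int_const c r : circ_int (fun _ => c) r = RtoC (2 * PI) * c.
Proof. unfold circ_int. rewrite Cint_const by apply two_PI_ge_0. now rewrite Rminus_0_r. Qed.

Lemma circ_int_ext F G r : (0 <= r)%R -> (forall z, Cmod z = r -> F z = G z) -> circ_int F r = circ_int G r.
Proof.
  intros Hr H. unfold circ_int. apply Cint_ext; [apply two_PI_ge_0|].
  intros t _. apply H. rewrite Cmod_polar. now apply Rabs_pos_eq.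
Qed.

Lemma circ_int_bound F r M : (0 <= r)%R -> cont_circ F r ->
  (forall z, Cmod z = r -> (Cmod (F z) <= M)%R) ->
  (Cmod (circ_int F r) <= 4 * PI * M)%R.
Proof.
  intros Hr HF HM. replace (4 * PI * M)%R with (2 * (2 * PI - 0) * M)%R by ring.
  apply Cint_bound; [apply two_PI_ge_0|now apply cont_circ_on|].
  intros t _. apply HM. rewrite Cmod_polar. now apply Rabs_pos_eq.
Qed.

Lemma cont_circ_bounded F r : (0 <= r)%R -> cont_circ F r ->
  exists M, (0 < M)%R /\ forall z, Cmod z = r -> (Cmod (F z) <= M)%R.
Proof.
  intros Hr HF. pose proof PI_RGT_0 as HPI.
  destruct (continuity_ab_maj (fun t => Cmod (F (polar r t))) (- PI) PI) as [tm [Htm _]].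
  - lra.
  - intros t _ eps He.
    destruct (cont_circ_on F r t t HF t ltac:(lra) eps He) as [del [Hd K]].
    exists del. split; auto. intros s [_ Hs]. unfold Rdist in *. simpl in *. unfold Rdist.
    eapply Rle_lt_trans; [|apply (K s Hs)].
    set (x := F (polar r s)). set (y := F (polar r t)).
    pose proof (Cmod_triangle (x - y) y) as T1. replace (x - y + y) with x in T1 by ring.
    pose proof (Cmod_triangle (y - x) x) as T2. replace (y - x + x) with y in T2 by ring.
    rewrite (Cmod_sub_sym y x) in T2. apply Rabs_le. lra.
  - exists (Cmod (F (polar r tm)) + 1)%R. split; [pose proof (Cmod_ge_0 (F (polar r tm))); lra|].
    intros z Hz. destruct (polar_surj z) as [t [Ht ->]]. rewrite Hz.
    specialize (Htm t Ht). simpl in Htm. lra.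
Qed.

(** Goursat's theorem on the annulus cut along the ray of angle 0: the two sides of the cut carry
    the same values by periodicity and cancel. *)
Lemma circ_int_annulus F r1 r2 : (0 < r1)%R -> (r1 <= r2)%R ->
  (forall z, (r1 <= Cmod z <= r2)%R -> cdiff F z) -> circ_int F r1 = circ_int F r2.
Proof.
  intros H0 H12 HF.
  assert (G : polar_bd F r1 r2 0 (2 * PI) = 0).
  { apply goursat_polar; auto using two_PI_ge_0. intros r t Hr _. apply HF.
    rewrite Cmod_polar, Rabs_pos_eq; lra. }
  unfold polar_bd in G. unfold circ_int.
  assert (P : forall r, polar r (2 * PI) = polar r 0).
  { intros r. unfold polar. now rewrite cis_2PI, cis_0. }
  rewrite (Cint_ext (fun r => / RtoC r * F (polar r (2 * PI))) (fun r => / RtoC r * F (polar r 0))) in G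
    by (auto; intros; now rewrite P).
  set (A2 := Cint (fun t => F (polar r2 t)) _ _) in *.
  set (A1 := Cint (fun t => F (polar r1 t)) _ _) in *.
  (* Since i^2 = -1 the two sides agree; the inner factor i (A2 - A1) is 0 by [G]. *)
  replace A1 with (A2 + Ci * (Ci * (A2 - A1))).
  - assert (E : Ci * (A2 - A1) = 0) by (rewrite <- G; ring).
    rewrite E. ring.
  - replace (Ci * (Ci * (A2 - A1))) with (A1 - A2); [ring|].
    unfold Ci, Cmult, Cminus, Cplus, Copp; destruct A1, A2; simpl. f_equal; ring.
Qed.

(** Continuity in the radius carries values across the radii 0 and |w|, where [circ_int_annulus]
    does not apply. *)
Lemma circ_int_continuous F r0 : (0 <= r0 < 1)%R -> (forall z, inD z -> cont_at dC F z) ->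
  forall eps, (0 < eps)%R -> exists del, (0 < del)%R /\ forall r, (0 <= r < 1)%R ->
    (Rabs (r - r0) < del)%R -> (Cmod (circ_int F r - circ_int F r0) < eps)%R.
Proof.
  intros Hr0 HF eps He.
  assert (HC : forall r, (0 <= r < 1)%R -> cont_circ F r).
  { intros r Hr t. apply HF. unfold inD. rewrite Cmod_polar, Rabs_pos_eq; lra. }
  assert (U : forall p : C -> R, (forall a b, Rabs (p a - p b) <= Cmod (a - b))%R ->
    forall e : posreal, exists d : posreal, forall r t, (0 <= t <= 2 * PI)%R ->
      (Rabs (r - r0) < d)%R -> (Rabs (p (F (polar r t)) - p (F (polar r0 t))) < e)%R).
  { intros p Hp e.
    destruct (uniform_continuity_2d_1d' (fun r t => p (F (polar r t))) 0 (2 * PI) r0) with (eps := e)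
      as [d Hd].
    - intros t _ e1. destruct (HC r0 Hr0 t e1 (cond_pos e1)) as [d1 [Hd1 K]].
      assert (P : (0 < d1 / (2 + Rabs r0))%R).
      { apply Rdiv_lt_0_compat; auto. pose proof (Rabs_pos r0). lra. }
      exists (mkposreal _ P). simpl. intros r s Hr Hs.
      eapply Rle_lt_trans; [apply Hp|]. apply K. unfold dC.
      eapply Rle_lt_trans; [apply polar_dist|].
      pose proof (Rabs_pos r0) as R0. pose proof (Rabs_pos (s - t)).
      set (x := (d1 / (2 + Rabs r0))%R) in *.
      replace d1 with (x + (1 + Rabs r0) * x)%R by (unfold x; field; lra).
      apply Rplus_lt_le_compat; auto. apply Rmult_le_compat; lra.
    - exists d. intros r t Ht Hr. apply Rabs_def2 in Hr.
      apply (Hd t r0 t r); auto.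
      + pose proof (cond_pos d). lra.
      + lra.
      + rewrite Rminus_diag, Rabs_R0. apply cond_pos. }
  pose proof PI_RGT_0 as HPI.
  (* Real and imaginary parts each contribute this error, the interval has length 2 pi and
     [Cint_bound] adds a factor 2: the total is eps/2. *)
  assert (P : (0 < eps / (16 * PI))%R) by (apply Rdiv_lt_0_compat; lra).
  destruct (U Re) with (e := mkposreal _ P) as [d1 K1].
  { intros a b. pose proof (re_le_Cmod (a - b)) as T. exact T. }
  destruct (U Im) with (e := mkposreal _ P) as [d2 K2].
  { intros a b. pose proof (Rmax_Cmod (a - b)) as T. eapply Rle_trans; [|exact T]. apply Rmax_r. }
  exists (Rmin d1 d2). split; [apply Rmin_pos; apply cond_pos|]. intros r Hr Hd.
  assert (E : circ_int F r - circ_int F r0 =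
    Cint (fun t => F (polar r t) + (-(1)) * F (polar r0 t)) 0 (2 * PI)).
  { unfold circ_int. rewrite Cint_plus, Cint_scal; try apply two_PI_ge_0;
      try (apply cont_circ_on; auto); [ring|].
    intros t Ht. apply cont_at_mult; [apply cont_at_const|].
    apply (cont_circ_on F r0 0 (2 * PI)); auto. }
  rewrite E. eapply Rle_lt_trans.
  - apply Cint_bound with (M := (2 * (eps / (16 * PI)))%R); [apply two_PI_ge_0| |].
    + intros t Ht. apply cont_at_plus; [|apply cont_at_mult; [apply cont_at_const|]].
      * apply (cont_circ_on F r 0 (2 * PI)); auto.
      * apply (cont_circ_on F r0 0 (2 * PI)); auto.
    + intros t Ht. set (a := F (polar r t)). set (b := F (polar r0 t)).
      specialize (K1 r t Ht (Rlt_le_trans _ _ _ Hd (Rmin_l _ _))).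
      specialize (K2 r t Ht (Rlt_le_trans _ _ _ Hd (Rmin_r _ _))).
      fold a b in K1, K2. simpl in K1, K2.
      replace (a + (-(1)) * b) with (RtoC (Re a - Re b) + RtoC (Im a - Im b) * Ci).
      * eapply Rle_trans; [apply Cmod_triangle|]. rewrite Cmod_mult, Cmod_Ci, !Cmod_R. lra.
      * destruct a as [a1 a2], b as [b1 b2].
        unfold Ci, RtoC, Cmult, Cplus, Copp; simpl. f_equal; ring.
  - replace (2 * (2 * PI - 0) * (2 * (eps / (16 * PI))))%R with (eps / 2)%R by (field; lra). lra.
Qed.

(** Write z/(z - w) = 1 + w/(z - w). The integral of 1/(z - w) does not depend on the radius s > |w|
    and is O(1/(s - |w|)), so it is 0. *)
Lemma circ_int_kernel w r : (Cmod w < r)%R -> circ_int (fun z => z / (z - w)) r = RtoC (2 * PI).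
Proof.
  intros Hw. pose proof (Cmod_ge_0 w) as W0. pose proof PI_RGT_0 as HPI.
  assert (NZ : forall z, (Cmod w < Cmod z)%R -> z - w <> 0).
  { intros z Hz E. replace z with w in Hz; [lra|].
    replace w with (z - (z - w)) by ring. rewrite E. ring. }
  assert (D : forall z, (Cmod w < Cmod z)%R -> cdiff (fun z => / (z - w)) z).
  { intros z Hz. apply cdiff_inv; [now apply NZ|]. apply cdiff_minus; [apply cdiff_id|apply cdiff_const]. }
  assert (CC : forall s, (Cmod w < s)%R -> cont_circ (fun z => / (z - w)) s).
  { intros s Hs t. apply cdiff_cont, D. rewrite Cmod_polar, Rabs_pos_eq; lra. }
  assert (Z : circ_int (fun z => / (z - w)) r = 0).
  { apply Cmod_eq_0. apply Rle_antisym; [|apply Cmod_ge_0]. apply Rnot_lt_le. intros H.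
    set (k := Cmod (circ_int (fun z => / (z - w)) r)) in *.
    (* Chosen so that 4 pi / (s - |w|) <= k/2, which contradicts the bound [B]. *)
    set (s := (Rmax r (Cmod w + 8 * PI / k))%R).
    assert (P : (0 < 8 * PI / k)%R) by (apply Rdiv_lt_0_compat; lra).
    assert (S1 : (r <= s)%R) by apply Rmax_l.
    assert (S2 : (Cmod w + 8 * PI / k <= s)%R) by apply Rmax_r.
    assert (B : (k <= 4 * PI * / (s - Cmod w))%R).
    { unfold k. rewrite (circ_int_annulus _ r s); [|lra|lra|intros z Hz; apply D; lra].
      apply circ_int_bound; [lra|apply CC; lra|].
      intros z Hz. rewrite Cmod_inv by (apply NZ; lra). apply Rinv_le_contravar; [lra|].
      rewrite <- Hz. replace z with ((z - w) + w) at 1 by ring.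
      pose proof (Cmod_triangle (z - w) w). lra. }
    assert (/ (s - Cmod w) <= k / (8 * PI))%R.
    { replace (k / (8 * PI))%R with (/ (8 * PI / k))%R by (field; lra).
      apply Rinv_le_contravar; lra. }
    assert (4 * PI * / (s - Cmod w) <= 4 * PI * (k / (8 * PI)))%R by (apply Rmult_le_compat_l; lra).
    replace (4 * PI * (k / (8 * PI)))%R with (k / 2)%R in * by (field; lra). lra. }
  rewrite (circ_int_ext _ (fun z => 1 + w * / (z - w)) r).
  - rewrite circ_int_plus.
    + rewrite circ_int_const, circ_int_scal, Z by (now apply CC). ring.
    + intros t. apply cont_at_const.
    + intros t. apply cont_at_mult; [apply cont_at_const|now apply CC].
  - lra.
  - intros z Hz. field. apply NZ. lra.
Qed.

(** With the slope [phi] of [F] at [w], the integrand is [G z] + F(w) z/(z - w), where [G z] = z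
    phi(z) is holomorphic off [w] and continuous at [w]. Its integral is constant for radii on
    either side of |w|, continuous across |w|, and 0 at radius 0. *)
Theorem cauchy_formula F w r :
  (forall z, inD z -> cdiff F z) -> (Cmod w < r < 1)%R ->
  circ_int (fun z => z / (z - w) * F z) r = RtoC (2 * PI) * F w.
Proof.
  intros HF Hw. pose proof (Cmod_ge_0 w) as W0.
  assert (NZ : forall z, z <> w -> z - w <> 0).
  { intros z Hz E. apply Hz. replace z with ((z - w) + w) by ring. rewrite E. ring. }
  destruct (HF w ltac:(unfold inD; lra)) as [phi [Hphi Ephi]].
  set (G := fun z => z * phi z).
  assert (Dphi : forall z, inD z -> z <> w -> cdiff phi z).
  { intros z Hz Hzw.
    apply (cdiff_ext_loc (fun y => (F y - F w) / (y - w)) phi z (Cmod (z - w))).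
    - apply Cmod_gt_0. auto.
    - intros y Hy. rewrite (Ephi y). field. apply NZ. intros ->.
      rewrite Cmod_sub_sym in Hy. lra.
    - apply cdiff_div; auto.
      + apply cdiff_minus; [auto|apply cdiff_const].
      + apply cdiff_minus; [apply cdiff_id|apply cdiff_const]. }
  assert (DG : forall z, inD z -> z <> w -> cdiff G z).
  { intros z Hz Hzw. apply cdiff_mult; [apply cdiff_id|auto]. }
  assert (CG : forall z, inD z -> cont_at dC G z).
  { intros z Hz. destruct (excluded_middle_informative (z = w)) as [->|N].
    - apply cont_at_mult; [apply cont_at_id|auto].
    - apply cdiff_cont; auto. }
  set (K := circ_int G).
  (* A value taken at radii arbitrarily close to [x] is taken at [x]. It is used at 0 and, from both
     sides, at |w|. *)
  assert (Lim : forall x v, (0 <= x < 1)%R ->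
    (forall del, (0 < del)%R -> exists s, (0 <= s < 1)%R /\ (Rabs (s - x) < del)%R /\ K s = v) ->
    K x = v).
  { intros x v Hx H. assert (E : K x - v = 0).
    { apply Cmod_eq_0. apply Rle_antisym; [|apply Cmod_ge_0]. apply Rnot_lt_le. intros P.
      destruct (circ_int_continuous G x Hx CG _ P) as [del [Hd Kd]].
      destruct (H del Hd) as (s & Hs & Hsx & Es). specialize (Kd s Hs Hsx).
      fold K in Kd. rewrite Es, Cmod_sub_sym in Kd. lra. }
    replace (K x) with ((K x - v) + v) by ring. rewrite E. ring. }
  assert (K0 : K 0%R = 0).
  { unfold K. rewrite (circ_int_ext G (fun _ => 0) 0%R).
    - rewrite circ_int_const. ring.
    - lra.
    - intros z Hz. apply Cmod_eq_0 in Hz. subst z. unfold G. ring. }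
  assert (Kann : forall s s', (0 < s)%R -> (s <= s')%R -> (s' < 1)%R ->
     (s' < Cmod w \/ Cmod w < s)%R -> K s = K s').
  { intros s s' H1 H2 H3 H4. apply circ_int_annulus; auto.
    intros z Hz. apply DG; [unfold inD; lra|]. intros ->. lra. }
  assert (Kw : K (Cmod w) = 0).
  { destruct (Req_dec (Cmod w) 0) as [->|Nw]; [exact K0|].
    apply Lim; [lra|]. intros del Hd.
    set (s := Rmax (Cmod w / 2) (Cmod w - del / 2)).
    assert (S1 : (Cmod w / 2 <= s)%R) by apply Rmax_l.
    assert (S2 : (Cmod w - del / 2 <= s)%R) by apply Rmax_r.
    assert (S3 : (s < Cmod w)%R) by (apply Rmax_lub_lt; lra).
    exists s. split; [lra|]. split; [rewrite Rabs_left; lra|].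
    rewrite <- K0. symmetry. apply Lim; [lra|]. intros d Hdd.
    exists (Rmin s (d / 2)). pose proof (Rmin_l s (d / 2)) as M1. pose proof (Rmin_r s (d / 2)) as M2.
    assert (M3 : (0 < Rmin s (d / 2))%R) by (apply Rmin_pos; lra).
    split; [lra|]. split; [rewrite Rabs_pos_eq; lra|]. apply Kann; lra. }
  assert (Kr : K r = 0).
  { rewrite <- Kw. symmetry. apply Lim; [lra|]. intros d Hd.
    exists (Rmin r (Cmod w + d / 2)).
    pose proof (Rmin_l r (Cmod w + d / 2)) as M1. pose proof (Rmin_r r (Cmod w + d / 2)) as M2.
    assert (M3 : (Cmod w < Rmin r (Cmod w + d / 2))%R) by (apply Rmin_glb_lt; lra).
    split; [lra|]. split; [rewrite Rabs_pos_eq; lra|]. apply Kann; lra. }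
  assert (NZr : forall z, Cmod z = r -> z - w <> 0) by (intros z Hz; apply NZ; intros ->; lra).
  assert (CK : cont_circ (fun z => z / (z - w)) r).
  { intros t. apply cont_at_mult; [apply cont_at_id|apply cont_at_inv].
    - apply NZr. rewrite Cmod_polar, Rabs_pos_eq; lra.
    - apply cont_at_minus; [apply cont_at_id|apply cont_at_const]. }
  rewrite (circ_int_ext _ (fun z => G z + F w * (z / (z - w))) r).
  - rewrite circ_int_plus.
    + rewrite circ_int_scal, circ_int_kernel by (auto; lra). fold K. rewrite Kr. ring.
    + intros t. apply CG. unfold inD. rewrite Cmod_polar, Rabs_pos_eq; lra.
    + intros t. apply cont_at_mult; [apply cont_at_const|apply CK].
  - lra.
  - intros z Hz. rewrite (Ephi z). unfold G. field. auto.
Qed.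

(** * Estimates, and division by z *)

Lemma holD_cdiff f : holD f <-> forall z, inD z -> cdiff f z.
Proof. split; intros H z Hz; apply cdiff_iff_ex_derive; auto. Qed.

Lemma holD_cont_circ f r : holD f -> (0 <= r < 1)%R -> cont_circ f r.
Proof.
  intros H Hr t. apply cdiff_cont. apply holD_cdiff; auto.
  unfold inD. rewrite Cmod_polar, Rabs_pos_eq; lra.
Qed.

Lemma Cmod_sub_ge a b : (Cmod a - Cmod b <= Cmod (a - b))%R.
Proof.
  pose proof (Cmod_triangle (a - b) b) as T. replace (a - b + b) with a in T by ring. lra.
Qed.

(** The kernel is at most r/(r - |w|) on the circle, and the 2 is the loss of [circ_int_bound]. This
    weak maximum principle is enough because it is applied with [M] zero or against a power of
    |w|/r. *)
Lemma holD_bound f w r M :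
  holD f -> (Cmod w < r < 1)%R -> (forall z, Cmod z = r -> (Cmod (f z) <= M)%R) ->
  (Cmod (f w) <= 2 * r / (r - Cmod w) * M)%R.
Proof.
  intros Hf Hw HM. pose proof PI_RGT_0 as HPI. pose proof (Cmod_ge_0 w) as W0.
  pose proof (cauchy_formula f w r (proj1 (holD_cdiff f) Hf) Hw) as E.
  apply (f_equal Cmod) in E. rewrite Cmod_mult, Cmod_R, Rabs_pos_eq in E by lra.
  assert (NZ : forall z, Cmod z = r -> z - w <> 0).
  { intros z Hz K. pose proof (Cmod_sub_ge z w) as T. rewrite K, Cmod_0 in T. lra. }
  assert (Hr : forall t, Cmod (polar r t) = r) by (intros; rewrite Cmod_polar, Rabs_pos_eq; lra).
  assert (B : (Cmod (circ_int (fun z => (z / (z - w) * f z)%C) r) <= 4 * PI * (r / (r - Cmod w) * M))%R).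
  { apply circ_int_bound; [lra| |].
    - intros t. apply cont_at_mult; [|apply holD_cont_circ; auto; lra].
      apply cont_at_mult; [apply cont_at_id|apply cont_at_inv].
      + apply NZ, Hr.
      + apply cont_at_minus; [apply cont_at_id|apply cont_at_const].
    - intros z Hz. rewrite Cmod_mult, Cmod_div by now apply NZ. rewrite Hz.
      pose proof (Cmod_sub_ge z w) as T. rewrite Hz in T.
      apply Rmult_le_compat; auto using Cmod_ge_0.
      + apply Rmult_le_pos; [lra|]. left. apply Rinv_0_lt_compat. lra.
      + apply Rmult_le_compat_l; [lra|]. apply Rinv_le_contravar; lra. }
  rewrite E in B.
  apply Rmult_le_reg_l with (2 * PI)%R; [lra|]. eapply Rle_trans; [exact B|].
  right. field. lra.
Qed.

(** The kernel expands as z/(z - w) = 1 + w/z + w^2/z^2 + w^3/(z^2 (z - w)). In Cauchy's formula the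
    first term gives f(0) = 0, so f(w) = w (a + w (b + w c(w))) and the quotient extends by [a]. *)
Lemma holD_div_id f : holD f -> f 0 = 0 ->
  exists f1, holD f1 /\ forall z, inD z -> f z = z * f1 z.
Proof.
  intros Hf H0. pose proof (proj1 (holD_cdiff f) Hf) as Df. pose proof PI_RGT_0 as HPI.
  set (r := (/ 2)%R). assert (Hr : (0 <= r < 1)%R) by (unfold r; lra).
  pose proof (holD_cont_circ f r Hf Hr) as Cf.
  assert (Cr : forall t, Cmod (polar r t) = r) by (intros; rewrite Cmod_polar, Rabs_pos_eq; lra).
  assert (NZ : forall z, Cmod z = r -> z <> 0).
  { intros z Hz E. rewrite E, Cmod_0 in Hz. unfold r in Hz. lra. }
  assert (NZw : forall z w, Cmod z = r -> (Cmod w < r)%R -> z - w <> 0).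
  { intros z w Hz Hw K. pose proof (Cmod_sub_ge z w) as T. rewrite K, Cmod_0 in T. lra. }
  assert (Cinvz : cont_circ (fun z => / z) r).
  { intros t. apply cont_at_inv; [apply NZ, Cr|apply cont_at_id]. }
  set (P := RtoC (2 * PI)). pose proof two_PI_neq_0 as HP. fold P in HP.
  set (K := fun (w z : C) => / (z - w) * (/ z * (/ z * f z))).
  assert (CK : forall w, (Cmod w < r)%R -> cont_circ (K w) r).
  { intros w Hw t. apply cont_at_mult; [|repeat (apply cont_at_mult; [apply Cinvz|]); apply Cf].
    apply cont_at_inv; [apply NZw; auto|]. apply cont_at_minus; [apply cont_at_id|apply cont_at_const]. }
  set (a := circ_int (fun z => / z * f z) r / P).
  set (b := circ_int (fun z => / z * (/ z * f z)) r / P).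
  set (c := fun w => circ_int (K w) r / P).
  assert (Exp : forall w, (Cmod w < r)%R -> f w = w * (a + w * (b + w * c w))).
  { intros w Hw.
    assert (Z : circ_int f r = 0).
    { rewrite <- (circ_int_ext (fun z => z / (z - 0) * f z) f r).
      - rewrite cauchy_formula; auto; [rewrite H0; ring|]. rewrite Cmod_0. unfold r; lra.
      - lra.
      - intros z Hz. field. replace (z - 0) with z by ring. now apply NZ. }
    pose proof (cauchy_formula f w r Df ltac:(lra)) as E.
    rewrite (circ_int_ext _ (fun z => f z + w * (/ z * f z + w * (/ z * (/ z * f z) + w * K w z))) r) in E.
    - assert (C3 : cont_circ (fun z => / z * (/ z * f z) + w * K w z) r).
      { intros t. apply cont_at_plus; [repeat (apply cont_at_mult; [apply Cinvz|]); apply Cf|].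
        apply cont_at_mult; [apply cont_at_const|apply CK; auto]. }
      assert (C2 : cont_circ (fun z => / z * f z + w * (/ z * (/ z * f z) + w * K w z)) r).
      { intros t. apply cont_at_plus; [apply cont_at_mult; [apply Cinvz|apply Cf]|].
        apply cont_at_mult; [apply cont_at_const|apply C3]. }
      rewrite circ_int_plus, Z, circ_int_scal in E; auto.
      2: { intros t. apply cont_at_mult; [apply cont_at_const|apply C2]. }
      rewrite circ_int_plus, circ_int_scal in E; auto.
      2: { intros t. apply cont_at_mult; [apply Cinvz|apply Cf]. }
      2: { intros t. apply cont_at_mult; [apply cont_at_const|apply C3]. }
      rewrite circ_int_plus, circ_int_scal in E; auto.
      2: { intros t. repeat (apply cont_at_mult; [apply Cinvz|]); apply Cf. }
      2: { intros t. apply cont_at_mult; [apply cont_at_const|apply CK; auto]. }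
      unfold a, b, c. fold P in E.
      replace (f w) with ((P * f w) / P) by (field; auto). rewrite <- E. field. auto.
    - lra.
    - intros z Hz. unfold K. field. split; [now apply NZ|now apply NZw]. }
  exists (fun w : C => if excluded_middle_informative (w = 0) then a else f w / w).
  split.
  - apply holD_cdiff. intros z Hz. destruct (excluded_middle_informative (z = 0)) as [->|N].
    + apply (cdiff_ext_loc (fun w : C => a + w * (b + w * c w)) _ 0 r).
      * unfold r; lra.
      * intros w Hw. replace (w - 0) with w in Hw by ring.
        destruct excluded_middle_informative as [->|N]; [ring|].
        rewrite (Exp w Hw). field; auto.
      (* Expanding to third order makes this slope continuous at 0 as soon as [c] is bounded there;
         no regularity of [c] is needed. *)
      * exists (fun w => b + w * c w). split; [|intros; ring].
        assert (BM : exists M, (0 < M)%R /\ forall w, (Cmod w < r / 2)%R -> (Cmod (c w) <= M)%R).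
        { assert (CG : cont_circ (fun z => / z * (/ z * f z)) r).
          { intros t. repeat (apply cont_at_mult; [apply Cinvz|]); apply Cf. }
          destruct (cont_circ_bounded _ r ltac:(lra) CG) as [M [HM BM]].
          exists (4 * PI * (/ (r / 2) * M) / (2 * PI))%R. split.
          { apply Rdiv_lt_0_compat; [|lra]. apply Rmult_lt_0_compat; [lra|].
            apply Rmult_lt_0_compat; [|auto]. apply Rinv_0_lt_compat. unfold r; lra. }
          intros w Hw. unfold c, P.
          rewrite Cmod_div, Cmod_R, (Rabs_pos_eq (2 * PI)) by (auto; lra).
          apply Rmult_le_compat_r; [left; apply Rinv_0_lt_compat; lra|].
          apply circ_int_bound; [lra|apply CK; lra|].
          intros u Hu. unfold K. rewrite Cmod_mult, Cmod_inv by (apply NZw; auto; lra).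
          apply Rmult_le_compat; auto using Cmod_ge_0.
          - left. apply Rinv_0_lt_compat. apply Cmod_gt_0. apply NZw; auto; lra.
          - apply Rinv_le_contravar; [unfold r; lra|]. pose proof (Cmod_sub_ge u w). lra. }
        destruct BM as [M [HM BM]].
        intros eps He. exists (Rmin (r / 2) (eps / M)). split.
        { apply Rmin_pos; [unfold r; lra|]. apply Rdiv_lt_0_compat; lra. }
        intros w Hw. unfold dC in Hw. replace (w - 0) with w in Hw by ring.
        replace (b + w * c w - (b + 0 * c 0)) with (w * c w) by ring. rewrite Cmod_mult.
        assert (W1 : (Cmod w < r / 2)%R) by (eapply Rlt_le_trans; [exact Hw|apply Rmin_l]).
        assert (W2 : (Cmod w < eps / M)%R) by (eapply Rlt_le_trans; [exact Hw|apply Rmin_r]).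
        apply Rle_lt_trans with (Cmod w * M)%R.
        { apply Rmult_le_compat_l; [apply Cmod_ge_0|now apply BM]. }
        apply (Rmult_lt_compat_r M) in W2; auto.
        replace (eps / M * M)%R with eps in W2 by (field; lra). exact W2.
    + apply (cdiff_ext_loc (fun w : C => f w / w) _ z (Cmod z)).
      * now apply Cmod_gt_0.
      * intros w Hw. destruct excluded_middle_informative as [->|]; auto.
        replace (0 - z) with (- z) in Hw by ring. rewrite Cmod_opp in Hw. lra.
      * apply cdiff_div; auto. apply cdiff_id.
  - intros z Hz. destruct excluded_middle_informative as [->|N].
    + rewrite H0. ring.
    + field. auto.
Qed.

(** * Banach spaces of holomorphic functions *)

Definition fsub (f g : C -> C) : C -> C := fadd f (fscal (-1) g).

Definition shift (A : (C -> C) -> (C -> C)) (mu : C) : (C -> C) -> (C -> C) :=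
  fun f => fadd (A f) (fscal (- mu) f).

Ltac eqD_ring := intros ? ?; unfold fsub, shift, fadd, fscal, fzero; ring.

Lemma eqD_sym f g : eqD f g -> eqD g f.
Proof. intros H z Hz. symmetry. auto. Qed.

Lemma eqD_trans f g h : eqD f g -> eqD g h -> eqD f h.
Proof. intros H K z Hz. rewrite H; auto. Qed.

Lemma small_eq_0 (x : R) : (0 <= x)%R -> (forall eps, (0 < eps)%R -> (x <= eps)%R) -> x = 0%R.
Proof.
  intros H0 H. apply Rle_antisym; auto. apply Rnot_lt_le. intros P.
  specialize (H (x / 2)%R ltac:(lra)). lra.
Qed.

Lemma pow_small (q c eps : R) : (0 <= q < 1)%R -> (0 < eps)%R ->
  exists n0, forall n, (n0 <= n)%nat -> (c * q ^ n < eps)%R.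
Proof.
  intros Hq He.
  destruct (pow_lt_1_zero q ltac:(rewrite Rabs_pos_eq; lra) (eps / (Rabs c + 1))) as [n0 H].
  { apply Rdiv_lt_0_compat; auto. pose proof (Rabs_pos c). lra. }
  exists n0. intros n Hn. specialize (H n Hn).
  pose proof (pow_le q n ltac:(lra)) as P. rewrite Rabs_pos_eq in H by auto.
  pose proof (Rabs_pos c) as Pc. pose proof (RRle_abs c) as Rc.
  apply (Rmult_lt_compat_l (Rabs c + 1)) in H; [|lra].
  replace ((Rabs c + 1) * (eps / (Rabs c + 1)))%R with eps in H by (field; lra). nra.
Qed.

Section Banach.

Context {X : (C -> C) -> Prop} {N : (C -> C) -> R}.
Hypothesis HX : banach_subspace_Hol X N.

Lemma X_holD f : X f -> holD f.
Proof. apply HX. Qed.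

Lemma X_ext f g : X f -> eqD f g -> X g.
Proof. intros Hf E. now destruct (proj1 (proj2 HX) f g Hf E). Qed.

Lemma N_ext f g : X f -> eqD f g -> N g = N f.
Proof. intros Hf E. now destruct (proj1 (proj2 HX) f g Hf E). Qed.

Lemma X_zero : X fzero.
Proof. apply HX. Qed.

Lemma X_add f g : X f -> X g -> X (fadd f g).
Proof. apply HX. Qed.

Lemma X_scal a f : X f -> X (fscal a f).
Proof. apply HX. Qed.

Lemma X_sub f g : X f -> X g -> X (fsub f g).
Proof. intros. apply X_add; auto. now apply X_scal. Qed.

Lemma N_ge_0 f : X f -> (0 <= N f)%R.
Proof. apply HX. Qed.

Lemma N_eq_0 f : X f -> (N f = 0%R <-> eqD f fzero).
Proof. apply HX. Qed.

Lemma N_zero : N fzero = 0%R.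
Proof. apply N_eq_0; [apply X_zero|]. now intros z Hz. Qed.

Lemma N_add f g : X f -> X g -> (N (fadd f g) <= N f + N g)%R.
Proof. apply HX. Qed.

Lemma N_scal a f : X f -> N (fscal a f) = (Cmod a * N f)%R.
Proof. apply HX. Qed.

Lemma eval_bound r : (0 <= r)%R -> (r < 1)%R -> exists c : R, (0 <= c)%R /\
  forall f, X f -> forall z, (Cmod z <= r)%R -> (Cmod (f z) <= c * N f)%R.
Proof.
  intros H1 H2. destruct HX as (_ & _ & _ & _ & _ & _ & _ & _ & _ & _ & H).
  destruct (H r H1 H2) as [c Hc]. exists (Rmax 0 c). split; [apply Rmax_l|].
  intros f Hf z Hz. eapply Rle_trans; [apply Hc; auto|].
  apply Rmult_le_compat_r; [now apply N_ge_0|apply Rmax_r].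
Qed.

Lemma N_scal_m1 f : X f -> N (fscal (-1) f) = N f.
Proof.
  intros Hf. rewrite N_scal by auto. rewrite Cmod_R, Rabs_left by lra. ring.
Qed.

Lemma N_sub f g : X f -> X g -> (N (fsub f g) <= N f + N g)%R.
Proof.
  intros Hf Hg. eapply Rle_trans; [apply N_add; auto; now apply X_scal|].
  rewrite N_scal_m1; auto. lra.
Qed.

Lemma N_sub_sym f g : X f -> X g -> N (fsub f g) = N (fsub g f).
Proof.
  intros Hf Hg. rewrite <- (N_scal_m1 (fsub g f)) by now apply X_sub.
  apply N_ext; [apply X_scal, X_sub; auto|].
  intros z Hz. unfold fsub, fadd, fscal. ring.
Qed.

Lemma N_le_add f g h : X g -> X h -> eqD f (fadd g h) -> (N f <= N g + N h)%R.
Proof.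
  intros Hg Hh E. rewrite (N_ext (fadd g h) f).
  - now apply N_add.
  - now apply X_add.
  - now apply eqD_sym.
Qed.

Lemma N_sub_trans f g h : X f -> X g -> X h -> (N (fsub f h) <= N (fsub f g) + N (fsub g h))%R.
Proof.
  intros. apply N_le_add; try now apply X_sub.
  intros z Hz. unfold fsub, fadd, fscal. ring.
Qed.

Lemma N_sub_eq_0 f g : X f -> X g -> N (fsub f g) = 0%R -> eqD f g.
Proof.
  intros Hf Hg E. apply N_eq_0 in E; [|now apply X_sub].
  intros z Hz. specialize (E z Hz). unfold fsub, fadd, fscal, fzero in E.
  replace (f z) with ((f z + (-1) * g z) + g z) by (ring). rewrite E. ring.
Qed.

(** The one place where completeness of X enters. The explicit rate serves the later limits, and its
    value at n = 0 also bounds the limit itself. *)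
Lemma geometric_limit (u : nat -> C -> C) (c q : R) :
  (0 <= q < 1)%R -> (forall n, X (u n)) ->
  (forall n, (N (fsub (u (S n)) (u n)) <= c * q ^ n)%R) ->
  exists g, X g /\ forall n, (N (fsub g (u n)) <= c / (1 - q) * q ^ n)%R.
Proof.
  intros Hq Hu Hd.
  assert (Hc : (0 <= c)%R).
  { specialize (Hd 0%nat). pose proof (N_ge_0 _ (X_sub _ _ (Hu 1%nat) (Hu 0%nat))). simpl in Hd. lra. }
  set (c' := (c / (1 - q))%R).
  assert (Hc' : (0 <= c')%R).
  { apply Rmult_le_pos; auto. left. apply Rinv_0_lt_compat. lra. }
  (* Keeping the difference [q ^ n - q ^ (k + n)] makes the induction telescope. *)
  assert (T : forall k n, (N (fsub (u (k + n)%nat) (u n)) <= c' * (q ^ n - q ^ (k + n)))%R).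
  { induction k as [|k IH]; intros n.
    - simpl. rewrite (N_ext fzero); [rewrite N_zero; lra|apply X_zero|].
      intros z Hz. unfold fzero, fsub, fadd, fscal. ring.
    - simpl. eapply Rle_trans; [apply (N_sub_trans _ (u (k + n)%nat)); auto|].
      specialize (IH n). specialize (Hd (k + n)%nat).
      replace c with (c' * (1 - q))%R in Hd by (unfold c'; field; lra). lra. }
  assert (T' : forall m n, (n <= m)%nat -> (N (fsub (u m) (u n)) <= c' * q ^ n)%R).
  { intros m n Hmn. replace m with ((m - n) + n)%nat by lia.
    eapply Rle_trans; [apply T|]. apply Rmult_le_compat_l; auto.
    pose proof (pow_le q (m - n + n) ltac:(lra)). lra. }
  destruct HX as (_ & _ & _ & _ & _ & _ & _ & _ & _ & Comp & _).
  destruct (Comp u Hu) as [g [Hg Lim]].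
  { intros eps He. destruct (pow_small q c' (eps / 2) Hq ltac:(lra)) as [n0 Hn0].
    exists n0. intros p r Hp Hr. specialize (Hn0 n0 (Nat.le_refl _)).
    change (N (fsub (u p) (u r)) < eps)%R.
    eapply Rle_lt_trans; [apply (N_sub_trans _ (u n0)); auto|].
    rewrite (N_sub_sym (u n0)) by auto.
    pose proof (T' p n0 Hp). pose proof (T' r n0 Hr). lra. }
  exists g. split; auto. intros n. apply Rnot_lt_le. intros P.
  destruct (Lim (N (fsub g (u n)) - c' * q ^ n)%R ltac:(lra)) as [n0 Hn0].
  set (p := Nat.max n n0). specialize (Hn0 p ltac:(lia)). fold (fsub (u p) g) in Hn0.
  pose proof (N_sub_trans g (u p) (u n) Hg (Hu p) (Hu n)) as Q.
  rewrite (N_sub_sym g (u p)) in Q by auto. pose proof (T' p n ltac:(lia)). lra.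
Qed.

Section Operator.

Context {A : (C -> C) -> (C -> C)}.
Hypothesis HA : bounded_op X N A.

Lemma op_X f : X f -> X (A f).
Proof. apply HA. Qed.

Lemma op_ext f g : X f -> eqD f g -> eqD (A f) (A g).
Proof. apply HA. Qed.

Lemma op_lin a f g : X f -> X g -> eqD (A (fadd f (fscal a g))) (fadd (A f) (fscal a (A g))).
Proof. apply HA. Qed.

Lemma op_zero : eqD (A fzero) fzero.
Proof.
  intros z Hz.
  assert (E : A fzero z = A fzero z + 1 * A fzero z).
  { transitivity (A (fadd fzero (fscal 1 fzero)) z).
    - apply op_ext; auto using X_zero. eqD_ring.
    - now rewrite op_lin by auto using X_zero. }
  unfold fzero at 2. replace (A fzero z) with ((A fzero z + 1 * A fzero z) - A fzero z) by ring.
  rewrite <- E. ring.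
Qed.

Lemma op_scal a f : X f -> eqD (A (fscal a f)) (fscal a (A f)).
Proof.
  intros Hf z Hz. rewrite (op_ext (fscal a f) (fadd fzero (fscal a f))); auto.
  - rewrite op_lin; auto using X_zero. unfold fadd. rewrite op_zero by auto. unfold fzero, fscal. ring.
  - now apply X_scal.
  - eqD_ring.
Qed.

Lemma op_add f g : X f -> X g -> eqD (A (fadd f g)) (fadd (A f) (A g)).
Proof.
  intros Hf Hg z Hz. rewrite (op_ext (fadd f g) (fadd f (fscal 1 g))); auto.
  - rewrite op_lin; auto. unfold fadd, fscal. ring.
  - now apply X_add.
  - eqD_ring.
Qed.

Lemma op_sub f g : X f -> X g -> eqD (A (fsub f g)) (fsub (A f) (A g)).
Proof. apply op_lin. Qed.

Lemma op_bound : exists c, (0 < c)%R /\ forall f, X f -> (N (A f) <= c * N f)%R.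
Proof.
  destruct HA as (_ & _ & _ & c & Hc). exists (Rmax 1 c). split.
  - apply Rlt_le_trans with 1%R; [lra|apply Rmax_l].
  - intros f Hf. eapply Rle_trans; [apply Hc; auto|].
    apply Rmult_le_compat_r; [now apply N_ge_0|apply Rmax_r].
Qed.

Lemma shift_bounded mu : bounded_op X N (shift A mu).
Proof.
  split; [|split; [|split]].
  - intros f Hf. apply X_add; [now apply op_X|now apply X_scal].
  - intros f g Hf E z Hz. unfold shift, fadd, fscal. rewrite (op_ext f g Hf E z Hz), (E z Hz). auto.
  - intros a f g Hf Hg z Hz. unfold shift. unfold fadd at 1. rewrite op_lin by auto.
    unfold fadd, fscal. ring.
  - destruct op_bound as [c [_ Hc]]. exists (c + Cmod mu)%R. intros f Hf.
    eapply Rle_trans; [apply N_add; [now apply op_X|now apply X_scal]|].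
    rewrite N_scal, Cmod_opp by auto. specialize (Hc f Hf). lra.
Qed.

(** The Neumann series, with partial sums u(n+1) = f + A u(n). A bound on the powers is assumed
    instead of a norm below 1, so that contractions and operators with a mere power bound are
    treated alike. *)
Lemma neumann_surj c q : (0 <= q < 1)%R ->
  (forall n f, X f -> (N (Nat.iter n A f) <= c * q ^ n * N f)%R) ->
  forall f, X f -> exists g, X g /\ eqD (fsub g (A g)) f.
Proof.
  intros Hq HP f Hf.
  set (u := fix u n := match n with O => fzero | S n => fadd f (A (u n)) end).
  assert (Xu : forall n, X (u n)).
  { induction n; [apply X_zero|]. apply X_add; auto. now apply op_X. }
  assert (XI : forall n, X (Nat.iter n A f)).
  { induction n; simpl; auto. now apply op_X. }
  assert (D : forall n, eqD (fsub (u (S n)) (u n)) (Nat.iter n A f)).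
  { induction n as [|n IH]; intros z Hz.
    - unfold fsub, fadd, fscal. simpl u. unfold fadd. rewrite op_zero by auto. simpl. unfold fzero. ring.
    - transitivity (A (fsub (u (S n)) (u n)) z).
      + rewrite op_sub by auto. change (u (S (S n))) with (fadd f (A (u (S n)))).
        change (u (S n)) with (fadd f (A (u n))) at 2.
        unfold fsub, fadd, fscal. ring.
      + change (Nat.iter (S n) A f) with (A (Nat.iter n A f)). apply op_ext; auto. now apply X_sub. }
  destruct (geometric_limit u (c * N f) q Hq Xu) as [g [Hg Lim]].
  { intros n. rewrite (N_ext (Nat.iter n A f)); auto using eqD_sym.
    eapply Rle_trans; [apply HP; auto|]. right; ring. }
  exists g. split; auto. destruct op_bound as [b [Hb HB]].
  assert (E : eqD g (fadd f (A g))).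
  { apply N_sub_eq_0; auto. { apply X_add; auto. now apply op_X. }
    apply small_eq_0. { apply N_ge_0, X_sub; auto. apply X_add; auto. now apply op_X. }
    intros eps He. set (k := (c * N f / (1 - q))%R) in *.
    destruct (pow_small q ((1 + b) * Rabs k) eps Hq He) as [n Hn].
    specialize (Hn n (Nat.le_refl n)).
    assert (XA : forall h, X h -> X (fadd f (A h))) by (intros; apply X_add; auto; now apply op_X).
    eapply Rle_trans; [apply (N_sub_trans g (u (S n))); auto|].
    assert (B2 : (N (fsub (u (S n)) (fadd f (A g))) <= b * (k * q ^ n))%R).
    { rewrite (N_ext (A (fsub (u n) g))).
      - eapply Rle_trans; [apply HB, X_sub; auto|]. apply Rmult_le_compat_l; [lra|].
        rewrite N_sub_sym by auto. apply Lim.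
      - apply op_X, X_sub; auto.
      - intros z Hz. rewrite op_sub by auto. simpl u. unfold fsub, fadd, fscal. ring. }
    pose proof (Lim (S n)) as B1. rewrite <- tech_pow_Rmult in B1.
    pose proof (pow_le q n ltac:(lra)) as Pq.
    assert (k * q ^ n <= Rabs k * q ^ n)%R by (apply Rmult_le_compat_r; auto; apply RRle_abs).
    assert (k * (q * q ^ n) <= Rabs k * q ^ n)%R.
    { pose proof (RRle_abs k). pose proof (Rabs_pos k).
      apply Rle_trans with (Rabs k * (q * q ^ n))%R; [apply Rmult_le_compat_r; nra|].
      apply Rmult_le_compat_l; nra. }
    assert (b * (k * q ^ n) <= b * (Rabs k * q ^ n))%R by (apply Rmult_le_compat_l; lra).
    lra. }
  intros z Hz. unfold fsub, fadd, fscal. rewrite (E z Hz) at 1. unfold fadd. ring.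
Qed.

(** A fixed vector is fixed by all iterates, whose norms tend to 0. *)
Lemma neumann_inj c q : (0 <= q < 1)%R ->
  (forall n f, X f -> (N (Nat.iter n A f) <= c * q ^ n * N f)%R) ->
  forall g, X g -> eqD (A g) g -> eqD g fzero.
Proof.
  intros Hq HP g Hg E. apply N_eq_0; auto. apply small_eq_0; [now apply N_ge_0|].
  intros eps He.
  assert (I : forall n, X (Nat.iter n A g) /\ eqD (Nat.iter n A g) g).
  { induction n as [|n [I1 I2]]; simpl; [split; auto; now intros z|].
    split; [now apply op_X|]. apply eqD_trans with (A g); auto. now apply op_ext. }
  destruct (pow_small q (c * N g) eps Hq He) as [n Hn].
  rewrite (N_ext (Nat.iter n A g)) by apply I.
  eapply Rle_trans; [apply HP; auto|].
  specialize (Hn n (Nat.le_refl n)). lra.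
Qed.

End Operator.

End Banach.

(** * The bounded inverse theorem *)

Section BoundedInverse.

Context {X : (C -> C) -> Prop} {N : (C -> C) -> R}.
Hypothesis HX : banach_subspace_Hol X N.
Context {A : (C -> C) -> (C -> C)}.
Hypothesis HA : bounded_op X N A.
Hypothesis A_inj : forall f, X f -> eqD (A f) fzero -> eqD f fzero.
Context (S : (C -> C) -> (C -> C)).
Hypothesis S_X : forall f, X f -> X (S f).
Hypothesis A_S : forall f, X f -> eqD (A (S f)) f.

Lemma op_inj f g : X f -> X g -> eqD (A f) (A g) -> eqD f g.
Proof.
  intros Hf Hg E.
  assert (Z : eqD (fsub f g) fzero).
  { apply A_inj; [now apply (X_sub HX)|]. intros z Hz. rewrite (op_sub HA) by auto.
    unfold fsub, fadd, fscal. rewrite (E z Hz). unfold fzero. ring. }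
  intros z Hz. specialize (Z z Hz). unfold fsub, fadd, fscal, fzero in Z.
  replace (f z) with ((f z + (-1) * g z) + g z) by ring. rewrite Z. ring.
Qed.

Lemma S_lin a f g : X f -> X g -> eqD (S (fadd f (fscal a g))) (fadd (S f) (fscal a (S g))).
Proof.
  intros Hf Hg.
  assert (X (fadd f (fscal a g))) by (apply (X_add HX); auto; now apply (X_scal HX)).
  apply op_inj.
  - now apply S_X.
  - apply (X_add HX); auto. apply (X_scal HX); auto.
  - intros z Hz. rewrite A_S by auto. rewrite (op_lin HA) by auto.
    unfold fadd, fscal. rewrite !A_S by auto. ring.
Qed.

Lemma S_ext f g : X f -> eqD f g -> eqD (S f) (S g).
Proof.
  intros Hf E. assert (Hg : X g) by (eapply (X_ext HX); eauto).
  apply op_inj; auto. intros z Hz. rewrite !A_S by auto. auto.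
Qed.

(** Quantified over all [eps], this says that [f] lies in the closure of the set where the preimage
    under [A] has norm at most [n]. *)
Definition near_small (n : nat) (f : C -> C) (eps : R) : Prop :=
  exists f', X f' /\ (N (fsub f' f) < eps)%R /\ (N (S f') <= INR n)%R.

(* Baire's theorem for the sets [N (S f) <= n], whose union is X. *)
Lemma ball_in_closure : exists n f0 del, X f0 /\ (0 < del)%R /\
  forall f, X f -> (N (fsub f f0) < del)%R -> forall eps, (0 < eps)%R -> near_small n f eps.
Proof.
  apply NNPP. intros HN.
  (* A pair is a centre and a radius. If no closure contains a ball, every ball contains another one
     that misses the set of index [n]; moving the centre by less than a quarter and halving the
     radius keeps the limit strictly inside. *)
  assert (Step : forall (n : nat) (s : (C -> C) * R), exists s' : (C -> C) * R,
    X (fst s) -> (0 < snd s)%R ->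
    X (fst s') /\ (0 < snd s' <= snd s / 2)%R /\ (N (fsub (fst s') (fst s)) < snd s / 4)%R /\
    ~ near_small n (fst s') (snd s')).
  { intros n [f0 d]; simpl. apply NNPP. intros HN2. apply HN. exists n, f0, (d / 4)%R.
    assert (X f0 /\ (0 < d)%R) as [Hf0 Hd].
    { apply NNPP. intros K. apply HN2. exists (f0, d). intros. exfalso. auto. }
    split; auto. split; [lra|]. intros f Hf Hfd eps He. apply NNPP. intros K.
    apply HN2. exists (f, Rmin eps (d / 2)). simpl. intros _ _. split; auto. split; [|split; auto].
    - split; [apply Rmin_pos; lra|apply Rmin_r].
    - intros (f' & H1 & H2 & H3). apply K. exists f'. split; auto. split; auto.
      eapply Rlt_le_trans; [exact H2|apply Rmin_l]. }
  assert (exists F : nat * ((C -> C) * R) -> (C -> C) * R, forall p,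
    X (fst (snd p)) -> (0 < snd (snd p))%R ->
    X (fst (F p)) /\ (0 < snd (F p) <= snd (snd p) / 2)%R /\
    (N (fsub (fst (F p)) (fst (snd p))) < snd (snd p) / 4)%R /\
    ~ near_small (fst p) (fst (F p)) (snd (F p))) as [F HF].
  { apply (functional_choice (fun (p : nat * ((C -> C) * R)) (s' : (C -> C) * R) =>
      X (fst (snd p)) -> (0 < snd (snd p))%R ->
      X (fst s') /\ (0 < snd s' <= snd (snd p) / 2)%R /\
      (N (fsub (fst s') (fst (snd p))) < snd (snd p) / 4)%R /\
      ~ near_small (fst p) (fst s') (snd s'))).
    intros [n s]. apply Step. }
  set (s := fix s n := match n with O => (fzero, 1%R) | Datatypes.S n => F (n, s n) end).
  assert (I : forall n, X (fst (s n)) /\ (0 < snd (s n) <= (/ 2) ^ n)%R).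
  { induction n as [|n [I1 I2]]; simpl; [split; [apply (X_zero HX)|lra]|].
    destruct (HF (n, s n) I1 (proj1 I2)) as (H1 & H2 & _). simpl in H2. split; auto. lra. }
  assert (D : forall n, (snd (s (Datatypes.S n)) <= snd (s n) / 2)%R /\
    (N (fsub (fst (s (Datatypes.S n))) (fst (s n))) < snd (s n) / 4)%R /\
    ~ near_small n (fst (s (Datatypes.S n))) (snd (s (Datatypes.S n)))).
  { intros n. destruct (I n) as [I1 I2]. destruct (HF (n, s n) I1 (proj1 I2)) as (_ & H2 & H3 & H4).
    simpl in *. split; [lra|split]; auto. }
  destruct (geometric_limit HX (fun n => fst (s n)) 1 (/ 2) ltac:(lra)) as [g [Hg Lim]].
  { intros n. apply I. }
  { intros n. destruct (D n) as (_ & H & _). destruct (I n) as [_ H']. lra. }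
  assert (In : forall n, (N (fsub g (fst (s n))) < snd (s n))%R).
  { intros n.
    (* Distance plus half the current radius never exceeds half the initial one; the other half is
       left for the tail of the limit. *)
    assert (T : forall k, (N (fsub (fst (s (k + n)%nat)) (fst (s n))) + snd (s (k + n)%nat) / 2 <= snd (s n) / 2)%R).
    { induction k as [|k IH].
      - simpl. rewrite (N_ext HX fzero); [rewrite (N_zero HX); lra|apply (X_zero HX)|eqD_ring].
      - destruct (D (k + n)%nat) as (D1 & D2 & _).
        pose proof (N_sub_trans HX (fst (s (Datatypes.S (k + n)))) (fst (s (k + n)%nat)) (fst (s n))
          (proj1 (I _)) (proj1 (I _)) (proj1 (I _))).
        change (Datatypes.S k + n)%nat with (Datatypes.S (k + n)). lra. }
    destruct (pow_small (/ 2) (1 / (1 - / 2)) (snd (s n) / 2) ltac:(lra)) as [k Hk].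
    { destruct (I n). lra. }
    specialize (Hk (k + n)%nat ltac:(lia)). specialize (T k). specialize (Lim (k + n)%nat).
    pose proof (N_sub_trans HX g (fst (s (k + n)%nat)) (fst (s n)) Hg (proj1 (I _)) (proj1 (I _))).
    destruct (I (k + n)%nat). simpl in *. lra. }
  (* The limit [g] has a preimage of finite norm, so it belongs to one of the sets that its balls
     were built to avoid. *)
  destruct (INR_unbounded (N (S g))) as [n Hn].
  destruct (D n) as (_ & _ & H). apply H. exists g. split; auto. split; [apply In|lra].
Qed.

(** Approximate both f0 + t f and f0 inside the ball and subtract: the preimage has norm at most 2n
    before division by t = del / (2 N f), which gives the constant 4n/del. *)
Lemma approx_preimage : exists c, (0 <= c)%R /\ forall f, X f -> forall eps, (0 < eps)%R ->
  exists f', X f' /\ (N (fsub f f') < eps)%R /\ (N (S f') <= c * N f)%R.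
Proof.
  destruct ball_in_closure as (n & f0 & del & Hf0 & Hdel & HB).
  pose proof (pos_INR n) as Pn.
  exists (4 * INR n / del)%R. split. { apply Rmult_le_pos; [lra|]. left. now apply Rinv_0_lt_compat. }
  intros f Hf eps He. pose proof (N_ge_0 HX f Hf) as [Pf|Zf].
  - set (t := (del / (2 * N f))%R). assert (Ht : (0 < t)%R) by (apply Rdiv_lt_0_compat; lra).
    (* Two errors of this size are added and then divided by [t]. *)
    set (e := (eps * t / 2)%R). assert (He' : (0 < e)%R).
    { apply Rdiv_lt_0_compat; [now apply Rmult_lt_0_compat|lra]. }
    assert (Xt : X (fadd f0 (fscal t f))) by (apply (X_add HX); auto; now apply (X_scal HX)).
    destruct (HB (fadd f0 (fscal t f)) Xt) with (eps := e) as (f1 & H1 & H2 & H3); auto.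
    { rewrite (N_ext HX (fscal t f)).
      - rewrite (N_scal HX), Cmod_R, Rabs_pos_eq by (auto; lra). unfold t.
        replace (del / (2 * N f) * N f)%R with (del / 2)%R by (field; lra). lra.
      - now apply (X_scal HX).
      - eqD_ring. }
    destruct (HB f0 Hf0) with (eps := e) as (f2 & K1 & K2 & K3); auto.
    { rewrite (N_ext HX fzero); [rewrite (N_zero HX); lra|apply (X_zero HX)|eqD_ring]. }
    assert (Ht' : RtoC t <> 0) by (intros E; apply RtoC_inj in E; lra).
    assert (Ct : Cmod (/ RtoC t) = (/ t)%R) by (rewrite Cmod_inv, Cmod_R, Rabs_pos_eq; auto; lra).
    exists (fscal (/ RtoC t) (fsub f1 f2)). split; [apply (X_scal HX), (X_sub HX); auto|]. split.
    + rewrite (N_ext HX (fscal (/ RtoC t) (fsub (fsub f2 f0) (fsub f1 (fadd f0 (fscal t f)))))).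
      * rewrite (N_scal HX), Ct by (repeat apply (X_sub HX); auto).
        pose proof (N_sub HX (fsub f2 f0) (fsub f1 (fadd f0 (fscal t f)))
          (X_sub HX _ _ K1 Hf0) (X_sub HX _ _ H1 Xt)) as T.
        apply Rmult_lt_reg_l with t; auto. rewrite <- Rmult_assoc, Rinv_r, Rmult_1_l by lra.
        unfold e in *. lra.
      * apply (X_scal HX). repeat apply (X_sub HX); auto.
      * intros z Hz. unfold fsub, fadd, fscal. field. auto.
    + rewrite (N_ext HX (fscal (/ RtoC t) (fsub (S f1) (S f2)))).
      * rewrite (N_scal HX), Ct by (apply (X_sub HX); auto).
        replace (4 * INR n / del * N f)%R with (/ t * (2 * INR n))%R by (unfold t; field; lra).
        apply Rmult_le_compat_l; [left; now apply Rinv_0_lt_compat|].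
        pose proof (N_sub HX (S f1) (S f2) (S_X _ H1) (S_X _ K1)). lra.
      * apply (X_scal HX), (X_sub HX); auto.
      * apply op_inj.
        { apply (X_scal HX), (X_sub HX); auto. }
        { apply S_X, (X_scal HX), (X_sub HX); auto. }
        intros z Hz. rewrite (op_scal HX HA) by (auto; apply (X_sub HX); auto).
        unfold fscal at 1. rewrite (op_sub HA) by auto.
        rewrite A_S by (auto; apply (X_scal HX), (X_sub HX); auto).
        unfold fscal, fsub, fadd. unfold fscal. rewrite !A_S by auto. reflexivity.
  - exists fzero. split; [apply (X_zero HX)|]. split.
    + rewrite (N_ext HX f); [lra|auto|eqD_ring].
    + rewrite <- Zf, Rmult_0_r. right. apply (N_eq_0 HX); [apply S_X, (X_zero HX)|].
      apply A_inj; [apply S_X, (X_zero HX)|]. apply A_S, (X_zero HX).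
Qed.

(** The approximate preimages are applied to the successive errors. The errors are halved each time,
    so the preimages sum to an exact one, of norm at most 2 c N(f), which is S f by injectivity. *)
Lemma inverse_bound : exists c, forall f, X f -> (N (S f) <= c * N f)%R.
Proof.
  destruct approx_preimage as (c & Hc & HP). exists (2 * c)%R. intros f Hf.
  destruct (N_ge_0 HX f Hf) as [Pf|Zf].
  2: { rewrite <- Zf, Rmult_0_r. right. symmetry in Zf. apply (N_eq_0 HX) in Zf; auto.
       apply (N_eq_0 HX); auto. apply A_inj; auto.
       apply eqD_trans with f; auto. }
  set (a := N f) in *.
  assert (exists F : (C -> C) * R -> (C -> C), forall p, X (fst p) -> (0 < snd p)%R ->
     X (F p) /\ (N (fsub (fst p) (F p)) < snd p)%R /\ (N (S (F p)) <= c * N (fst p))%R) as [F HF].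
  { apply (functional_choice (fun (p : (C -> C) * R) f' => X (fst p) -> (0 < snd p)%R ->
       X f' /\ (N (fsub (fst p) f') < snd p)%R /\ (N (S f') <= c * N (fst p))%R)).
    intros [h e]. simpl. destruct (excluded_middle_informative (X h /\ (0 < e)%R)) as [[H1 H2]|K].
    - destruct (HP h H1 e H2) as [f' H']. exists f'. auto.
    - exists h. intros. exfalso. auto. }
  (* What is left of [f] after [n] corrections; its norm is at most a / 2^n, and the next correction
     is picked to halve that bound. *)
  set (err := fix err n := match n with O => f | Datatypes.S n => fsub (err n) (F (err n, a * (/ 2) ^ Datatypes.S n)%R) end).
  set (pick := fun n => F (err n, a * (/ 2) ^ Datatypes.S n)%R).
  assert (Pa : forall n, (0 < a * (/ 2) ^ n)%R).
  { intros n. apply Rmult_lt_0_compat; auto. apply pow_lt. lra. }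
  assert (IE : forall n, X (err n) /\ (N (err n) <= a * (/ 2) ^ n)%R).
  { induction n as [|n [I1 I2]].
    - simpl. split; auto. unfold a. lra.
    - destruct (HF (err n, a * (/ 2) ^ Datatypes.S n)%R I1 (Pa (Datatypes.S n))) as (H1 & H2 & _).
      simpl in H1, H2. split; [simpl; now apply (X_sub HX)|]. simpl. lra. }
  assert (IP : forall n, X (pick n) /\ (N (S (pick n)) <= c * a * (/ 2) ^ n)%R).
  { intros n. destruct (IE n) as [I1 I2].
    destruct (HF (err n, a * (/ 2) ^ Datatypes.S n)%R I1 (Pa (Datatypes.S n))) as (H1 & _ & H3).
    split; auto. eapply Rle_trans; [exact H3|]. simpl. rewrite Rmult_assoc.
    now apply Rmult_le_compat_l. }
  set (G := fix G n := match n with O => fzero | Datatypes.S n => fadd (G n) (S (pick n)) end).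
  assert (XG : forall n, X (G n)).
  { induction n; simpl; [apply (X_zero HX)|]. apply (X_add HX); auto. apply S_X, IP. }
  assert (AG : forall n, eqD (A (G n)) (fsub f (err n))).
  { induction n as [|n IH]; intros z Hz.
    - simpl. rewrite (op_zero HX HA) by auto. unfold fsub, fadd, fscal, fzero. ring.
    - change (G (Datatypes.S n)) with (fadd (G n) (S (pick n))).
      change (err (Datatypes.S n)) with (fsub (err n) (pick n)).
      rewrite (op_add HX HA) by (auto; apply S_X, IP). unfold fadd at 1.
      rewrite IH, A_S by (auto; apply IP). unfold fsub, fadd, fscal. ring. }
  destruct (geometric_limit HX G (c * a) (/ 2) ltac:(lra) XG) as [g [Hg Lim]].
  { intros n. rewrite (N_ext HX (S (pick n))); [apply IP|apply S_X, IP|].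
    change (G (Datatypes.S n)) with (fadd (G n) (S (pick n))). eqD_ring. }
  assert (E : eqD (A g) f).
  { apply (N_sub_eq_0 HX); auto; [now apply (op_X HA)|]. apply small_eq_0.
    { apply (N_ge_0 HX), (X_sub HX); auto. now apply (op_X HA). }
    intros eps He. destruct (op_bound HX HA) as [b [Hb HB]].
    set (k := (c * a / (1 - / 2))%R) in *.
    destruct (pow_small (/ 2) (b * k + a) eps ltac:(lra) He) as [n Hn].
    specialize (Hn n (Nat.le_refl n)).
    eapply Rle_trans; [apply (N_le_add HX) with (g := A (fsub g (G n))) (h := fscal (-1) (err n))|].
    - apply (op_X HA), (X_sub HX); auto.
    - apply (X_scal HX), IE.
    - intros z Hz. unfold fadd at 1. rewrite (op_sub HA) by auto.
      unfold fsub at 2. unfold fadd, fscal. rewrite (AG n z Hz). unfold fsub, fadd, fscal. ring.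
    - rewrite (N_scal_m1 HX) by apply IE. destruct (IE n) as [_ I].
      pose proof (HB (fsub g (G n)) (X_sub HX _ _ Hg (XG n))) as B1.
      assert (b * N (fsub g (G n)) <= b * (k * (/ 2) ^ n))%R by (apply Rmult_le_compat_l; [lra|apply Lim]).
      lra. }
  assert (E2 : eqD g (S f)).
  { apply op_inj; auto. apply eqD_trans with f; auto. apply eqD_sym, A_S; auto. }
  rewrite (N_ext HX g) by auto. specialize (Lim 0%nat). simpl in Lim.
  rewrite (N_ext HX g) in Lim; [|auto|eqD_ring].
  replace (2 * c * a)%R with (c * a / (1 - / 2) * 1)%R by field. exact Lim.
Qed.

End BoundedInverse.

(** * Invertibility and bijectivity *)

Section Invertibility.

Context {X : (C -> C) -> Prop} {N : (C -> C) -> R}.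
Hypothesis HX : banach_subspace_Hol X N.
Context {A : (C -> C) -> (C -> C)}.
Hypothesis HA : bounded_op X N A.

(** Injectivity makes any choice of preimages linear and compatible with [eqD]; boundedness is the
    bounded inverse theorem. Off X the chosen value is arbitrary. *)
Lemma bijective_invertible :
  (forall f, X f -> eqD (A f) fzero -> eqD f fzero) ->
  (forall f, X f -> exists g, X g /\ eqD (A g) f) ->
  invertible_op X N A.
Proof.
  intros Hinj Hsurj.
  destruct (functional_choice (fun f g => X f -> X g /\ eqD (A g) f)) as [S HS].
  { intros f. destruct (excluded_middle_informative (X f)) as [Hf|K].
    - destruct (Hsurj f Hf) as [g Hg]. exists g. auto.
    - exists f. intros. contradiction. }
  assert (S_X : forall f, X f -> X (S f)) by (intros f Hf; now apply HS).
  assert (A_S : forall f, X f -> eqD (A (S f)) f) by (intros f Hf; now apply HS).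
  exists S. split; [split; [|split; [|split]]|].
  - exact S_X.
  - apply (S_ext HX HA Hinj S S_X A_S).
  - apply (S_lin HX HA Hinj S S_X A_S).
  - apply (inverse_bound HX HA Hinj S S_X A_S).
  - intros f Hf. split; auto.
    apply (op_inj HX HA Hinj); auto.
    + apply S_X, (op_X HA); auto.
    + apply A_S, (op_X HA); auto.
Qed.

Lemma invertible_surj : invertible_op X N A -> forall f, X f -> exists g, X g /\ eqD (A g) f.
Proof.
  intros [S [HS H]] f Hf. exists (S f). split; [now apply (op_X HS)|now apply H].
Qed.

Lemma invertible_lower_bound : invertible_op X N A ->
  exists c, (0 < c)%R /\ forall f, X f -> (N f <= c * N (A f))%R.
Proof.
  intros [S [HS H]]. destruct (op_bound HX HS) as [c [Hc HB]]. exists c. split; auto.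
  intros f Hf. rewrite (N_ext HX (S (A f)) f).
  - apply HB. now apply (op_X HA).
  - apply (op_X HS). now apply (op_X HA).
  - now apply H.
Qed.

Lemma lower_bound_inj c : (forall f, X f -> (N f <= c * N (A f))%R) ->
  forall f, X f -> eqD (A f) fzero -> eqD f fzero.
Proof.
  intros H f Hf E. apply (N_eq_0 HX); auto. apply Rle_antisym; [|now apply (N_ge_0 HX)].
  eapply Rle_trans; [now apply H|]. rewrite (N_ext HX fzero); [|apply (X_zero HX)|now apply eqD_sym].
  rewrite (N_zero HX). lra.
Qed.

End Invertibility.

(** * Dense rotations and vanishing of holomorphic functions *)

Lemma pigeonhole (f : nat -> nat) n : (forall i, (i <= n)%nat -> (f i < n)%nat) ->
  exists i j, (i < j <= n)%nat /\ f i = f j.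
Proof.
  intros Hf. apply NNPP. intros HN.
  assert (ND : NoDup (map f (seq 0 (S n)))).
  { apply NoDup_map_NoDup_ForallPairs; [|apply seq_NoDup].
    intros x y Hx Hy E. apply in_seq in Hx, Hy.
    destruct (Nat.lt_trichotomy x y) as [L|[L|L]]; auto; exfalso; apply HN.
    - exists x, y. split; auto; lia.
    - exists y, x. split; auto; lia. }
  apply (NoDup_incl_length (l' := seq 0 n)) in ND.
  - rewrite length_map, !length_seq in ND. lia.
  - intros y Hy. apply in_map_iff in Hy. destruct Hy as [x [<- Hx]].
    apply in_seq in Hx. apply in_seq. specialize (Hf x). lia.
Qed.

Section Rotation.

Context (b : C).
Hypothesis Hb : Cmod b = 1%R.
Hypothesis Hbn : forall n, (1 <= n)%nat -> b ^ n <> 1.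

(** Dirichlet's argument: cut the angles into cells of length [del]. Two powers share a cell, and
    their quotient is a power of small angle, nonzero because no positive power of [b] is 1. *)
Lemma unimodular_small_power (del : R) : (0 < del)%R ->
  exists n phi, b ^ n = cis phi /\ phi <> 0%R /\ (Rabs phi < del)%R.
Proof.
  intros Hd. pose proof PI_RGT_0 as HPI.
  destruct (functional_choice (fun k t => (- PI <= t <= PI)%R /\ b ^ k = cis t)) as [t Ht].
  { intros k. destruct (cis_surj (b ^ k)) as [t Ht]; [now rewrite Cmod_pow, Hb, pow1|].
    exists t. exact Ht. }
  destruct (functional_choice (fun k c => (INR c <= (t k + PI) / del < INR c + 1)%R)) as [c Hc].
  { intros k. destruct (nfloor_ex ((t k + PI) / del)) as [c Hc].
    - apply Rmult_le_pos; [destruct (Ht k); lra|]. left. now apply Rinv_0_lt_compat.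
    - exists c. exact Hc. }
  destruct (INR_unbounded (2 * PI / del)) as [M HM].
  destruct (pigeonhole c M) as (i & j & Hij & E).
  { intros i _. apply INR_lt. eapply Rle_lt_trans; [apply Hc|]. eapply Rle_lt_trans; [|exact HM].
    apply Rmult_le_compat_r; [left; now apply Rinv_0_lt_compat|]. destruct (Ht i). lra. }
  destruct (Ht i) as [_ Ei]. destruct (Ht j) as [_ Ej].
  pose proof (Hc i) as Ci. pose proof (Hc j) as Cj. rewrite <- E in Cj.
  assert (D : b ^ (j - i) = cis (t j - t i)).
  { assert (X : b ^ (j - i) * cis (t i) = cis (t j - t i) * cis (t i)).
    { rewrite <- Ei at 1. rewrite <- Cpow_add_r, <- cis_plus.
      replace (j - i + i)%nat with j by lia. rewrite Ej. f_equal. ring. }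
    pose proof (cis_neq_0 (t i)) as NZ.
    replace (b ^ (j - i)) with ((b ^ (j - i) * cis (t i)) / cis (t i)) by (field; auto).
    rewrite X. field; auto. }
  exists (j - i)%nat, (t j - t i)%R. split; auto. split.
  - intros Z. apply (Hbn (j - i)); [lia|]. now rewrite D, Z, cis_0.
  - apply Rabs_def1.
    + apply Rmult_lt_reg_r with (/ del)%R; [now apply Rinv_0_lt_compat|].
      rewrite Rinv_r by lra. unfold Rdiv in *. lra.
    + apply Rmult_lt_reg_r with (/ del)%R; [now apply Rinv_0_lt_compat|].
      replace (- del * / del)%R with (-1)%R by (field; lra). unfold Rdiv in *. lra.
Qed.

Lemma unimodular_orbit_dense (u : C) (eps : R) : Cmod u = 1%R -> (0 < eps)%R ->
  exists n, (Cmod (b ^ n - u) < eps)%R.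
Proof.
  intros Hu He. pose proof PI_RGT_0 as HPI.
  destruct (unimodular_small_power eps He) as (n & phi & E & Hphi & Hsmall).
  destruct (cis_surj u Hu) as [tau [Ht Eu]].
  (* Only positive multiples of [phi] are available, so the target angle is moved by 2 pi to have
     the sign of [phi]. *)
  assert (exists tau', u = cis tau' /\ (0 <= tau' / phi)%R) as [tau' [Eu' Hq]].
  { destruct (Rlt_dec 0 phi) as [P|P].
    - exists (tau + 2 * PI)%R. split; [rewrite cis_plus, cis_2PI, Eu; ring|].
      apply Rmult_le_pos; [lra|]. left. now apply Rinv_0_lt_compat.
    - exists (tau + - (2 * PI))%R. split.
      + assert (X : cis (- (2 * PI)) = 1).
        { unfold cis. now rewrite cos_neg, sin_neg, cos_2PI, sin_2PI, Ropp_0. }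
        rewrite cis_plus, X, Eu. ring.
      + replace ((tau + - (2 * PI)) / phi)%R with ((2 * PI - tau) * / (- phi))%R by (field; auto).
        apply Rmult_le_pos; [lra|]. left. apply Rinv_0_lt_compat. lra. }
  destruct (nfloor_ex _ Hq) as [k Hk].
  exists (n * k)%nat. rewrite Cpow_mult_r, E, cis_pow, Eu'.
  eapply Rle_lt_trans; [apply cis_lipschitz|]. eapply Rle_lt_trans; [|exact Hsmall].
  replace (INR k * phi - tau')%R with ((INR k - tau' / phi) * phi)%R by (field; auto).
  rewrite Rabs_mult. rewrite <- (Rmult_1_l (Rabs phi)) at 2.
  apply Rmult_le_compat_r; [apply Rabs_pos|]. apply Rabs_le. lra.
Qed.

End Rotation.

Lemma holD_vanish_at f w : holD f -> inD w ->
  (forall eps, (0 < eps)%R -> exists z, (Cmod (z - w) < eps)%R /\ f z = 0) -> f w = 0.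
Proof.
  intros Hf Hw H. apply Cmod_eq_0. apply small_eq_0; [apply Cmod_ge_0|]. intros eps He.
  destruct (cdiff_cont f w (proj1 (holD_cdiff f) Hf w Hw) eps He) as [del [Hd K]].
  destruct (H del Hd) as [z [Hz E]]. specialize (K z Hz). rewrite E in K.
  replace (0 - f w) with (- f w) in K by ring. rewrite Cmod_opp in K. lra.
Qed.

Lemma holD_vanish_origin f : holD f -> (forall z, inD z -> z <> 0 -> f z = 0) -> eqD f fzero.
Proof.
  intros Hf H z Hz. unfold fzero. destruct (excluded_middle_informative (z = 0)) as [->|N]; auto.
  apply holD_vanish_at; auto. intros eps He.
  set (x := (Rmin eps 1 / 2)%R).
  assert (0 < Rmin eps 1)%R by (apply Rmin_pos; lra).
  pose proof (Rmin_l eps 1). pose proof (Rmin_r eps 1).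
  assert (Hx : Cmod (RtoC x) = x) by (rewrite Cmod_R, Rabs_pos_eq; unfold x; lra).
  exists (RtoC x). replace (RtoC x - 0) with (RtoC x) by ring. rewrite Hx. split; [unfold x; lra|].
  apply H.
  - unfold inD. rewrite Hx. unfold x; lra.
  - intros E. apply RtoC_inj in E. unfold x in E. lra.
Qed.

(** A Schwarz lemma of order [n]: apply [holD_bound] to [g], which is at most M/r^n on the
    circle. *)
Lemma holD_divisible_bound f g n w r M :
  holD g -> (forall z, inD z -> f z = z ^ n * g z) -> (Cmod w < r < 1)%R ->
  (forall z, Cmod z = r -> (Cmod (f z) <= M)%R) ->
  (Cmod (f w) <= 2 * r / (r - Cmod w) * M * (Cmod w / r) ^ n)%R.
Proof.
  intros Hg E Hw HM. pose proof (Cmod_ge_0 w) as W0.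
  rewrite E by (unfold inD; lra). rewrite Cmod_mult, Cmod_pow.
  assert (P : (0 < r ^ n)%R) by (apply pow_lt; lra).
  pose proof (holD_bound g w r (M / r ^ n) Hg Hw) as B.
  replace (2 * r / (r - Cmod w) * M * (Cmod w / r) ^ n)%R
    with (Cmod w ^ n * (2 * r / (r - Cmod w) * (M / r ^ n)))%R.
  - apply Rmult_le_compat_l; [now apply pow_le|]. apply B.
    intros z Hz. apply Rmult_le_reg_l with (r ^ n)%R; auto.
    replace (r ^ n * (M / r ^ n))%R with M by (field; lra).
    rewrite <- Hz at 1. rewrite <- Cmod_pow, <- Cmod_mult, <- E by (unfold inD; lra). auto.
  - unfold Rdiv. rewrite Rpow_mult_distr, pow_inv. ring.
Qed.

Lemma inD_between w : inD w -> exists r, (Cmod w < r < 1)%R.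
Proof. intros H. exists ((Cmod w + 1) / 2)%R. unfold inD in H. lra. Qed.

Lemma holD_divisible_zero f : holD f ->
  (forall n, exists g, holD g /\ forall z, inD z -> f z = z ^ n * g z) -> eqD f fzero.
Proof.
  intros Hf H w Hw. destruct (inD_between w Hw) as [r Hr]. pose proof (Cmod_ge_0 w) as W0.
  destruct (cont_circ_bounded f r ltac:(lra) (holD_cont_circ f r Hf ltac:(lra))) as [M [_ HM]].
  apply Cmod_eq_0. apply small_eq_0; [apply Cmod_ge_0|]. intros eps He.
  destruct (pow_small (Cmod w / r) (2 * r / (r - Cmod w) * M) eps) as [n Hn]; auto.
  { split; [apply Rmult_le_pos; [auto|left; apply Rinv_0_lt_compat; lra]|].
    apply Rmult_lt_reg_r with r; [lra|]. unfold Rdiv. rewrite Rmult_assoc, Rinv_l; lra. }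
  destruct (H n) as [g [Hg E]]. specialize (Hn n (Nat.le_refl n)).
  pose proof (holD_divisible_bound f g n w r M Hg E Hr HM). lra.
Qed.

(** [holD_bound] gives 0 inside the circle, so f/z^n is holomorphic for every [n], and a zero of
    infinite order at 0 forces f = 0 on the whole disc. *)
Lemma holD_vanish_circle f r : holD f -> (0 < r < 1)%R ->
  (forall z, Cmod z = r -> f z = 0) -> eqD f fzero.
Proof.
  intros Hf Hr H.
  assert (In : forall z, (Cmod z < r)%R -> f z = 0).
  { intros z Hz. apply Cmod_eq_0. apply Rle_antisym; [|apply Cmod_ge_0].
    eapply Rle_trans; [apply (holD_bound f z r 0); auto; try lra|].
    - intros y Hy. rewrite (H y Hy), Cmod_0. lra.
    - lra. }
  apply holD_divisible_zero; auto. intros n. exists (fun z => f z / z ^ n).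
  assert (F0 : f 0 = 0) by (apply In; rewrite Cmod_0; lra).
  split.
  - apply holD_cdiff. intros z Hz. destruct (excluded_middle_informative (z = 0)) as [->|N].
    + apply (cdiff_ext_loc (fun _ => 0) _ 0 r); [lra| |apply cdiff_const].
      intros y Hy. replace (y - 0) with y in Hy by ring. rewrite (In y Hy). unfold Cdiv. ring.
    + apply cdiff_div; [now apply Cpow_nz|now apply holD_cdiff|apply cdiff_pow].
  - intros z Hz. destruct (excluded_middle_informative (z = 0)) as [->|N].
    + rewrite F0. unfold Cdiv. ring.
    + field. now apply Cpow_nz.
Qed.

(** * Resolvents *)

Section Resolvent.

Context {X : (C -> C) -> Prop} {N : (C -> C) -> R}.
Hypothesis HX : banach_subspace_Hol X N.
Context {T : (C -> C) -> (C -> C)}.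
Hypothesis HT : bounded_op X N T.

Lemma bounded_op_scal a S : bounded_op X N S -> bounded_op X N (fun f => fscal a (S f)).
Proof.
  intros HS. split; [|split; [|split]].
  - intros f Hf. now apply (X_scal HX), (op_X HS).
  - intros f g Hf E z Hz. unfold fscal. now rewrite (op_ext HS f g Hf E z Hz).
  - intros c f g Hf Hg z Hz. unfold fscal at 1. rewrite (op_lin HS) by auto.
    unfold fadd, fscal. ring.
  - destruct (op_bound HX HS) as [c [_ Hc]]. exists (Cmod a * c)%R. intros f Hf.
    rewrite (N_scal HX) by now apply (op_X HS).
    rewrite Rmult_assoc. apply Rmult_le_compat_l; [apply Cmod_ge_0|auto].
Qed.

Lemma iter_X S n f : bounded_op X N S -> X f -> X (Nat.iter n S f).
Proof. intros HS Hf. induction n; simpl; auto. now apply (op_X HS). Qed.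

Lemma iter_ext S n f g : bounded_op X N S -> X f -> eqD f g -> eqD (Nat.iter n S f) (Nat.iter n S g).
Proof.
  intros HS Hf E. induction n; simpl; auto.
  apply (op_ext HS); auto. now apply iter_X.
Qed.

Lemma iter_contraction S q : bounded_op X N S -> (0 <= q)%R ->
  (forall f, X f -> (N (S f) <= q * N f)%R) ->
  forall n f, X f -> (N (Nat.iter n S f) <= 1 * q ^ n * N f)%R.
Proof.
  intros HS Hq H n f Hf. induction n as [|n IH]; simpl; [lra|].
  eapply Rle_trans; [apply H; now apply iter_X|].
  apply (Rmult_le_compat_l q) in IH; auto. lra.
Qed.

(** With S = (T - mu)^-1 one has (T - nu) S = 1 - K for K = (nu - mu) S, and the radius 1/(2c) makes
    the norm of K at most 1/2. *)
Lemma resolvent_set_open mu : invertible_op X N (shift T mu) ->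
  exists del, (0 < del)%R /\ forall nu, (Cmod (nu - mu) < del)%R -> invertible_op X N (shift T nu).
Proof.
  intros [S [HS H]]. destruct (op_bound HX HS) as [c [Hc HB]].
  exists (/ (2 * c))%R. split; [apply Rinv_0_lt_compat; lra|]. intros nu Hnu.
  set (K := fun f => fscal (nu - mu) (S f)).
  assert (HK : bounded_op X N K) by now apply bounded_op_scal.
  assert (Kq : forall f, X f -> (N (K f) <= / 2 * N f)%R).
  { intros f Hf. unfold K. rewrite (N_scal HX) by now apply (op_X HS).
    replace (/ 2 * N f)%R with (/ (2 * c) * (c * N f))%R by (field; lra).
    apply Rmult_le_compat; [apply Cmod_ge_0|apply (N_ge_0 HX); now apply (op_X HS)|lra|auto]. }
  assert (HTm : forall m, bounded_op X N (shift T m)) by (intros; now apply shift_bounded).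
  apply (bijective_invertible HX (HTm nu)).
  - intros g Hg E.
    apply (neumann_inj HX HK 1 (/ 2) ltac:(lra) (iter_contraction K (/ 2) HK ltac:(lra) Kq)); auto.
    intros z Hz. unfold K.
    assert (E2 : eqD (shift T mu g) (fscal (nu - mu) g)).
    { intros y Hy. specialize (E y Hy). unfold shift, fadd, fscal, fzero in *.
      replace (T g y) with ((T g y + - nu * g y) + nu * g y) by ring. rewrite E. ring. }
    rewrite <- (op_scal HX HS (nu - mu) g Hg z Hz).
    rewrite <- (op_ext HS _ _ (op_X (HTm mu) g Hg) E2 z Hz). apply H; auto.
  - intros f Hf.
    destruct (neumann_surj HX HK 1 (/ 2) ltac:(lra) (iter_contraction K (/ 2) HK ltac:(lra) Kq) f Hf)
      as [h [Hh E]].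
    exists (S h). split; [now apply (op_X HS)|]. intros z Hz. rewrite <- (E z Hz).
    destruct (H h Hh) as [_ H2]. specialize (H2 z Hz).
    unfold shift, K, fsub, fadd, fscal in *.
    replace (T (S h) z) with ((T (S h) z + - mu * S h z) + mu * S h z) by ring.
    rewrite H2. ring.
Qed.

(** T - mu = -mu (1 - T/mu), and the powers of T/mu decay like (r/|mu|)^n. *)
Lemma outer_resolvent c r mu : (0 <= r < Cmod mu)%R ->
  (forall n f, X f -> (N (Nat.iter n T f) <= c * r ^ n * N f)%R) ->
  invertible_op X N (shift T mu).
Proof.
  intros Hr HP.
  assert (Hmu : mu <> 0) by (intros ->; rewrite Cmod_0 in Hr; lra).
  set (K := fun f => fscal (/ mu) (T f)).
  assert (HK : bounded_op X N K) by now apply bounded_op_scal.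
  assert (EK : forall n f, X f -> eqD (Nat.iter n K f) (fscal (/ mu ^ n) (Nat.iter n T f))).
  { intros n f Hf. induction n as [|n IH]; intros z Hz.
    - simpl. unfold fscal. field.
    - simpl Nat.iter. unfold K at 1. unfold fscal at 1.
      rewrite (op_ext HT _ _ (iter_X K n f HK Hf) IH z Hz).
      rewrite (op_scal HX HT) by (auto; now apply iter_X).
      unfold fscal. rewrite Cpow_S. field. split; auto. now apply Cpow_nz. }
  assert (Hq : (0 <= r / Cmod mu < 1)%R).
  { split; [apply Rmult_le_pos; [lra|left; apply Rinv_0_lt_compat; lra]|].
    apply Rmult_lt_reg_r with (Cmod mu); [lra|]. unfold Rdiv. rewrite Rmult_assoc, Rinv_l; lra. }
  assert (HKP : forall n f, X f -> (N (Nat.iter n K f) <= c * (r / Cmod mu) ^ n * N f)%R).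
  { intros n f Hf.
    rewrite (N_ext HX (fscal (/ mu ^ n) (Nat.iter n T f)));
      [|apply (X_scal HX); now apply iter_X|now apply eqD_sym, EK].
    rewrite (N_scal HX), Cmod_inv, Cmod_pow by (try apply Cpow_nz; auto; now apply iter_X).
    assert (P : (0 < Cmod mu ^ n)%R) by (apply pow_lt; lra).
    unfold Rdiv. rewrite Rpow_mult_distr, pow_inv.
    replace (c * (r ^ n * / Cmod mu ^ n) * N f)%R with (/ Cmod mu ^ n * (c * r ^ n * N f))%R by ring.
    apply Rmult_le_compat_l; [left; now apply Rinv_0_lt_compat|auto]. }
  apply (bijective_invertible HX (shift_bounded HX HT mu)).
  - intros g Hg E. apply (neumann_inj HX HK c _ Hq HKP); auto.
    intros z Hz. specialize (E z Hz). unfold shift, K, fadd, fscal, fzero in *.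
    replace (T g z) with ((T g z + - mu * g z) + mu * g z) by ring. rewrite E. field. auto.
  - intros f Hf.
    destruct (neumann_surj HX HK c _ Hq HKP (fscal (- / mu) f)) as [g [Hg E]].
    { now apply (X_scal HX). }
    exists g. split; auto. intros z Hz. specialize (E z Hz).
    unfold shift, K, fsub, fadd, fscal in *.
    transitivity (- mu * (g z + (-1) * (/ mu * T g z))); [field; auto|].
    rewrite E. field. auto.
Qed.

(** Each inverse gives a lower bound that survives, with twice the constant, on a small arc;
    compactness of the circle makes it uniform. *)
Lemma circle_lower_bound r : (0 < r)%R ->
  (forall mu, Cmod mu = r -> invertible_op X N (shift T mu)) ->
  exists M, (0 < M)%R /\ forall mu, Cmod mu = r -> forall g, X g ->
    (N g <= M * N (shift T mu g))%R.
Proof.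
  intros Hr H.
  assert (Cp : forall t, Cmod (polar r t) = r) by (intros; rewrite Cmod_polar, Rabs_pos_eq; lra).
  assert (Loc : forall t, exists c, (0 < c)%R /\
    forall g, X g -> (N g <= c * N (shift T (polar r t) g))%R).
  { intros t. apply (invertible_lower_bound HX (shift_bounded HX HT _)), H, Cp. }
  destruct (functional_choice _ Loc) as [c Hc].
  (* The first entry lets half of the norm absorb the perturbation. The second turns the lower bound
     [d] on the gauge into c t <= 1/d, hence into the uniform constant 2/d. *)
  assert (Pd : forall t, (0 < Rmin (/ (2 * c t * r)) (/ c t))%R).
  { intros t. destruct (Hc t) as [P _]. apply Rmin_pos; apply Rinv_0_lt_compat; auto.
    apply Rmult_lt_0_compat; lra. }
  destruct (compactness_value_1d (- PI) PI (fun t => mkposreal _ (Pd t))) as [d Hd].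
  exists (2 / d)%R. split; [apply Rdiv_lt_0_compat; [lra|apply cond_pos]|].
  intros mu Hmu g Hg. destruct (polar_surj mu) as [x [Hx Ex]]. rewrite Hmu in Ex. subst mu.
  specialize (Hd x Hx). apply NNPP in Hd. destruct Hd as (t & _ & Hxt & Hdt). simpl in *.
  destruct (Hc t) as [Pc Bc]. specialize (Bc g Hg).
  assert (X1 : X (shift T (polar r x) g)) by now apply (op_X (shift_bounded HX HT _)).
  assert (B1 : (N (shift T (polar r t) g) <= N (shift T (polar r x) g) + r * Rabs (x - t) * N g)%R).
  { eapply Rle_trans.
    - apply (N_le_add HX) with (g := shift T (polar r x) g) (h := fscal (polar r x - polar r t) g); auto.
      + now apply (X_scal HX).
      + eqD_ring.
    - apply Rplus_le_compat_l. rewrite (N_scal HX) by auto.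
      apply Rmult_le_compat_r; [now apply (N_ge_0 HX)|].
      eapply Rle_trans; [apply polar_dist|].
      rewrite Rminus_diag, Rabs_R0, (Rabs_pos_eq r) by lra. lra. }
  assert (B2 : (c t * (r * Rabs (x - t)) <= / 2)%R).
  { assert (Rabs (x - t) <= / (2 * c t * r))%R.
    { left. eapply Rlt_le_trans; [exact Hxt|apply Rmin_l]. }
    replace (/ 2)%R with (c t * (r * / (2 * c t * r)))%R by (field; lra).
    apply Rmult_le_compat_l; [lra|]. apply Rmult_le_compat_l; lra. }
  assert (B3 : (c t <= / d)%R).
  { rewrite <- (Rinv_inv (c t)). apply Rinv_le_contravar; [apply cond_pos|].
    eapply Rle_trans; [exact Hdt|apply Rmin_r]. }
  pose proof (N_ge_0 HX g Hg) as Ng. pose proof (N_ge_0 HX _ X1) as Ns.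
  apply Rle_trans with (2 * (c t * N (shift T (polar r x) g)))%R.
  - assert (c t * (r * Rabs (x - t)) * N g <= / 2 * N g)%R by (apply Rmult_le_compat_r; auto).
    assert (c t * N (shift T (polar r t) g)
      <= c t * (N (shift T (polar r x) g) + r * Rabs (x - t) * N g))%R
      by (apply Rmult_le_compat_l; lra).
    lra.
  - unfold Rdiv. rewrite Rmult_assoc. apply Rmult_le_compat_l; [lra|].
    apply Rmult_le_compat_r; auto.
Qed.

End Resolvent.

(** * Sums over the L-th roots of r^L *)

Fixpoint csum (u : nat -> C) (n : nat) : C :=
  match n with O => 0 | S n => csum u n + u n end.

Lemma csum_ext u v n : (forall k, (k < n)%nat -> u k = v k) -> csum u n = csum v n.
Proof. intros H. induction n; simpl; auto. rewrite H, IHn; auto. Qed.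

Lemma csum_plus u v n : csum (fun k => u k + v k) n = csum u n + csum v n.
Proof. induction n; simpl; [ring|]. rewrite IHn. ring. Qed.

Lemma csum_scal a u n : csum (fun k => a * u k) n = a * csum u n.
Proof. induction n; simpl; [ring|]. rewrite IHn. ring. Qed.

Lemma csum_const a n : csum (fun _ => a) n = RtoC (INR n) * a.
Proof.
  induction n; [simpl; ring|]. change (csum (fun _ => a) n + a = RtoC (INR (S n)) * a).
  rewrite IHn, S_INR, RtoC_plus. ring.
Qed.

Lemma csum_geometric q n : (q - 1) * csum (fun k => q ^ k) n = q ^ n - 1.
Proof.
  induction n; [simpl; ring|]. simpl csum. rewrite Cpow_S.
  transitivity ((q - 1) * csum (fun k => q ^ k) n + (q - 1) * q ^ n); [ring|]. rewrite IHn. ring.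
Qed.

Lemma csum_double u n : csum u (2 * n) = csum (fun k => u (2 * k)%nat + u (2 * k + 1)%nat) n.
Proof.
  induction n as [|n IH]; [reflexivity|]. replace (2 * S n)%nat with (S (S (2 * n))) by lia.
  change (csum u (S (S (2 * n)))) with (csum u (2 * n) + u (2 * n)%nat + u (S (2 * n))).
  rewrite IH. cbn [csum]. rewrite Nat.add_1_r. ring.
Qed.

Definition node (r : R) (L k : nat) : C := polar r (2 * PI * INR k / INR L).

Lemma node_pow r L k p :
  node r L k ^ p = RtoC (r ^ p) * cis (2 * PI * INR p / INR L) ^ k.
Proof.
  unfold node, polar. rewrite Cpow_mult_l, RtoC_pow, !cis_pow. f_equal. f_equal.
  unfold Rdiv. ring.
Qed.

Lemma node_pow_L r L k : (0 < L)%nat -> node r L k ^ L = RtoC (r ^ L).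
Proof.
  intros HL. apply lt_0_INR in HL. rewrite node_pow.
  replace (2 * PI * INR L / INR L)%R with (2 * PI)%R by (field; lra).
  rewrite cis_2PI, Cpow_1_l. ring.
Qed.

(** A geometric sum whose ratio has angle strictly between 0 and 2 pi, so it is not 1, while its
    L-th power is 1. *)
Lemma node_sum_pow r L p : (0 < p < L)%nat -> csum (fun k => node r L k ^ p) L = 0.
Proof.
  intros Hp. pose proof PI_RGT_0 as HPI.
  assert (HL : (0 < INR L)%R) by (apply lt_0_INR; lia).
  assert (Pp : (0 < INR p)%R) by (apply lt_0_INR; lia).
  assert (PL : (INR p < INR L)%R) by (apply lt_INR; lia).
  set (x := (2 * PI * INR p / INR L)%R).
  rewrite (csum_ext _ (fun k => RtoC (r ^ p) * cis x ^ k)) by (intros; apply node_pow).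
  rewrite csum_scal.
  assert (Q : cis x - 1 <> 0).
  { intros E. assert (C1 : cos x = 1%R).
    { assert (E' : cis x = 1) by (replace (cis x) with ((cis x - 1) + 1) by ring; rewrite E; ring).
      now apply (f_equal fst) in E'. }
    assert (Hx : (0 < x / 2 < PI)%R).
    { unfold x. replace (2 * PI * INR p / INR L / 2)%R with (PI * (INR p / INR L))%R by (field; lra).
      assert (0 < INR p / INR L)%R by (apply Rdiv_lt_0_compat; lra).
      assert (INR p / INR L < 1)%R.
      { apply Rmult_lt_reg_r with (INR L); [lra|]. unfold Rdiv. rewrite Rmult_assoc, Rinv_l; lra. }
      split; [now apply Rmult_lt_0_compat|]. rewrite <- (Rmult_1_r PI) at 2.
      apply Rmult_lt_compat_l; lra. }
    pose proof (sin_gt_0 (x / 2) ltac:(lra) ltac:(lra)) as S.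
    replace x with (2 * (x / 2))%R in C1 by field. rewrite cos_2a_sin in C1. nra. }
  assert (E : cis x ^ L = 1).
  { rewrite cis_pow. unfold x. replace (INR L * (2 * PI * INR p / INR L))%R with (INR p * (2 * PI))%R
      by (field; lra). rewrite <- cis_pow, cis_2PI. apply Cpow_1_l. }
  pose proof (csum_geometric (cis x) L) as G. rewrite E in G.
  set (Z := csum (fun k => cis x ^ k) L) in *.
  assert (EZ : Z = ((cis x - 1) * Z) / (cis x - 1)) by (field; auto).
  rewrite EZ, G. unfold Cdiv. ring.
Qed.

Lemma Cmod_node r L k : (0 <= r)%R -> Cmod (node r L k) = r.
Proof. intros Hr. unfold node. now rewrite Cmod_polar, Rabs_pos_eq. Qed.

(** * Averages of the resolvent over a circle *)

(** All that the averaging argument has to know about the zero of m. Closeness to the ranges is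
    used, and not membership, because h - f is only a limit of elements T^L u. *)
Definition ranges_shrink (X : (C -> C) -> Prop) (N : (C -> C) -> R)
    (T : (C -> C) -> (C -> C)) : Prop :=
  forall d, X d ->
    (forall eps, (0 < eps)%R -> forall n0, exists n u, (n0 <= n)%nat /\ X u /\
       (N (fsub d (Nat.iter n T u)) < eps)%R) ->
    eqD d fzero.

Fixpoint fsum (u : nat -> C -> C) (n : nat) : C -> C :=
  match n with O => fzero | S n => fadd (fsum u n) (u n) end.

Lemma fsum_csum u n z : fsum u n z = csum (fun k => u k z) n.
Proof. induction n; simpl; auto. unfold fadd. now rewrite IHn. Qed.

Section PowerBound.

Context {X : (C -> C) -> Prop} {N : (C -> C) -> R}.
Hypothesis HX : banach_subspace_Hol X N.
Context {T : (C -> C) -> (C -> C)}.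
Hypothesis HT : bounded_op X N T.

Lemma fsum_X u n : (forall k, X (u k)) -> X (fsum u n).
Proof. intros H. induction n; simpl; [apply (X_zero HX)|now apply (X_add HX)]. Qed.

Lemma fsum_bound u n B : (forall k, X (u k)) -> (forall k, (N (u k) <= B)%R) ->
  (N (fsum u n) <= INR n * B)%R.
Proof.
  intros H HB. induction n as [|n IH].
  - simpl. rewrite (N_zero HX). lra.
  - rewrite S_INR. simpl fsum. eapply Rle_trans; [apply (N_add HX); auto; now apply fsum_X|].
    specialize (HB n). lra.
Qed.

Lemma op_fsum u n : (forall k, X (u k)) -> eqD (T (fsum u n)) (fsum (fun k => T (u k)) n).
Proof.
  intros H z Hz. induction n as [|n IH]; [now apply (op_zero HX HT)|].
  simpl. rewrite (op_add HX HT) by (auto; now apply fsum_X). unfold fadd. now rewrite IH.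
Qed.

Lemma iterT_X n f : X f -> X (Nat.iter n T f).
Proof. exact (iter_X T n f HT). Qed.

Lemma iter_sub n f g : X f -> X g ->
  eqD (Nat.iter n T (fsub f g)) (fsub (Nat.iter n T f) (Nat.iter n T g)).
Proof.
  intros Hf Hg. induction n as [|n IH]; [now intros z|]. intros z Hz. simpl.
  rewrite (op_ext HT _ _ (iterT_X n _ (X_sub HX _ _ Hf Hg)) IH z Hz).
  apply (op_sub HT); auto; now apply iterT_X.
Qed.

Lemma iterT_scal n a f : X f -> eqD (Nat.iter n T (fscal a f)) (fscal a (Nat.iter n T f)).
Proof.
  intros Hf. induction n as [|n IH]; [now intros z|]. intros z Hz. simpl.
  rewrite (op_ext HT _ _ (iterT_X n _ (X_scal HX a f Hf)) IH z Hz).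
  apply (op_scal HX HT); auto. now apply iterT_X.
Qed.

Lemma iter_bound n : exists b, (0 <= b)%R /\ forall f, X f -> (N (Nat.iter n T f) <= b * N f)%R.
Proof.
  destruct (op_bound HX HT) as [c [Hc HB]]. exists (c ^ n)%R. split; [apply pow_le; lra|].
  intros f Hf. induction n as [|n IH]; simpl; [lra|].
  eapply Rle_trans; [apply HB; now apply iterT_X|].
  apply (Rmult_le_compat_l c) in IH; lra.
Qed.

Section Circle.

Context (r M : R).
Hypothesis Hr : (0 < r)%R.
Hypothesis HM : (0 < M)%R.
Hypothesis Hlow : forall mu, Cmod mu = r -> forall g, X g -> (N g <= M * N (shift T mu g))%R.

Context (f : C -> C) (G : C -> C -> C).
Hypothesis Hf : X f.
Hypothesis G_X : forall mu, Cmod mu = r -> X (G mu).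
Hypothesis G_res : forall mu, Cmod mu = r -> eqD (shift T mu (G mu)) f.

(** The factor [mu] comes from d mu = i mu dt when the contour integral is written in the angle. *)
Definition res (mu : C) : C -> C := fscal mu (G mu).

(* The average of -mu^(n+1) (T - mu)^-1 f over the L-th roots mu of r^L, an approximation
   to T^n f. *)
Definition moment (n L : nat) : C -> C :=
  fscal (- / RtoC (INR L)) (fsum (fun k => fscal (node r L k ^ n) (res (node r L k))) L).

Lemma node_mod L k : Cmod (node r L k) = r.
Proof. apply Cmod_node. lra. Qed.

Lemma res_X mu : Cmod mu = r -> X (res mu).
Proof. intros H. apply (X_scal HX). auto. Qed.

Lemma res_G_bound mu : Cmod mu = r -> (N (G mu) <= M * N f)%R.
Proof.
  intros H. eapply Rle_trans; [apply (Hlow mu H); auto|]. right. f_equal. symmetry.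
  apply (N_ext HX); [apply (op_X (shift_bounded HX HT _)); auto|now apply G_res].
Qed.

Lemma res_bound mu : Cmod mu = r -> (N (res mu) <= r * M * N f)%R.
Proof.
  intros H. unfold res. rewrite (N_scal HX), H, Rmult_assoc by auto.
  apply Rmult_le_compat_l; [lra|]. now apply res_G_bound.
Qed.

Lemma op_G mu z : Cmod mu = r -> inD z -> T (G mu) z = f z + mu * G mu z.
Proof.
  intros H Hz. rewrite <- (G_res mu H z Hz). unfold shift, fadd, fscal. ring.
Qed.

(** The resolvent identity in the form (T - mu)(G mu - G nu) = (mu - nu) G nu, combined with the
    uniform lower bound on the circle. *)
Lemma res_lipschitz mu nu : Cmod mu = r -> Cmod nu = r ->
  (N (fsub (res mu) (res nu)) <= (r * M + 1) * (M * N f) * Cmod (mu - nu))%R.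
Proof.
  intros H1 H2.
  assert (D : (N (fsub (G mu) (G nu)) <= M * (Cmod (mu - nu) * (M * N f)))%R).
  { eapply Rle_trans; [apply (Hlow mu H1), (X_sub HX); auto|]. apply Rmult_le_compat_l; [lra|].
    rewrite (N_ext HX (fscal (mu - nu) (G nu))).
    - rewrite (N_scal HX) by auto. apply Rmult_le_compat_l; [apply Cmod_ge_0|now apply res_G_bound].
    - apply (X_scal HX); auto.
    - intros z Hz. unfold shift. unfold fadd at 1. rewrite (op_sub HT) by auto.
      unfold fsub, fadd, fscal. rewrite !op_G by auto. ring. }
  eapply Rle_trans.
  - apply (N_le_add HX) with (g := fscal mu (fsub (G mu) (G nu))) (h := fscal (mu - nu) (G nu)).
    + apply (X_scal HX), (X_sub HX); auto.
    + apply (X_scal HX); auto.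
    + unfold res. eqD_ring.
  - rewrite !(N_scal HX) by (auto; apply (X_sub HX); auto). rewrite H1.
    pose proof (res_G_bound nu H2) as B. apply (Rmult_le_compat_l r) in D; [|lra].
    apply (Rmult_le_compat_l (Cmod (mu - nu))) in B; [|apply Cmod_ge_0]. lra.
Qed.

Lemma moment_X n L : X (moment n L).
Proof.
  apply (X_scal HX), fsum_X. intros k. apply (X_scal HX), res_X, node_mod.
Qed.

Lemma Cmod_inv_INR L : (0 < L)%nat -> Cmod (- / RtoC (INR L)) = (/ INR L)%R.
Proof.
  intros HL. apply lt_0_INR in HL. rewrite Cmod_opp, Cmod_inv, Cmod_R, Rabs_pos_eq; try lra.
  intros E. apply RtoC_inj in E. lra.
Qed.

Lemma moment_bound n L : (0 < L)%nat -> (N (moment n L) <= r ^ n * (r * M * N f))%R.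
Proof.
  intros HL. unfold moment.
  assert (XU : forall k, X (fscal (node r L k ^ n) (res (node r L k)))).
  { intros k. apply (X_scal HX), res_X, node_mod. }
  rewrite (N_scal HX), Cmod_inv_INR by (auto; now apply fsum_X).
  pose proof (lt_0_INR L HL) as P.
  eapply Rle_trans.
  - apply Rmult_le_compat_l; [left; now apply Rinv_0_lt_compat|].
    apply (fsum_bound _ _ (r ^ n * (r * M * N f))); auto.
    intros k. rewrite (N_scal HX) by apply res_X, node_mod.
    rewrite Cmod_pow, node_mod. apply Rmult_le_compat_l; [apply pow_le; lra|].
    apply res_bound, node_mod.
  - right. field. lra.
Qed.

(** From T G mu = f + mu G mu. The correction is a power sum of the nodes, which vanishes for n + 1
    < L. *)
Lemma op_moment n L z : (0 < L)%nat -> inD z ->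
  T (moment n L) z =
    moment (S n) L z - / RtoC (INR L) * csum (fun k => node r L k ^ S n) L * f z.
Proof.
  intros HL Hz. unfold moment.
  assert (XU : forall m k, X (fscal (node r L k ^ m) (res (node r L k)))).
  { intros m k. apply (X_scal HX), res_X, node_mod. }
  rewrite (op_scal HX HT) by (auto; now apply fsum_X). unfold fscal at 1.
  rewrite op_fsum by auto. unfold fscal at 2. rewrite !fsum_csum.
  rewrite (csum_ext _ (fun k => f z * node r L k ^ S n + fscal (node r L k ^ S n) (res (node r L k)) z)).
  - rewrite csum_plus, csum_scal. ring.
  - intros k _. rewrite (op_scal HX HT) by (auto; apply res_X, node_mod).
    unfold fscal at 1, res at 1. rewrite (op_scal HX HT) by (auto; apply G_X, node_mod).
    unfold res, fscal. rewrite op_G by (auto; apply node_mod). rewrite Cpow_S. ring.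
Qed.

Lemma moment_0_L L : (0 < L)%nat -> eqD (moment L L) (fscal (RtoC (r ^ L)) (moment 0 L)).
Proof.
  intros HL z Hz. unfold moment, fscal. rewrite !fsum_csum.
  rewrite (csum_ext _ (fun k => RtoC (r ^ L) * (node r L k ^ 0 * res (node r L k) z))).
  - rewrite csum_scal. ring.
  - intros k _. rewrite node_pow_L by auto. simpl. ring.
Qed.

Lemma iter_moment n L : (n < L)%nat -> eqD (Nat.iter n T (moment 0 L)) (moment n L).
Proof.
  intros Hn. induction n as [|n IH]; [now intros z|]. intros z Hz. simpl.
  rewrite (op_ext HT _ _ (iterT_X n _ (moment_X 0 L)) (IH ltac:(lia)) z Hz).
  rewrite op_moment, node_sum_pow by (auto; lia). ring.
Qed.

(** The first L - 1 applications only raise the power of mu; at the last one the nodes' L-th powers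
    sum to L r^L, which leaves one multiple of f. *)
Lemma iter_moment_full L : (0 < L)%nat ->
  eqD (Nat.iter L T (moment 0 L)) (fscal (RtoC (r ^ L)) (fsub (moment 0 L) f)).
Proof.
  intros HL z Hz. destruct L as [|L]; [lia|]. simpl Nat.iter.
  rewrite (op_ext HT _ _ (iterT_X L _ (moment_X 0 (S L))) (iter_moment L (S L) ltac:(lia)) z Hz).
  rewrite op_moment by auto. rewrite (moment_0_L (S L)) by auto.
  rewrite (csum_ext _ (fun _ => RtoC (r ^ S L))) by (intros; now apply node_pow_L).
  rewrite csum_const. pose proof (lt_0_INR (S L) HL) as P.
  unfold fscal, fsub, fadd, fscal. field. intros E. apply RtoC_inj in E. lra.
Qed.

(** The even nodes of the finer average are the old nodes. Each odd node lies within pi r / L of its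
    even neighbour, so the Lipschitz bound applies to each pair. *)
Lemma moment_double L : (0 < L)%nat ->
  (N (fsub (moment 0 (2 * L)) (moment 0 L))
     <= (r * M + 1) * (M * N f) * (r * PI) * / INR L)%R.
Proof.
  intros HL. pose proof (lt_0_INR L HL) as P. pose proof PI_RGT_0 as HPI.
  assert (P' : RtoC (INR L) <> 0) by (intros E; apply RtoC_inj in E; lra).
  assert (E2 : INR (2 * L) = (2 * INR L)%R) by (rewrite mult_INR; simpl; ring).
  assert (Even : forall k, node r (2 * L) (2 * k) = node r L k).
  { intros k. unfold node. f_equal. rewrite E2, mult_INR. simpl. field. lra. }
  set (u := fun k => fsub (res (node r (2 * L) (2 * k + 1))) (res (node r L k))).
  assert (Xu : forall k, X (u k)) by (intros k; apply (X_sub HX); apply res_X, node_mod).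
  rewrite (N_ext HX (fscal (- / RtoC (INR L) * / RtoC 2) (fsum u L))).
  - rewrite (N_scal HX), Cmod_mult, Cmod_inv_INR by (auto; now apply fsum_X).
    rewrite Cmod_inv, Cmod_R, (Rabs_pos_eq 2) by (try lra; intros E; apply RtoC_inj in E; lra).
    set (B := ((r * M + 1) * (M * N f) * (r * PI / INR L))%R).
    apply Rle_trans with (/ INR L * / 2 * (INR L * B))%R.
    + apply Rmult_le_compat_l.
      { apply Rmult_le_pos; left; apply Rinv_0_lt_compat; lra. }
      apply fsum_bound; auto. intros k. unfold u.
      eapply Rle_trans; [apply res_lipschitz; apply node_mod|].
      unfold B. apply Rmult_le_compat_l.
      { pose proof (N_ge_0 HX f Hf). apply Rmult_le_pos; [|apply Rmult_le_pos; lra].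
        assert (0 < r * M)%R by now apply Rmult_lt_0_compat. lra. }
      rewrite <- Even. unfold node. eapply Rle_trans; [apply polar_dist|].
      rewrite Rminus_diag, Rabs_R0, (Rabs_pos_eq r) by lra.
      replace (2 * PI * INR (2 * k + 1) / INR (2 * L) - 2 * PI * INR (2 * k) / INR (2 * L))%R
        with (PI / INR L)%R by (rewrite plus_INR, E2; simpl; field; lra).
      rewrite Rabs_pos_eq by (left; now apply Rdiv_lt_0_compat). unfold Rdiv. lra.
    + unfold B. pose proof (N_ge_0 HX f Hf).
      assert (Q : (0 <= (r * M + 1) * (M * N f) * (r * PI) * / INR L)%R).
      { assert (0 < r * M)%R by now apply Rmult_lt_0_compat.
        assert (0 <= M * N f)%R by (apply Rmult_le_pos; lra).
        assert (0 <= r * PI)%R by (apply Rmult_le_pos; lra).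
        apply Rmult_le_pos; [|left; now apply Rinv_0_lt_compat].
        apply Rmult_le_pos; [|auto]. apply Rmult_le_pos; [lra|auto]. }
      unfold Rdiv. replace (/ INR L * / 2 * (INR L * ((r * M + 1) * (M * N f) * (r * PI * / INR L))))%R
        with (/ 2 * ((r * M + 1) * (M * N f) * (r * PI) * / INR L))%R by (field; lra).
      lra.
  - apply (X_scal HX). now apply fsum_X.
  - intros z Hz. unfold fscal at 1. rewrite (fsum_csum u).
    set (U := csum (fun k => u k z) L).
    unfold moment, fsub, fadd, fscal. rewrite !fsum_csum, csum_double.
    rewrite E2, RtoC_mult.
    rewrite (csum_ext _ (fun k => u k z + 2 * (node r L k ^ 0 * res (node r L k) z))).
    + rewrite csum_plus, csum_scal. fold U. field. auto.
    + intros k _. rewrite Even. unfold u, fsub, fadd, fscal. simpl. ring.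
Qed.

Hypothesis Hshrink : ranges_shrink X N T.

(** The dyadic averages converge to some h, and shrinking ranges give h = f. Then T^n f is the limit
    of the averages with factor mu^n, which are bounded uniformly in L. *)
Lemma iter_bound_from_moments n : (N (Nat.iter n T f) <= r ^ n * (r * M * N f))%R.
Proof.
  set (c := ((r * M + 1) * (M * N f) * (r * PI))%R).
  destruct (geometric_limit HX (fun j => moment 0 (2 ^ j)) c (/ 2) ltac:(lra)) as [h [Hh Lim]].
  { intros j. apply moment_X. }
  { intros j. eapply Rle_trans.
    - change (2 ^ S j)%nat with (2 * 2 ^ j)%nat. apply moment_double.
      pose proof (Nat.pow_nonzero 2 j). lia.
    - fold c. right. f_equal. rewrite pow_INR, pow_inv. reflexivity. }
  set (k := (c / (1 - / 2))%R) in *.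
  assert (Pj : forall j, (j < 2 ^ j)%nat) by (intros; apply Nat.pow_gt_lin_r; lia).
  assert (E : eqD h f).
  { apply (N_sub_eq_0 HX); auto. apply (N_eq_0 HX); [now apply (X_sub HX)|].
    apply Hshrink; [now apply (X_sub HX)|]. intros eps He n0.
    destruct (pow_small (/ 2) k eps ltac:(lra) He) as [j0 Hj0].
    set (j := Nat.max n0 j0). specialize (Hj0 j ltac:(lia)). set (L := (2 ^ j)%nat).
    assert (HL : (j < L)%nat) by apply Pj.
    assert (rL : RtoC (r ^ L) <> 0).
    { intros E. apply RtoC_inj in E. pose proof (pow_lt r L Hr). lra. }
    (* For this u one has T^L u = h_L - f, so h - f - T^L u = h - h_L is small. *)
    exists L, (fscal (/ RtoC (r ^ L)) (moment 0 L)). split; [lia|].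
    assert (XM : X (moment 0 L)) by apply moment_X.
    split; [now apply (X_scal HX)|].
    rewrite (N_ext HX (fsub h (moment 0 L))); [eapply Rle_lt_trans; [apply Lim|exact Hj0]| |].
    - now apply (X_sub HX).
    - intros z Hz.
      assert (V : Nat.iter L T (fscal (/ RtoC (r ^ L)) (moment 0 L)) z = fsub (moment 0 L) f z).
      { rewrite iterT_scal by auto. unfold fscal. rewrite iter_moment_full by (auto; lia).
        unfold fscal. field. auto. }
      change (fsub h (moment 0 L) z = fsub h f z
        + (-1) * Nat.iter L T (fscal (/ RtoC (r ^ L)) (moment 0 L)) z).
      rewrite V. unfold fsub, fadd, fscal. ring. }
  rewrite (N_ext HX (Nat.iter n T h)); [|now apply iterT_X|now apply (iter_ext T n h f HT)].
  (* For fixed [n] any bound on T^n will do: it only serves to pass to the limit in [j]. *)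
  destruct (iter_bound n) as [b [Hb Bb]].
  apply Rnot_lt_le. intros K.
  set (e := (N (Nat.iter n T h) - r ^ n * (r * M * N f))%R) in *.
  assert (He : (0 < e)%R) by (unfold e; lra).
  destruct (pow_small (/ 2) (b * k) e ltac:(lra) He) as [j0 Hj0].
  set (j := Nat.max n j0). specialize (Hj0 j ltac:(lia)).
  assert (Hn : (n < 2 ^ j)%nat) by (specialize (Pj j); lia).
  assert (XM : X (moment 0 (2 ^ j))) by apply moment_X.
  pose proof (Bb _ (X_sub HX _ _ Hh XM)) as B1.
  assert (B2 : (b * N (fsub h (moment 0 (2 ^ j))) <= b * (k * (/ 2) ^ j))%R)
    by (apply Rmult_le_compat_l; auto; apply Lim).
  assert (B3 : (N (Nat.iter n T h)
    <= N (Nat.iter n T (fsub h (moment 0 (2 ^ j)))) + N (moment n (2 ^ j)))%R).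
  { apply (N_le_add HX); [apply iterT_X; auto; now apply (X_sub HX)|apply moment_X|].
    intros z Hz. unfold fadd. rewrite iter_sub by auto. rewrite <- iter_moment by auto.
    unfold fsub, fadd, fscal. ring. }
  pose proof (moment_bound n (2 ^ j) ltac:(lia)). unfold e in *. lra.
Qed.

End Circle.

Theorem resolvent_circle_power_bound r : (0 < r)%R -> ranges_shrink X N T ->
  (forall mu, Cmod mu = r -> invertible_op X N (shift T mu)) ->
  exists c, forall n f, X f -> (N (Nat.iter n T f) <= c * r ^ n * N f)%R.
Proof.
  intros Hr Hs H. destruct (circle_lower_bound HX HT r Hr H) as [M [HM Hlow]].
  exists (r * M)%R. intros n f Hf.
  destruct (functional_choice (fun mu g => Cmod mu = r -> X g /\ eqD (shift T mu g) f)) as [G HG].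
  { intros mu. destruct (Req_dec (Cmod mu) r) as [E|E].
    - destruct (invertible_surj (H mu E) f Hf) as [g Hg]. exists g. auto.
    - exists f. intros. contradiction. }
  replace (r * M * r ^ n * N f)%R with (r ^ n * (r * M * N f))%R by ring.
  apply (iter_bound_from_moments r M Hr HM Hlow f G Hf); auto; intros mu E; now apply HG.
Qed.

End PowerBound.

(** * Weighted composition operators *)

Section WeightedComposition.

Context {X : (C -> C) -> Prop} {N : (C -> C) -> R}.
Hypothesis HX : banach_subspace_Hol X N.
Hypothesis Hi : X (fun _ => 1).
Context {m : C -> C} (Hm : holD m).
Context {beta : C}.
Hypothesis Hbeta : Cmod beta = 1%R.
Hypothesis Hbeta_n : forall n : nat, (1 <= n)%nat -> Cpow beta n <> 1.
Hypothesis HT : bounded_op X N (wcomp m beta).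

Lemma beta_neq_0 : beta <> 0.
Proof. apply Cmod_gt_0. rewrite Hbeta. lra. Qed.

Lemma inD_rotate z : inD z -> inD (beta * z).
Proof. unfold inD. now rewrite Cmod_mult, Hbeta, Rmult_1_l. Qed.

Lemma inD_0 : inD 0.
Proof. unfold inD. rewrite Cmod_0. lra. Qed.

Lemma eval_small z eps : inD z -> (0 < eps)%R -> exists del, (0 < del)%R /\
  forall f, X f -> (N f < del)%R -> (Cmod (f z) < eps)%R.
Proof.
  intros Hz He. destruct (eval_bound HX (Cmod z) (Cmod_ge_0 z) Hz) as [c [Hc HB]].
  exists (eps / (c + 1))%R. split; [apply Rdiv_lt_0_compat; lra|]. intros f Hf HN.
  eapply Rle_lt_trans; [apply HB; auto; lra|].
  apply Rle_lt_trans with ((c + 1) * N f)%R.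
  - apply Rmult_le_compat_r; [now apply (N_ge_0 HX)|lra].
  - apply (Rmult_lt_compat_l (c + 1)) in HN; [|lra].
    replace ((c + 1) * (eps / (c + 1)))%R with eps in HN by (field; lra). exact HN.
Qed.

Lemma iter_wcomp_S n u z :
  Nat.iter (S n) (wcomp m beta) u z = m z * Nat.iter n (wcomp m beta) u (beta * z).
Proof. reflexivity. Qed.

(** T^n u (w) contains the factor m(beta^k w) for each k < n, and for this point beta^k w = z0. *)
Lemma iter_wcomp_backward z0 k n u : m z0 = 0 -> (k < n)%nat ->
  Nat.iter n (wcomp m beta) u (/ beta ^ k * z0) = 0.
Proof.
  intros Hz0. revert n. induction k as [|k IH]; intros n Hn; (destruct n as [|n]; [lia|]);
    rewrite iter_wcomp_S.
  - replace (/ beta ^ 0 * z0) with z0 by (simpl; field). rewrite Hz0. ring.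
  - replace (beta * (/ beta ^ S k * z0)) with (/ beta ^ k * z0).
    + rewrite IH by lia. ring.
    + rewrite Cpow_S. field. split; [apply Cpow_nz|]; apply beta_neq_0.
Qed.

(** The orbit of 0 is a single point, so the zeros accumulate as multiplicity: every application of
    T contributes one factor z. *)
Lemma iter_wcomp_divisible n u : m 0 = 0 -> holD u ->
  exists g, holD g /\ forall z, inD z -> Nat.iter n (wcomp m beta) u z = z ^ n * g z.
Proof.
  intros Hm0 Hu. destruct (holD_div_id m Hm Hm0) as [m1 [Hm1 Em]].
  induction n as [|n [g [Hg Eg]]].
  - exists u. split; auto. intros z Hz. simpl. ring.
  - exists (fun z => beta ^ n * (m1 z * g (beta * z))). split.
    + apply holD_cdiff. intros z Hz. apply cdiff_mult; [apply cdiff_const|].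
      apply cdiff_mult; [now apply holD_cdiff|].
      destruct (proj1 (holD_cdiff g) Hg (beta * z) (inD_rotate z Hz)) as [phi [Hp Ep]].
      exists (fun y => phi (beta * y) * beta). split.
      * apply cont_at_mult; [|apply cont_at_const]. apply (cont_at_compC dC (fun y => beta * y)); auto.
        apply cont_at_mult; [apply cont_at_const|apply cont_at_id].
      * intros y. rewrite (Ep (beta * y)). ring.
    + intros z Hz. rewrite iter_wcomp_S, Em by auto.
      rewrite Eg by now apply inD_rotate. rewrite Cpow_mult_l, Cpow_S. ring.
Qed.

(** If z0 = 0, a nearby T^n u has bounded norm and is divisible by z^n, so its values decay
    geometrically. Otherwise d vanishes at all beta^-k z0, which are dense in the circle through
    z0. *)
Lemma wcomp_ranges_shrink z0 : inD z0 -> m z0 = 0 -> ranges_shrink X N (wcomp m beta).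
Proof.
  intros Hz0 Mz0 d Hd H.
  assert (XI : forall n u, X u -> X (Nat.iter n (wcomp m beta) u)).
  { intros n u. exact (iter_X (wcomp m beta) n u HT). }
  destruct (excluded_middle_informative (z0 = 0)) as [->|N0].
  - intros w Hw. destruct (inD_between w Hw) as [r Hr]. pose proof (Cmod_ge_0 w) as W0.
    apply Cmod_eq_0. apply small_eq_0; [apply Cmod_ge_0|]. intros eps He.
    destruct (eval_bound HX r ltac:(lra) ltac:(lra)) as [c [Hc HB]].
    destruct (eval_small w (eps / 2) Hw ltac:(lra)) as [del [Hdel Hev]].
    destruct (pow_small (Cmod w / r) (2 * r / (r - Cmod w) * (c * (N d + 1))) (eps / 2)) as [n0 Hn0].
    { split; [apply Rmult_le_pos; [auto|left; apply Rinv_0_lt_compat; lra]|].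
      apply Rmult_lt_reg_r with r; [lra|]. unfold Rdiv. rewrite Rmult_assoc, Rinv_l; lra. }
    { lra. }
    (* [del] controls the value of the difference at [w]; the bound 1 keeps the norm of [v] below N
       d + 1 whatever [n] is. *)
    destruct (H (Rmin del 1) ltac:(apply Rmin_pos; lra) n0) as (n & u & Hn & Hu & HN).
    set (v := Nat.iter n (wcomp m beta) u) in *.
    assert (Xv : X v) by now apply XI.
    destruct (iter_wcomp_divisible n u Mz0 (X_holD HX u Hu)) as [g [Hg Eg]].
    assert (Nv : (N v <= N d + 1)%R).
    { eapply Rle_trans; [apply (N_le_add HX v d (fscal (-1) (fsub d v)))|]; auto.
      - now apply (X_scal HX), (X_sub HX).
      - eqD_ring.
      - rewrite (N_scal_m1 HX) by now apply (X_sub HX).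
        pose proof (Rmin_r del 1). lra. }
    assert (B : (Cmod (v w) <= 2 * r / (r - Cmod w) * (c * (N d + 1)) * (Cmod w / r) ^ n)%R).
    { apply (holD_divisible_bound v g); auto. intros z Hz.
      eapply Rle_trans; [apply HB; auto; lra|]. now apply Rmult_le_compat_l. }
    specialize (Hn0 n Hn).
    assert (B2 : (Cmod (fsub d v w) < eps / 2)%R).
    { apply Hev; [now apply (X_sub HX)|]. eapply Rlt_le_trans; [exact HN|apply Rmin_l]. }
    replace (d w) with (fsub d v w + v w) by (unfold fsub, fadd, fscal; ring).
    eapply Rle_trans; [apply Cmod_triangle|]. lra.
  - assert (P0 : (0 < Cmod z0)%R) by now apply Cmod_gt_0.
    assert (Z : forall k, d (/ beta ^ k * z0) = 0).
    { intros k. set (w := / beta ^ k * z0).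
      assert (Hw : inD w).
      { unfold inD, w. rewrite Cmod_mult, Cmod_inv, Cmod_pow, Hbeta, pow1 by apply Cpow_nz, beta_neq_0.
        rewrite Rinv_1, Rmult_1_l. exact Hz0. }
      apply Cmod_eq_0. apply small_eq_0; [apply Cmod_ge_0|]. intros eps He.
      destruct (eval_small w eps Hw He) as [del [Hdel Hev]].
      destruct (H del Hdel (S k)) as (n & u & Hn & Hu & HN).
      replace (d w) with (fsub d (Nat.iter n (wcomp m beta) u) w).
      - left. apply Hev; auto. apply (X_sub HX); auto.
      - unfold fsub, fadd, fscal, w. rewrite (iter_wcomp_backward z0 k n u) by (auto; lia). ring. }
    apply (holD_vanish_circle d (Cmod z0)); [now apply (X_holD HX)|unfold inD in Hz0; lra|].
    intros w Hw. apply (holD_vanish_at d w (X_holD HX d Hd)); [unfold inD in *; lra|].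
    intros eps He.
    assert (Hb1 : Cmod (/ beta) = 1%R).
    { rewrite Cmod_inv by apply beta_neq_0. rewrite Hbeta. apply Rinv_1. }
    destruct (unimodular_orbit_dense (/ beta) Hb1) with (u := w / z0) (eps := (eps / Cmod z0)%R)
      as [k Hk].
    + intros n Hn E. apply (Hbeta_n n Hn). rewrite Cpow_inv in E by apply beta_neq_0.
      replace (beta ^ n) with (/ / beta ^ n) by (field; apply Cpow_nz, beta_neq_0).
      rewrite E. field.
    + rewrite Cmod_div, Hw by auto. field. lra.
    + now apply Rdiv_lt_0_compat.
    + exists (/ beta ^ k * z0). split; auto. rewrite Cpow_inv in Hk by apply beta_neq_0.
      replace (/ beta ^ k * z0 - w) with ((/ beta ^ k - w / z0) * z0)
        by (field; split; auto; apply Cpow_nz, beta_neq_0).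
      rewrite Cmod_mult. apply (Rmult_lt_compat_r (Cmod z0)) in Hk; auto.
      replace (eps / Cmod z0 * Cmod z0)%R with eps in Hk by (field; lra). exact Hk.
Qed.

Lemma wcomp_not_surj z0 : inD z0 -> m z0 = 0 -> ~ invertible_op X N (shift (wcomp m beta) 0).
Proof.
  intros Hz0 Mz0 H. destruct (invertible_surj H _ Hi) as [g [Hg E]].
  specialize (E z0 Hz0). unfold shift, wcomp, fadd, fscal in E. rewrite Mz0 in E.
  apply (f_equal Cmod) in E. replace (0 * g (beta * z0) + - 0 * g z0) with (RtoC 0) in E by ring.
  rewrite Cmod_0, Cmod_1 in E. lra.
Qed.

Hypothesis Hii : forall f f1 : C -> C, holD f -> holD f1 ->
  (forall z, inD z -> f z = z * f1 z) -> (X f <-> X f1).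

Lemma X_mul_id f : X f -> X (fun z => z * f z).
Proof.
  intros Hf. apply (Hii (fun z => z * f z) f); auto; try now apply (X_holD HX).
  apply holD_cdiff. intros z Hz. apply cdiff_mult; [apply cdiff_id|].
  apply holD_cdiff; auto. now apply (X_holD HX).
Qed.

Lemma X_div_id f : X f -> f 0 = 0 -> exists g, X g /\ forall z, inD z -> f z = z * g z.
Proof.
  intros Hf H0. destruct (holD_div_id f (X_holD HX f Hf) H0) as [g [Hg E]].
  exists g. split; auto. now apply (Hii f g (X_holD HX f Hf) Hg E).
Qed.

Lemma mul_id_cancel f g : X f -> X g -> (forall z, inD z -> z * f z = z * g z) -> eqD f g.
Proof.
  intros Hf Hg E.
  assert (Z : eqD (fsub f g) fzero).
  { apply holD_vanish_origin; [now apply (X_holD HX), (X_sub HX)|]. intros z Hz N0.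
    unfold fsub, fadd, fscal.
    replace (f z + (-1) * g z) with ((z * f z - z * g z) / z) by (field; auto).
    rewrite E by auto. unfold Cdiv. ring. }
  intros z Hz. specialize (Z z Hz). unfold fsub, fadd, fscal, fzero in Z.
  replace (f z) with ((f z + (-1) * g z) + g z) by ring. rewrite Z. ring.
Qed.

Lemma shift_mul_id mu f z :
  shift (wcomp m beta) mu (fun y => y * f y) z
    = z * (beta * shift (wcomp m beta) (/ beta * mu) f z).
Proof. unfold shift, wcomp, fadd, fscal. field. apply beta_neq_0. Qed.

(** Solve (T - mu) f = V g. At 0 this reads (m(0) - mu) f(0) = 0, and m(0) differs from mu because
    the constant 1 is in the range of T - mu. So f = V u, and beta u solves the rotated equation. *)
Lemma resolvent_set_rotate mu : invertible_op X N (shift (wcomp m beta) mu) ->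
  invertible_op X N (shift (wcomp m beta) (/ beta * mu)).
Proof.
  intros H. set (T := wcomp m beta) in *.
  assert (HS : forall nu, bounded_op X N (shift T nu)) by (intros; now apply shift_bounded).
  pose proof beta_neq_0 as B0.
  destruct (invertible_lower_bound HX (HS mu) H) as [c [_ Low]].
  pose proof (lower_bound_inj HX c Low) as Inj.
  assert (S0 : forall f, shift T mu f 0 = (m 0 - mu) * f 0).
  { intros f. unfold shift, T, wcomp, fadd, fscal. replace (beta * 0) with (RtoC 0) by ring. ring. }
  assert (M0 : m 0 - mu <> 0).
  { intros E. destruct (invertible_surj H _ Hi) as [g [Hg Eg]].
    specialize (Eg 0 inD_0). rewrite S0, E in Eg. apply (f_equal Cmod) in Eg.
    rewrite Cmult_0_l, Cmod_0, Cmod_1 in Eg. lra. }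
  apply (bijective_invertible HX (HS _)).
  - intros f Hf E. pose proof (X_zero HX) as X0. apply mul_id_cancel; auto.
    intros z Hz. transitivity (RtoC 0); [|unfold fzero; ring].
    apply (Inj (fun y => y * f y)); auto using X_mul_id.
    intros y Hy. unfold T. rewrite shift_mul_id. fold T. rewrite E by auto. unfold fzero. ring.
  - intros g Hg. destruct (invertible_surj H _ (X_mul_id g Hg)) as [f [Hf E]].
    assert (F0 : f 0 = 0).
    { pose proof (E 0 inD_0) as E0. rewrite S0, Cmult_0_l in E0.
      replace (f 0) with (((m 0 - mu) * f 0) / (m 0 - mu)) by (field; auto).
      rewrite E0. unfold Cdiv. ring. }
    destruct (X_div_id f Hf F0) as [u [Hu Eu]].
    exists (fscal beta u). split; [now apply (X_scal HX)|].
    apply mul_id_cancel; auto.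
    { now apply (op_X (HS _)), (X_scal HX). }
    intros z Hz. rewrite (op_scal HX (HS _)) by auto.
    unfold fscal. unfold T. rewrite <- shift_mul_id. fold T. rewrite <- (E z Hz).
    apply (op_ext (HS mu)); auto using X_mul_id. intros y Hy. now rewrite Eu.
Qed.

(** Rotation by 1/beta is the only move at hand. So beta^n mu is first brought close to lam, where
    openness applies, and n such rotations lead back to mu. *)
Lemma resolvent_set_circle lam : invertible_op X N (shift (wcomp m beta) lam) ->
  forall mu, Cmod mu = Cmod lam -> invertible_op X N (shift (wcomp m beta) mu).
Proof.
  intros H mu E. pose proof beta_neq_0 as B0.
  destruct (excluded_middle_informative (mu = 0)) as [->|N0].
  { rewrite Cmod_0 in E. symmetry in E. apply Cmod_eq_0 in E. now subst lam. }
  assert (P : (0 < Cmod mu)%R) by now apply Cmod_gt_0.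
  destruct (resolvent_set_open HX HT lam H) as [del [Hdel Hopen]].
  destruct (unimodular_orbit_dense beta Hbeta Hbeta_n (lam / mu) (del / Cmod mu)) as [n Hn].
  { rewrite Cmod_div, E by auto. field. lra. }
  { now apply Rdiv_lt_0_compat. }
  assert (Back : forall k, invertible_op X N (shift (wcomp m beta) (beta ^ k * mu)) ->
    invertible_op X N (shift (wcomp m beta) mu)).
  { induction k as [|k IH]; intros Hk.
    - replace (beta ^ 0 * mu) with mu in Hk by (simpl; ring). exact Hk.
    - apply IH. apply resolvent_set_rotate in Hk. rewrite Cpow_S in Hk.
      replace (/ beta * (beta * beta ^ k * mu)) with (beta ^ k * mu) in Hk by (field; auto).
      exact Hk. }
  apply (Back n), Hopen.
  replace (beta ^ n * mu - lam) with ((beta ^ n - lam / mu) * mu) by (field; auto).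
  rewrite Cmod_mult. apply (Rmult_lt_compat_r (Cmod mu)) in Hn; auto.
  replace (del / Cmod mu * Cmod mu)%R with del in Hn by (field; lra). exact Hn.
Qed.

End WeightedComposition.

Theorem theorem5p3 (X : (C -> C) -> Prop) (N : (C -> C) -> R)
  (HX : banach_subspace_Hol X N)
  (Hi : X (fun _ => 1))
  (Hii : forall f f1 : C -> C, holD f -> holD f1 ->
           (forall z, inD z -> f z = z * f1 z) -> (X f <-> X f1))
  (Hiii : forall f, X f -> forall b' : C, Cmod b' = 1%R -> X (fun z => f (b' * z)))
  (m : C -> C) (Hm : holD m) (HmX : forall f, X f -> X (fun z => m z * f z))
  (beta : C) (Hbeta : Cmod beta = 1%R)
  (Hbeta_n : forall n : nat, (1 <= n)%nat -> Cpow beta n <> 1)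
  (HT : bounded_op X N (wcomp m beta))
  (Hz0 : exists z0 : C, inD z0 /\ m z0 = 0) :
  forall lam : C, spectrum X N (wcomp m beta) lam <->
    Rbar_le (Finite (Cmod lam)) (spectral_radius X N (wcomp m beta)).
Proof.
  destruct Hz0 as [z0 [Dz0 Mz0]]. intros lam.
  destruct (Lub_Rbar_correct (fun x => exists mu, spectrum X N (wcomp m beta) mu /\ x = Cmod mu))
    as [Ub Lub].
  split; [intros H; apply Ub; now exists lam|]. intros Hle H.
  change (invertible_op X N (shift (wcomp m beta) lam)) in H.
  assert (L0 : lam <> 0).
  { intros ->. exact (wcomp_not_surj Hi z0 Dz0 Mz0 H). }
  assert (P : (0 < Cmod lam)%R) by now apply Cmod_gt_0.
  destruct (resolvent_set_open HX HT lam H) as [del [Hdel Hopen]].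
  (* The relative shrinking of the circle: [/ 2] keeps the new radius positive, and the other bound
     keeps (1 - s) lam within [del] of lam. *)
  set (s := Rmin (/ 2) (del / (2 * Cmod lam))).
  assert (S0 : (0 < s)%R) by (apply Rmin_pos; [lra|apply Rdiv_lt_0_compat; lra]).
  assert (S1 : (s <= / 2)%R) by apply Rmin_l.
  assert (S2 : (s * Cmod lam <= del / 2)%R).
  { replace (del / 2)%R with (del / (2 * Cmod lam) * Cmod lam)%R by (field; lra).
    apply Rmult_le_compat_r; [lra|apply Rmin_r]. }
  set (r := ((1 - s) * Cmod lam)%R).
  assert (Hr : (0 < r < Cmod lam)%R) by (unfold r; nra).
  assert (Cr : Cmod (RtoC (1 - s) * lam) = r).
  { rewrite Cmod_mult, Cmod_R, Rabs_pos_eq by lra. reflexivity. }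
  assert (Hc : forall mu, Cmod mu = r -> invertible_op X N (shift (wcomp m beta) mu)).
  { intros mu Hmu. apply (resolvent_set_circle HX Hi Hbeta Hbeta_n HT Hii (RtoC (1 - s) * lam)).
    - apply Hopen. replace (RtoC (1 - s) * lam - lam) with (- (RtoC s * lam))
        by (rewrite RtoC_minus; ring).
      rewrite Cmod_opp, Cmod_mult, Cmod_R, Rabs_pos_eq by lra. lra.
    - now rewrite Cr. }
  destruct (resolvent_circle_power_bound HX HT r (proj1 Hr)
    (wcomp_ranges_shrink HX Hm Hbeta Hbeta_n HT z0 Dz0 Mz0) Hc) as [c HP].
  (* Powers of T bounded by c r^n leave no spectrum outside the disc of radius r, and r < |lam|. *)
  assert (Le : Rbar_le (spectral_radius X N (wcomp m beta)) (Finite r)).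
  { apply Lub. intros x [mu [Hmu ->]]. simpl. apply Rnot_lt_le. intros K. apply Hmu.
    apply (outer_resolvent HX HT c r mu ltac:(lra) HP). }
  pose proof (Rbar_le_trans _ _ _ Hle Le) as Q. simpl in Q. lra.
Qed.
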